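(* Let $\xi$ be a random variable for which there exist a number $a>0$ and an $\mathbb F$-adapted process $\{z_t,t\in[0,1]\}$, whose paths are almost surely $a$-H\''older continuous on $[0,1]$, such that $z_1=\xi$. Then for any $\alpha\in\big(1-H,\min(1-H+a,\,1/2)\big)$ there exists an $\mathbb F$-adapted process $\psi=\{\psi_t,t\in[0,1]\}$ such that $\|\psi\|_{\alpha,1}<\infty$ almost surely and $\int_0^1\psi_s\,dB^H_s=\xi$ almost surely.
   Context: Let $(\Omega,\mathcal F,\mathsf P)$ be a complete probability space with a $\mathsf P$-complete left-continuous filtration $\mathbb F=\{\mathcal F_t,t\in[0,1]\}$. Let $B^H=\{B^H_t,t\in[0,1]\}$ be a fractional Brownian motion with Hurst parameter $H\in(1/2,1)$, i.e. an $\mathbb F$-adapted centered Gaussian process with $\mathsf E[B^H_tB^H_s]=\frac12(s^{2H}+t^{2H}-|s-t|^{2H})$, with continuous paths. The H\''older constant of $z$ may be random. For $\alpha>0$ and $t\in(0,1]$ define $$\|f\|_{\alpha,t}=\int_0^t\left(\frac{|f(s)|}{s^\alpha}+\int_0^s\frac{|f(s)-f(z)|}{(s-z)^{1+\alpha}}\,dz\right)ds.$$ Integrals with respect to $B^H$ are pathwise generalized Lebesgue--Stieltjes integrals: if $\|f\|_{\alpha,t}<\infty$ for some $\alpha\in(1-H,1)$, then $$\int_0^t f_s\,dB^H_s=\frac{1}{\Gamma(1-\alpha)\Gamma(\alpha)}\int_0^t\left(\frac{f(x)}{x^\alpha}+\alpha\int_0^x\frac{f(x)-f(u)}{(x-u)^{1+\alpha}}du\right)\left(\frac{B^H_t-B^H_x}{(t-x)^{1-\alpha}}+(1-\alpha)\int_x^t\frac{B^H_u-B^H_x}{(u-x)^{2-\alpha}}du\right)dx.$$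 Almost surely, the second factor is bounded in $x$, and the value does not depend on the choice of such $\alpha$. *)

(* Defs.v *)
From HB Require Import structures.
From mathcomp Require Import all_boot all_order all_algebra.
From mathcomp Require Import all_classical all_reals all_analysis.

Set Implicit Arguments.
Unset Strict Implicit.
Unset Printing Implicit Defensive.

Import Order.TTheory GRing.Theory Num.Theory.
Import numFieldNormedType.Exports.

Local Open Scope classical_set_scope.
Local Open Scope ring_scope.

(* Processes and filtrations on the time interval [0, 1] are families indexed
   by all of R; every definition below only looks at indices in [0, 1]. *)

Definition filtration {d : measure_display} {T : measurableType d}
    {R : realType} (F : R -> set (set T)) :=
  (forall t : R, t \in `[0, 1] ->
     sigma_algebra [set: T] (F t) /\ F t `<=` measurable) /\
  (forall s t : R, 0 <= s -> s <= t -> t <= 1 -> F s `<=` F t).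

Definition complete_filtration {d : measure_display} {T : measurableType d}
    {R : realType} (P : probability T R) (F : R -> set (set T)) :=
  forall t : R, t \in `[0, 1] -> P.-negligible `<=` F t.

Definition left_continuous_filtration {T : Type} {R : realType}
    (F : R -> set (set T)) :=
  forall t : R, t \in `]0, 1] -> F t = <<s \bigcup_(s in `[0, t[) F s >>.

Definition adapted {T : Type} {R : realType} (F : R -> set (set T))
    (X : R -> T -> R) :=
  forall t : R, t \in `[0, 1] ->
    forall A : set R, measurable A -> F t (X t @^-1` A).

(* Normal law with mean m and standard deviation s; normal_prob m 0 is not the
   Dirac mass at m, hence the case distinction. *)
Definition gaussian_law {R : realType} (m s : R) (A : set R) : \bar R :=
  if s == 0 then \d_m A else normal_prob m s A.

Definition gaussian_rv {d : measure_display} {T : measurableType d}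
    {R : realType} (P : probability T R) (X : T -> R) :=
  measurable_fun [set: T] X /\
  exists m s : R, forall A : set R, measurable A ->
    P (X @^-1` A) = gaussian_law m s A.

Definition gaussian_process {d : measure_display} {T : measurableType d}
    {R : realType} (P : probability T R) (X : R -> T -> R) :=
  forall (n : nat) (t c : 'I_n -> R), (forall i, t i \in `[0, 1]) ->
    gaussian_rv P (fun w => \sum_(i < n) c i * X (t i) w).

Definition fractional_brownian_motion {d : measure_display}
    {T : measurableType d} {R : realType} (P : probability T R)
    (F : R -> set (set T)) (H : R) (B : R -> T -> R) :=
  [/\ adapted F B,
      gaussian_process P B,
      (forall t : R, t \in `[0, 1] -> ('E_P[B t] = 0)%E),
      (forall s t : R, s \in `[0, 1] -> t \in `[0, 1] ->
         ('E_P[fun w => (B t w * B s w)%R])%E =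
         (2^-1 * (s `^ (2 * H) + t `^ (2 * H) - `|s - t| `^ (2 * H)))%:E) &
      (forall w : T, {within `[0, 1], continuous (fun t => B t w)})].

Definition holder_on_unit {R : realType} (a : R) (f : R -> R) :=
  exists C : R, forall s t : R, s \in `[0, 1] -> t \in `[0, 1] ->
    `|f s - f t| <= C * `|s - t| `^ a.

Definition Gamma {R : realType} (x : R) : R :=
  \int[lebesgue_measure]_(u in `]0, +oo[) (u `^ (x - 1) * expR (- u)).

Definition norm_alpha {R : realType} (alpha : R) (f : R -> R) (t : R) : \bar R :=
  (\int[lebesgue_measure]_(s in `[0%R, t])
     ((`|f s| / s `^ alpha)%:E +
      \int[lebesgue_measure]_(z in `[0%R, s])
        (`|f s - f z| / (s - z) `^ (1 + alpha))%:E))%E.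

(* The library integral of a nonnegative function is also defined, as a lower
   integral, when the function is not measurable, so the finiteness of
   norm_alpha is only meaningful together with the measurability of f. *)
Definition finite_norm_alpha {R : realType} (alpha : R) (f : R -> R) (t : R) :=
  measurable_fun `[0, t] f /\ (norm_alpha alpha f t < +oo)%E.

(* Pathwise generalized Lebesgue-Stieltjes integral of f with respect to g over
   [0, t], computed with the exponent alpha. *)
Definition gLS_integral {R : realType} (alpha : R) (f g : R -> R) (t : R) : R :=
  (Gamma (1 - alpha) * Gamma alpha)^-1 *
  \int[lebesgue_measure]_(x in `[0, t])
    ((f x / x `^ alpha +
      alpha * \int[lebesgue_measure]_(u in `[0, x])
                ((f x - f u) / (x - u) `^ (1 + alpha))) *
     ((g t - g x) / (t - x) `^ (1 - alpha) +
      (1 - alpha) * \int[lebesgue_measure]_(u in `[x, t])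
                      ((g u - g x) / (u - x) `^ (2 - alpha)))).

(* Main.v *)
Require Import Defs.
From HB Require Import structures.
From mathcomp Require Import all_boot all_order all_algebra.
From mathcomp Require Import all_classical all_reals all_analysis.
From mathcomp Require Import measurable_realfun ring lra.

Set Implicit Arguments.
Unset Strict Implicit.
Unset Printing Implicit Defensive.

Import Order.TTheory GRing.Theory Num.Theory.
Import numFieldNormedType.Exports.

Local Open Scope classical_set_scope.
Local Open Scope ring_scope.
(** The integrand is a simple process whose jumps accumulate only at time 1. Put
    t_n = 1 - rho^n and split each stage [t_n, t_{n+1}] into 2^(K n) equal cells.
    With X the increment of B since t_n, integrate 2 X along the grid until X^2
    first reaches the level r_n = 4^-n (t_{n+1} - t_n)^(2H), and 0 afterwards. Up
    to the quadratic variation along the grid the outcome is r_n. Since H > 1/2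
    that variation is negligible for K large, and by the small ball estimate for
    the Gaussian B_{t_{n+1}} - B_{t_n} the level is reached; by Borel-Cantelli
    both hold almost surely for all large n. If V_n is the integral accumulated
    up to t_n, multiplying the integrand of stage n by (z_{t_n} - V_n) / r_n
    therefore brings V_{n+1} close to z_{t_n}, and the Hoelder continuity of z
    gives |z_{t_n} - V_n| = O(rho^(a n)), whence V_n tends to z_1 = xi.

    The jumps of stage n are O(rho^(a n) r_n^(-1/2)), so the series defining the
    norm is dominated by a geometric one of ratio 2^(K+1) rho^(a + 1 - alpha - H),
    which is small for a suitable rho because alpha < 1 - H + a. The fractional
    integral of a single step is evaluated by Fubini on a cut kernel. For the
    almost sure finiteness of the pathwise quantities no modulus of continuity of
    B is needed, only E|B_t - B_s| <= |t - s|^H and alpha > 1 - H. *)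

(** * Power functions and Beta integrals *)

Section calculus.
Context {R : realType}.
Local Notation mu := (@lebesgue_measure R).

Lemma ge0_FTC_oo (f F : R -> R) (a b : R) : a < b ->
  {in `]a, b[, forall x, 0 <= f x} ->
  {in `]a, b[, forall x, is_derive (x : R) (1 : R) F (f x)} ->
  {in `]a, b[, continuous f} ->
  F x @[x --> a^'+] --> F a -> F x @[x --> b^'-] --> F b ->
  (\int[mu]_(x in `]a, b[) (f x)%:E = (F b - F a)%:E)%E.
Proof.
move=> ab f0 dF cf Fa Fb.
pose e n : R := (b - a) / n.+3%:R.
have e0 n : 0 < e n by rewrite divr_gt0// subr_gt0.
have eb n : e n < (b - a) / 2.
  by rewrite ltr_pM2l ?subr_gt0// ltf_pV2 ?posrE// ltr_nat.
have ecvg : e n @[n --> \oo] --> (0 : R).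
  rewrite -[X in _ --> X](mulr0 (b - a)); apply: cvgM; first exact: cvg_cst.
  have := @cvg_harmonic R; rewrite -(cvg_shiftn 2); apply: cvg_trans.
  by apply: near_eq_cvg; near=> n; rewrite /harmonic/= addn2.
have nd : {homo e : n m / (n <= m)%N >-> m <= n}.
  by move=> n m nm; rewrite ler_pM2l ?subr_gt0// lef_pV2 ?posrE// ler_nat !ltnS.
pose I n := `[a + e n, b - e n]%classic.
have UI : \bigcup_n I n = `]a, b[%classic.
  apply/seteqP; split => x.
    move=> [n _]; rewrite /I /= !in_itv/= => /andP[h1 h2].
    by have := e0 n => ?; apply/andP; split; lra.
  rewrite /= in_itv/= => /andP[ax xb].
  have m0 : 0 < Num.min (x - a) (b - x) by rewrite lt_min !subr_gt0 ax xb.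
  have /cvgrPdist_lt/(_ _ m0)[N _ /(_ N (leqnn N))] := ecvg.
  rewrite sub0r normrN gtr0_norm// lt_min => /andP[h1 h2].
  by exists N => //; rewrite /I /= in_itv/=; apply/andP; split; lra.
have Ioo n : I n `<=` `]a, b[%classic.
  by rewrite -UI; exact: bigcup_sup.
have mf : measurable_fun `]a, b[%classic f.
  apply: open_continuous_measurable_fun; first exact: interval_open.
  by move=> x /set_mem; exact: cf.
rewrite -UI.
have : (\int[mu]_(x in I n) (f x)%:E @[n --> \oo] -->
    \int[mu]_(x in \bigcup_n I n) (f x)%:E)%E.
  apply: ge0_nondecreasing_set_cvg_integral => //=.
  - apply/nondecreasing_seqP => n; rewrite subsetEset => x; rewrite /I /= !in_itv/=.
    by have := nd _ _ (leqnSn n) => ? /andP[? ?]; apply/andP; split; lra.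
  - by move=> n; exact: measurable_itv.
  - move=> n; apply/measurable_EFinP; apply: (measurable_funS _ (Ioo n) mf).
    exact: measurable_itv.
  - by move=> n x /Ioo ?; rewrite lee_fin f0.
move=> /(@cvg_lim _ (@ereal_hausdorff R)) <-.
apply/cvg_lim; first exact: ereal_hausdorff.
have FI n : (\int[mu]_(x in I n) (f x)%:E = (F (b - e n) - F (a + e n))%:E)%E.
  have abe : a + e n < b - e n by have := eb n; lra.
  have sub x : x \in `[a + e n, b - e n] -> x \in `]a, b[.
    exact: Ioo.
  rewrite (@continuous_FTC2 _ f F)//.
  - apply: continuous_in_subspaceT => x /set_mem /sub; exact: cf.
  - split.
    + move=> x xab; have /sub xab' : x \in `[a + e n, b - e n].
        by apply: subset_itv_oo_cc.
      by case: (dF _ xab').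
    + apply: cvg_at_right_filter; apply: differentiable_continuous.
      by apply/derivable1_diffP; case: (dF (a + e n)) => //; apply: sub; rewrite in_itv/=; apply/andP; split; lra.
    + apply: cvg_at_left_filter; apply: differentiable_continuous.
      by apply/derivable1_diffP; case: (dF (b - e n)) => //; apply: sub; rewrite in_itv/=; apply/andP; split; lra.
  - move=> x xab; have /sub xab' : x \in `[a + e n, b - e n].
      by apply: subset_itv_oo_cc.
    by case: (dF _ xab') => _; rewrite derive1E.
under eq_fun do rewrite FI.
apply: cvg_EFin; first by apply: nearW.
apply: cvgB.
- move/cvg_at_leftP : Fb; apply; split => [n|]; first by rewrite gtrBl.
  by rewrite -[X in _ --> X](subr0 b); apply: cvgB => //; exact: cvg_cst.
- move/cvg_at_rightP : Fa; apply; split => [n|]; first by rewrite ltrDl.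
  by rewrite -[X in _ --> X](addr0 a); apply: cvgD => //; exact: cvg_cst.
Unshelve. all: by end_near. Qed.

Lemma powRD_gt0 (x r s : R) : 0 < x -> x `^ (r + s) = x `^ r * x `^ s.
Proof. by move=> x0; rewrite powRD// (gt_eqF x0) implybT. Qed.

Lemma is_derive1_continuous (F : R -> R) (x df : R) :
  is_derive x (1 : R) F df -> F y @[y --> x] --> F x.
Proof.
by case=> h _; apply: differentiable_continuous; apply/derivable1_diffP.
Qed.

Lemma is_derive_powRBl (p u x : R) : u < x ->
  is_derive x (1 : R) (fun y => (y - u) `^ p) (p * (x - u) `^ (p - 1)).
Proof.
move=> ux; have xu : 0 < x - u by rewrite subr_gt0.
have h : is_derive (x - u) 1 (fun y : R => y `^ p) (p * (x - u) `^ (p - 1)).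
  exact: is_derive1_powR.
have h2 : is_derive x (1 : R) (fun y => y - u) (1 : R).
  by apply: is_derive_eq; rewrite oppr0 addr0.
by have := @is_derive1_comp _ _ (fun y => y - u) _ _ _ h h2; rewrite mulr1.
Qed.

Lemma is_derive_powRBr (p u x : R) : x < u ->
  is_derive x (1 : R) (fun y => (u - y) `^ p) (- p * (u - x) `^ (p - 1)).
Proof.
move=> ux; have xu : 0 < u - x by rewrite subr_gt0.
have h : is_derive (u - x) 1 (fun y : R => y `^ p) (p * (u - x) `^ (p - 1)).
  exact: is_derive1_powR.
have h2 : is_derive x (1 : R) (fun y => u - y) (-1 : R).
  by rewrite -[X in is_derive _ _ X _]/(cst u - id); apply: is_derive_eq; rewrite sub0r.
by have := @is_derive1_comp _ _ (fun y => u - y) _ _ _ h h2; rewrite mulrN1 mulNr.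
Qed.

Lemma cvg_at_right_powRB (p u : R) : 0 < p ->
  (x - u) `^ p @[x --> u^'+] --> (u - u) `^ p.
Proof.
move=> p0; rewrite subrr powR0 ?gt_eqF//.
apply/cvg_at_rightP => v [vu cv].
have /cvg_at_rightP := powR_cvg0 p0; apply; split=> [n|].
  by rewrite subr_gt0.
by rewrite -(subrr u); apply: cvgB => //; exact: cvg_cst.
Qed.

Lemma cvg_at_left_powRB (p u : R) : 0 < p ->
  (u - x) `^ p @[x --> u^'-] --> (u - u) `^ p.
Proof.
move=> p0; rewrite subrr powR0 ?gt_eqF//.
apply/cvg_at_leftP => v [vu cv].
have /cvg_at_rightP := powR_cvg0 p0; apply; split=> [n|].
  by rewrite subr_gt0.
by rewrite -[X in _ --> X](subrr u); apply: cvgB => //; exact: cvg_cst.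
Qed.

Lemma integral_powRBl (p u a b : R) : a < b -> p != 0 ->
  u < a \/ (u = a /\ 0 < p) ->
  (\int[mu]_(x in `]a, b[) ((x - u) `^ (p - 1))%:E =
   (((b - u) `^ p - (a - u) `^ p) / p)%:E)%E.
Proof.
move=> ab p0 ua.
have ux x : x \in `]a, b[ -> u < x.
  by rewrite in_itv/= => /andP[ax _]; case: ua => [|[->]//]; lra.
have cF x : u < x -> {for x, continuous (fun y => (y - u) `^ p / p)}.
  move=> ?; apply: cvgMr_tmp; apply: is_derive1_continuous.
  exact: is_derive_powRBl.
rewrite (@ge0_FTC_oo _ (fun x => (x - u) `^ p / p))//.
- by rewrite mulrBl.
- by move=> x _; exact: powR_ge0.
- move=> x /ux ?; have h := is_derive_powRBl p (_ : u < x).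
  have -> : (fun x => (x - u) `^ p / p) = p^-1 \*: (fun x => (x - u) `^ p).
    by apply/funext => y /=; rewrite mulrC.
  by apply: is_derive_eq (is_deriveZ _ (h _)) _ => //; rewrite -[_ *: _]/(_ * _) mulrA mulVf ?mul1r.
- move=> x /ux ?; apply: is_derive1_continuous; exact: is_derive_powRBl.
- case: ua => [ua|[-> p_gt0]]; first exact/cvg_at_right_filter/cF.
  by apply: cvgMr_tmp; exact: cvg_at_right_powRB.
- by apply/cvg_at_left_filter/cF; case: ua => [|[->]//]; lra.
Qed.

Lemma integral_powRBr (p u a b : R) : a < b -> p != 0 ->
  b < u \/ (b = u /\ 0 < p) ->
  (\int[mu]_(x in `]a, b[) ((u - x) `^ (p - 1))%:E =
   (((u - a) `^ p - (u - b) `^ p) / p)%:E)%E.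
Proof.
move=> ab p0 ua.
have ux x : x \in `]a, b[ -> x < u.
  by rewrite in_itv/= => /andP[_ xb]; case: ua => [|[<-]//]; lra.
have cF x : x < u -> {for x, continuous (fun y => - ((u - y) `^ p / p))}.
  move=> ?; apply: cvgN; apply: cvgMr_tmp; apply: is_derive1_continuous.
  exact: is_derive_powRBr.
rewrite (@ge0_FTC_oo _ (fun x => - ((u - x) `^ p / p)))//.
- by rewrite opprK addrC mulrBl.
- by move=> x _; exact: powR_ge0.
- move=> x /ux ?; have h := is_derive_powRBr p (_ : x < u).
  have -> : (fun x => - ((u - x) `^ p / p)) = (- p^-1) \*: (fun x => (u - x) `^ p).
    by apply/funext => y /=; rewrite -[_ *: _]/(_ * _) mulNr mulrC.
  by apply: is_derive_eq (is_deriveZ _ (h _)) _ => //; rewrite -[_ *: _]/(_ * _) mulrA mulrNN mulVf ?mul1r.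
- move=> x /ux ?; apply: is_derive1_continuous; exact: is_derive_powRBr.
- by apply/cvg_at_right_filter/cF; case: ua => [|[<-]//]; lra.
- case: ua => [ua|[-> p_gt0]]; first exact/cvg_at_left_filter/cF.
  by apply: cvgN; apply: cvgMr_tmp; exact: cvg_at_left_powRB.
Qed.

(* The ratio ((x - u) / (y - x)) `^ (1 - al) is, up to a constant factor, an
   antiderivative of the product of the two kernels. *)
Lemma integral_powRB_powRB (al u b y : R) : 0 < al < 1 -> u < b -> b < y ->
  (\int[mu]_(x in `]u, b[) ((1 - al) * ((x - u) `^ (- al) * (y - x) `^ (al - 2)))%:E =
   (((b - u) / (y - b)) `^ (1 - al) / (y - u))%:E)%E.
Proof.
move=> /andP[al0 al1] ub yb.
pose F x := ((x - u) `^ (1 - al) * (y - x) `^ (al - 1)) / (y - u).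
have Fb x : u <= x -> x < y -> F x = ((x - u) / (y - x)) `^ (1 - al) / (y - u).
  move=> ux xy; rewrite /F powRM ?subr_ge0// ?invr_ge0 ?subr_ge0; [|lra..].
  by rewrite -[in RHS]powR_inv1 ?subr_ge0; [rewrite -powRrM mulN1r opprB|lra].
have dF x : u < x -> x < y ->
    is_derive x (1 : R) F ((1 - al) * ((x - u) `^ (- al) * (y - x) `^ (al - 2))).
  move=> ux xy.
  have h1 := is_derive_powRBl (1 - al) ux.
  have h2 := is_derive_powRBr (al - 1) xy.
  have -> : F = (y - u)^-1 \*: ((fun x => (x - u) `^ (1 - al)) * (fun x => (y - x) `^ (al - 1))).
    by apply/funext => z; exact: mulrC.
  apply: (is_derive_eq (is_deriveZ _ (is_deriveM h1 h2))).
  rewrite -![_ *: _]/(_ * _).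
  have -> : 1 - al - 1 = - al by ring.
  have -> : al - 1 - 1 = al - 2 by ring.
  have -> : (x - u) `^ (1 - al) = (x - u) * (x - u) `^ (- al).
    by rewrite powRD_gt0 ?subr_gt0// powRr1// subr_ge0 ltW.
  have -> : (y - x) `^ (al - 1) = (y - x) * (y - x) `^ (al - 2).
    rewrite -[X in X * _]powRr1 ?subr_ge0 ?ltW// -powRD_gt0 ?subr_gt0//.
    by congr (_ `^ _); ring.
  by field; rewrite subr_eq0 gt_eqF//; lra.
rewrite (@ge0_FTC_oo _ F)//.
- by congr EFin; rewrite Fb 1?ltW// [X in _ - X]/F subrr powR0 ?mul0r ?subr0//; lra.
- by move=> x _; rewrite !mulr_ge0 ?powR_ge0// subr_ge0 ltW.
- by move=> x; rewrite in_itv/= => /andP[ux xb]; apply: dF; lra.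
- move=> x; rewrite in_itv/= => /andP[ux xb].
  apply: cvgM; first exact: cvg_cst.
  by apply: cvgM; apply: is_derive1_continuous;
   [exact: is_derive_powRBl|apply: is_derive_powRBr; lra].
- apply: cvgMr_tmp; apply: cvgM; first by apply: cvg_at_right_powRB; lra.
  by apply/cvg_at_right_filter/is_derive1_continuous/is_derive_powRBr; lra.
- by apply/cvg_at_left_filter/is_derive1_continuous/dF; lra.
Qed.

End calculus.

Ltac mfun_step :=
  lazymatch goal with
  | |- measurable_fun _ (fun z => EFin _) =>
      apply/measurable_EFinP; rewrite /comp /=
  | |- measurable_fun _ (fun z => _ * _) => apply: measurable_funM
  | |- measurable_fun _ (fun z => _ - _) => apply: measurable_funB
  | |- measurable_fun _ (fun z => _ + _) => apply: measurable_funD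
  | |- measurable_fun _ (fun z => - _) =>
      apply: (measurableT_comp (@oppr_measurable _ setT))
  | |- measurable_fun _ (fun z => `|_ |) =>
      apply: (measurableT_comp (@normr_measurable _ setT))
  | |- measurable_fun _ (fun z => _ `^ ?p) =>
      first [exact: measurable_powR
            | apply: (measurableT_comp (@measurable_powR _ p))]
  | |- measurable_fun _ (fun z => expR _) =>
      apply: (measurableT_comp (@measurable_expR _))
  | |- measurable_fun _ (fun z => fst _) =>
      first [exact: measurable_fst
            | apply: (measurableT_comp measurable_fst)]
  | |- measurable_fun _ (fun z => snd _) =>
      first [exact: measurable_snd
            | apply: (measurableT_comp measurable_snd)]
  | |- measurable_fun _ (fun z => if _ then _ else _) =>
      apply: measurable_fun_ifT
  | |- measurable_fun _ (fun z => _ && _) => apply: measurable_and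
  | |- measurable_fun _ (fun z => _ < _) => apply: measurable_fun_ltr
  | |- measurable_fun _ (fun z => _ <= _) => apply: measurable_fun_ler
  | |- _ => first
    [ assumption | exact: measurable_cst | exact: measurable_id
    | exact: measurable_fst | exact: measurable_snd
    | exact: measurable_expR | exact: oppr_measurable | exact: measurable_powR
    | exact: normr_measurable
    | exact: (measurable_fun_ltr (measurable_cst _) (@measurable_id _ _ _))
    | exact: (measurable_fun_ler (measurable_cst _) (@measurable_id _ _ _))
    | apply: measurable_funM | apply: measurable_funB | apply: measurable_funD]
  end.
Ltac mfun := repeat (first [assumption | mfun_step]).

Section beta.
Context {R : realType}.
Local Notation mu := (@lebesgue_measure R).

Lemma ge0_integral_affine (f : R -> \bar R) (c b : R) : 0 < c ->
  measurable_fun [set: R] f -> (forall x, (0 <= f x)%E) ->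
  (\int[mu]_x f x = c%:E * \int[mu]_x f (c * x + b)%R)%E.
Proof.
move=> c0 mf f0.
pose phi (x : measurableTypeR R) : measurableTypeR R := c * x + b.
have mphi : measurable_fun setT phi by mfun.
pose nu0 := mscale (NngNum (ltW c0)) (pushforward mu phi).
pose nu := nu0 mphi.
have munu A : measurable A -> mu A = nu A.
  apply: lebesgue_measure_unique => _ [[u v] _ <-].
  rewrite /nu/= /nu0 /mscale/= /pushforward/=.
  have -> : phi @^-1` `]u, v] = `](u - b) / c, (v - b) / c]%classic.
    apply/seteqP; split => x /=; rewrite !in_itv/= /phi ltr_pdivrMr// ler_pdivlMr// ltrBlDr lerBrDr mulrC//.
  rewrite !lebesgue_measure_itv/= !lte_fin ltr_pM2r ?invr_gt0// ltrD2r.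
  case: ifPn; rewrite ?mule0// => uv; rewrite -!EFinD -EFinM; congr EFin.
  by field; rewrite gt_eqF.
rewrite (eq_measure_integral (mscale (NngNum (ltW c0)) (pushforward mu phi))); last by move=> A mA _; exact: munu.
rewrite ge0_integral_mscale//=; congr (_ * _)%E.
by rewrite ge0_integral_pushforward//= preimage_setT.
Qed.

Lemma integral_itv_if (i : interval R) (f : R -> \bar R) :
  (\int[mu]_(x in [set` i]) f x = \int[mu]_x (if x \in i then f x else 0))%E.
Proof.
rewrite integral_mkcond; apply: eq_integral => x _.
by rewrite patchE mem_setE.
Qed.

Lemma beta_lt_pinfty (al : R) : 0 < al < 1 ->
  (\int[mu]_(x in `]0%R, 1%R[) (x `^ (- al) * (1 - x) `^ (al - 1))%:E < +oo)%E.
Proof.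
move=> /andP[al0 al1].
apply: (@le_lt_trans _ _ (\int[mu]_(x in `]0%R, 1%R[) (((1 - x) `^ (al - 1))%:E + ((x - 0) `^ (1 - al - 1))%:E))%E).
  apply: ge0_le_integral => //=.
  - by move=> x _; rewrite lee_fin mulr_ge0 ?powR_ge0.
  - by apply: measurable_funTS; mfun.
  - by apply: measurable_funTS; apply: emeasurable_funD; mfun.
  - move=> x; rewrite in_itv/= => /andP[x0 x1]; rewrite -EFinD lee_fin subr0.
    have -> : 1 - al - 1 = - al by ring.
    have x1' : 0 < 1 - x by rewrite subr_gt0.
    have h1 : x * x `^ (- al) <= 1.
      rewrite -[X in X * _](powRr1 (ltW x0)) -powRD_gt0//.
      apply: (@le_trans _ _ (x `^ 0)); last by rewrite powRr0.
      by apply: ger_powR; [rewrite x0 ltW|lra].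
    have h2 : (1 - x) * (1 - x) `^ (al - 1) <= 1.
      rewrite -[X in X * _](powRr1 (ltW x1')) -powRD_gt0//.
      apply: (@le_trans _ _ ((1 - x) `^ 0)); last by rewrite powRr0.
      by apply: ger_powR; [apply/andP; split; lra|lra].
    have p1 := powR_ge0 x (- al); have p2 := powR_ge0 (1 - x) (al - 1).
    move: h1 h2 p1 p2; set A := x `^ _; set B := _ `^ (al - 1) => h1 h2 p1 p2.
    by nra.
rewrite ge0_integralD//=.
- rewrite integral_powRBr//; [|by lra|by right; split; lra].
  rewrite integral_powRBl//; [|by lra|by right; split; lra].
  by rewrite -EFinD ltry.
- by move=> x _; rewrite lee_fin powR_ge0.
- by apply: measurable_funTS; mfun.
- by move=> x _; rewrite lee_fin powR_ge0.
- by apply: measurable_funTS; mfun.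
Qed.

Lemma beta_gt0 (al : R) : 0 < al < 1 ->
  (0 < \int[mu]_(x in `]0%R, 1%R[) (x `^ (- al) * (1 - x) `^ (al - 1))%:E)%E.
Proof.
move=> /andP[al0 al1].
apply: (@lt_le_trans _ _ (\int[mu]_(x in `]0%R, 1%R[) (cst 1 x))%E).
  by rewrite integral_cst//= lebesgue_measure_itv/= lte_fin ltr01 oppr0 adde0 mule1 lte_fin.
apply: ge0_le_integral => //=.
- by apply: measurable_funTS; mfun.
- move=> x; rewrite in_itv/= => /andP[x0 x1]; rewrite lee_fin.
  rewrite -[leLHS]mulr1; apply: ler_pM => //.
    apply: (@le_trans _ _ (x `^ 0)); first by rewrite powRr0.
    by apply: ger_powR; [rewrite x0 ltW|lra].
  apply: (@le_trans _ _ ((1 - x) `^ 0)); first by rewrite powRr0.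
  by apply: ger_powR; [apply/andP; split; lra|lra].
Qed.

Lemma integral_beta_Gamma (al : R) : 0 < al < 1 ->
  (\int[mu]_(x in `]0%R, 1%R[) (x `^ (- al) * (1 - x) `^ (al - 1))%:E =
   (Gamma (1 - al) * Gamma al)%:E)%E.
Proof.
move=> al01; have /andP[al0 al1] := al01.
set Bt := LHS.
have Bt_fin : (Bt < +oo)%E by exact: beta_lt_pinfty.
have Bt_gt0 : (0 < Bt)%E by exact: beta_gt0.
rewrite /Gamma /Rintegral.
set I1 := (\int[mu]_(u in _) _)%E; set I2 := (\int[mu]_(u in _) _)%E.
have I10 : (0 <= I1)%E.
  by apply: integral_ge0 => x _; rewrite lee_fin mulr_ge0 ?powR_ge0 ?expR_ge0.
have I20 : (0 <= I2)%E.
  by apply: integral_ge0 => x _; rewrite lee_fin mulr_ge0 ?powR_ge0 ?expR_ge0.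
suff I12 : Bt = (I1 * I2)%E.
  rewrite I12 in Bt_fin Bt_gt0 *.
  move: I1 I2 I10 I20 Bt_fin Bt_gt0 {I12} => [x| |] [y| |] //= I10 I20.
  - move: I10; rewrite le_eqVlt => /predU1P[[<-]|x0]; first by rewrite mul0e ltxx.
    by rewrite gt0_muley.
  - move: I20; rewrite le_eqVlt => /predU1P[[<-]|x0]; first by rewrite mule0 ltxx.
    by rewrite gt0_mulye.
pose A u : R := if 0 < u then u `^ (- al) * expR (- u) else 0.
pose B v : R := if 0 < v then v `^ (al - 1) * expR (- v) else 0.
pose b x : R := if (0 < x) && (x < 1) then x `^ (- al) * (1 - x) `^ (al - 1) else 0.
have A0 u : 0 <= A u.
  by rewrite /A; case: ifPn => // _; rewrite mulr_ge0 ?powR_ge0 ?expR_ge0.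
have B0 u : 0 <= B u.
  by rewrite /B; case: ifPn => // _; rewrite mulr_ge0 ?powR_ge0 ?expR_ge0.
have b0 u : 0 <= b u.
  by rewrite /b; case: ifPn => // _; rewrite mulr_ge0 ?powR_ge0.
have -> : I1 = (\int[mu]_u (A u)%:E)%E.
  rewrite /I1 integral_itv_if; apply: eq_integral => x _.
  rewrite in_itv/= andbT /A; case: ifPn => // _.
  by have -> : 1 - al - 1 = - al by ring.
have -> : I2 = (\int[mu]_u (B u)%:E)%E.
  rewrite /I2 integral_itv_if; apply: eq_integral => x _.
  by rewrite in_itv/= andbT /B; case: ifPn.
have BtE : Bt = (\int[mu]_u (b u)%:E)%E.
  rewrite /Bt integral_itv_if; apply: eq_integral => x _.
  by rewrite in_itv/= /b; case: ifPn.
have mA : measurable_fun setT A by rewrite /A; mfun.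
have mB : measurable_fun setT B by rewrite /B; mfun.
have mb : measurable_fun setT b by rewrite /b; mfun.
have mAB : measurable_fun setT (fun z : R * R => A z.1 * B (z.2 - z.1)).
  by rewrite /A /B; mfun.
rewrite -ge0_integralZr//=; last 3 first.
- by mfun.
- by move=> x _; rewrite lee_fin.
- by apply: integral_ge0 => x _; rewrite lee_fin.
transitivity (\int[mu]_u \int[mu]_w (A u * B (w - u))%:E)%E; last first.
  apply: eq_integral => u _.
  under eq_integral do rewrite EFinM.
  have h1 : measurable_fun setT (fun w : R => (B (w - u))%:E) by rewrite /B; mfun.
  have h2 x : [set: R] x -> (0 <= (B (x - u))%:E)%E by rewrite lee_fin.
  have -> := ge0_integralZl_EFin mu measurableT h2 h1 (A0 u).
  congr (_ * _)%E.
  have -> := @ge0_integral_affine (fun w => (B w)%:E) 1 (- u) ltr01 _ _.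
  - by rewrite mul1e; apply: eq_integral => w _; rewrite mul1r.
  - exact/measurable_EFinP.
  - by move=> x; rewrite lee_fin.
transitivity (\int[mu]_w \int[mu]_u (A u * B (w - u))%:E)%E; last first.
  apply/esym/(@fubini_tonelli _ _ _ _ R mu mu
    (fun z : R * R => (A z.1 * B (z.2 - z.1))%:E)).
  - exact/measurable_EFinP.
  - by move=> z; rewrite lee_fin mulr_ge0.
transitivity (\int[mu]_w ((if 0 < w then expR (- w) else 0)%:E * Bt))%E; last first.
  apply: eq_integral => w _; case: ifPn => w0; last first.
    rewrite mul0e integral0_eq// => u _; rewrite /A /B; case: ifPn => u0; last by rewrite mul0r.
    by rewrite subr_gt0 (_ : u < w = false) ?mulr0//; apply/negbTE; rewrite -leNgt; lra.
  rewrite (@ge0_integral_affine (fun u => (A u * B (w - u))%:E) w 0)//; last 2 first.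
  - by rewrite /A /B; mfun.
  - by move=> u; rewrite lee_fin mulr_ge0.
  rewrite BtE -!ge0_integralZl_EFin ?expR_ge0 ?(ltW w0)//=; last 4 first.
  - by move=> u _; rewrite lee_fin mulr_ge0.
  - by rewrite /A /B; mfun.
  - by move=> u _; rewrite lee_fin.
  - by mfun.
  apply: eq_integral => x _; rewrite -!EFinM; congr EFin.
  rewrite addr0 /A /B /b pmulr_rgt0// subr_gt0 gtr_pMr//.
  have [x0|x0] /= := boolP (0 < x); last by rewrite mul0r !mulr0.
  have [x1|x1] /= := boolP (x < 1); last by rewrite !mulr0.
  have -> : w - w * x = w * (1 - x) by ring.
  rewrite !powRM ?subr_ge0 ?(ltW w0) ?(ltW x0) ?(ltW x1)//.
  have -> : expR (- w) = expR (- (w * x)) * expR (- (w * (1 - x))).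
    by rewrite -expRD; congr expR; ring.
  have e : w * w `^ (- al) * w `^ (al - 1) = 1.
    rewrite -[X in X * _ * _](powRr1 (ltW w0)) -!powRD_gt0//.
    by rewrite (_ : 1 - al + (al - 1) = 0) ?powRr0//; ring.
  rewrite -[LHS]mul1r -[X in X * _]e; ring.
rewrite ge0_integralZr//=; last 3 first.
- by mfun.
- by move=> w _; case: ifP; rewrite lee_fin ?expR_ge0.
- exact: ltW.
suff -> : (\int[mu]_x (if (0 < x)%R then expR (- x) else 0)%:E = 1)%E by rewrite mul1e.
transitivity (\int[mu]_(x in `[0%R, +oo[) (expR (- x))%:E)%E.
  rewrite -integral_itv_obnd_cbnd; last by apply: measurable_funTS; mfun.
  by rewrite integral_itv_if; apply: eq_integral => x _; rewrite in_itv/= andbT; case: ifP.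
rewrite (@ge0_continuous_FTC2y _ (fun x => expR (- x)) (fun x => - expR (- x)) _ 0)//.
- by rewrite oppr0 expR0 -EFinB sub0r opprK.
- apply: continuous_subspaceT => x; apply: continuous_comp; first exact: opp_continuous.
  exact: continuous_expR.
- by rewrite -oppr0; apply: cvgN; exact: cvgr_expR.
- apply: cvg_at_right_filter; apply: cvgN; apply: continuous_comp; first exact: opp_continuous.
  exact: continuous_expR.
- by move=> x _; rewrite derive1E derive_val mulrN1 opprK.
Qed.

Lemma integral_oo_if (a b : R) (f : R -> R) :
  (\int[mu]_(x in `]a, b[) (f x)%:E =
   \int[mu]_x (if (a < x) && (x < b) then f x else 0)%:E)%E.
Proof.
rewrite integral_itv_if; apply: eq_integral => x _.
by rewrite in_itv/=; case: ifP.
Qed.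

End beta.

Lemma integral_ge0Zr d (T : measurableType d) (R : realType)
    (m : {measure set T -> \bar R}) (f : T -> R) (c k : R) :
  measurable_fun setT f -> (forall x, 0 <= f x) ->
  (\int[m]_x (f x)%:E = c%:E)%E ->
  (\int[m]_x (f x * k)%:E = (c * k)%:E)%E /\
  (\int[m]_x `|(f x * k)%:E| = (c * `|k|)%:E)%E.
Proof.
move=> mf f0 fc; split.
- under eq_integral do rewrite EFinM.
  rewrite integralZr//; first by rewrite fc.
  apply/integrableP; split; first exact/measurable_EFinP.
  by under eq_integral do rewrite gee0_abs ?lee_fin//; rewrite fc ltry.
- under eq_integral do rewrite abse_EFin normrM (ger0_norm (f0 _)) EFinM.
  rewrite ge0_integralZr//; first by rewrite fc.
  + exact/measurable_EFinP.
  + by move=> x _; rewrite lee_fin.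
Qed.

(** * The fractional integral of a step function *)

Section cut_kernel.
Context {R : realType}.
Local Notation mu := (@lebesgue_measure R).
Variables (al u : R).
Hypotheses (al01 : 0 < al < 1) (u1 : u < 1).

Let al0 : 0 < al. Proof. by case/andP: al01. Qed.
Let al1 : al < 1. Proof. by case/andP: al01. Qed.

Definition rl_kernel2 (z : R * R) : R :=
  if (u < z.1) && (z.1 < z.2) && (z.2 < 1) then
    (1 - al) * ((z.1 - u) `^ (- al) * (z.2 - z.1) `^ (al - 2)) else 0.

(* The cut at y - u = lam * (x - u) keeps x away from y, so that both partial
   integrals are finite and explicit; lam tends to 1 afterwards. *)
Definition cut_kernel2 (lam : R) (z : R * R) : R :=
  if lam * (z.1 - u) < z.2 - u then rl_kernel2 z else 0.

Lemma rl_kernel2_ge0 z : 0 <= rl_kernel2 z.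
Proof.
rewrite /rl_kernel2; case: ifP => // _.
by rewrite !mulr_ge0 ?powR_ge0// subr_ge0 ltW.
Qed.

Lemma cut_kernel2_ge0 lam z : 0 <= cut_kernel2 lam z.
Proof. by rewrite /cut_kernel2; case: ifP => // _; exact: rl_kernel2_ge0. Qed.

Lemma measurable_rl_kernel2 : measurable_fun setT rl_kernel2.
Proof. by rewrite /rl_kernel2; mfun. Qed.

Lemma measurable_cut_kernel2 lam : measurable_fun setT (cut_kernel2 lam).
Proof. by have mk := measurable_rl_kernel2; rewrite /cut_kernel2; mfun. Qed.

Lemma integral_cut_kernel2_fst lam y : 1 < lam ->
  (\int[mu]_x (cut_kernel2 lam (x, y))%:E =
   (if (u < y) && (y < 1) then (lam - 1) `^ (al - 1) * (y - u) `^ (-1) else 0)%:E)%E.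
Proof.
move=> lam1; have lam0 : 0 < lam by lra.
case: ifPn => [/andP[uy y1]|yN]; last first.
  apply: integral0_eq => x _; rewrite /cut_kernel2 /rl_kernel2/=.
  case: ifP => // _; case: ifP => // /andP[/andP[ux xy] y1].
  by rewrite (lt_trans ux xy) y1 in yN.
pose b := u + (y - u) / lam.
have b1 : 0 < (y - u) / lam by rewrite divr_gt0// subr_gt0.
have b2 : (y - u) / lam < y - u by rewrite ltr_pdivrMr// ltr_pMr// subr_gt0.
have ub : u < b by rewrite /b; lra.
have byy : b < y by rewrite /b; lra.
transitivity (\int[mu]_(x in `]u, b[) ((1 - al) * ((x - u) `^ (- al) * (y - x) `^ (al - 2)))%:E)%E.
  rewrite integral_itv_if; apply: eq_integral => x _.
  rewrite /cut_kernel2 /rl_kernel2 /= y1 andbT in_itv/=.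
  have -> : (lam * (x - u) < y - u) = (x < b).
    by rewrite -(ltr_pdivlMl _ _ lam0) mulrC /b; apply/idP/idP => ?; lra.
  have [ux|ux]/= := boolP (u < x); last by rewrite if_same.
  have [xb|xb]//= := boolP (x < b).
  by rewrite (lt_trans xb byy).
rewrite integral_powRB_powRB// powR_inv1 ?subr_ge0 ?(ltW uy)//; congr EFin; congr (_ / _).
have -> : (b - u) / (y - b) = (lam - 1)^-1.
  rewrite /b; field; apply/and3P; split; [by rewrite gt_eqF// subr_gt0|by rewrite gt_eqF|].
  have -> : y * lam - (u * lam + (y - u)) = (y - u) * (lam - 1) by ring.
  by rewrite mulf_neq0 ?gt_eqF ?subr_gt0.
by rewrite -powR_inv1 ?subr_ge0 ?ltW// -powRrM mulN1r opprB.
Qed.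

Lemma integral_cut_kernel2_snd lam x : 1 < lam ->
  (\int[mu]_y (cut_kernel2 lam (x, y))%:E =
   (if (u < x) && (lam * (x - u) < 1 - u) then
      (lam - 1) `^ (al - 1) * (x - u) `^ (-1) -
      (x - u) `^ (- al) * (1 - x) `^ (al - 1) else 0)%:E)%E.
Proof.
move=> lam1; have lam0 : 0 < lam by lra.
case: ifPn => [/andP[ux x1]|xN]; last first.
  apply: integral0_eq => y _; rewrite /cut_kernel2 /rl_kernel2/=.
  case: ifP => // ch; case: ifP => // /andP[/andP[ux xy] y1].
  suff: lam * (x - u) < 1 - u by move=> h; rewrite ux h in xN.
  by lra.
pose b := u + lam * (x - u).
have xb : x < b by rewrite /b; nra.
have b1 : b < 1 by rewrite /b; lra.
transitivity (((1 - al) * (x - u) `^ (- al))%:E * \int[mu]_(y in `]b, 1%R[) ((y - x) `^ (al - 1 - 1))%:E)%E.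
  rewrite -ge0_integralZl_EFin//=; last 3 first.
  - by move=> y _; rewrite lee_fin powR_ge0.
  - by apply: measurable_funTS; mfun.
  - by rewrite mulr_ge0 ?powR_ge0// subr_ge0 ltW.
  rewrite integral_itv_if; apply: eq_integral => y _.
  rewrite /cut_kernel2 /rl_kernel2 /= ux/= in_itv/=.
  have -> : (lam * (x - u) < y - u) = (b < y) by rewrite /b; apply/idP/idP; lra.
  have [bY|//] := boolP (b < y); rewrite (lt_trans xb bY)/=.
  case: ifP => // _; rewrite -EFinM; congr EFin.
  by rewrite mulrA; congr (_ * _ `^ _); ring.
rewrite integral_powRBl//; [|by rewrite lt_eqF// subr_lt0|by left].
rewrite -EFinM; congr EFin.
have -> : b - x = (lam - 1) * (x - u) by rewrite /b; ring.
rewrite powRM ?subr_ge0 ?ltW//.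
have -> : (x - u) `^ (al - 1) = (x - u) `^ al / (x - u).
  by rewrite -powR_inv1 ?subr_ge0 ?ltW// -powRD_gt0// subr_gt0.
rewrite powRN powR_inv1 ?subr_ge0 ?(ltW ux)//.
have pn0 : (x - u) `^ al != 0 by rewrite gt_eqF// powR_gt0// subr_gt0.
field.
by rewrite pn0/= !subr_eq0 (gt_eqF ux) (lt_eqF al1).
Qed.

Section fubini_cut.
Variable (h : R -> R).
Hypothesis mh : measurable_fun setT h.
Hypothesis hL : (\int[mu]_(y in `]u, 1%R[) (`|h y| * (y - u) `^ (-1))%:E < +oo)%E.
Variable lam : R.
Hypothesis lam1 : 1 < lam.

Let mk := measurable_cut_kernel2 lam.

Let w (c x : R) := if (u < x) && (x < 1) then c * (x - u) `^ (-1) else 0.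

Let integrable_w : mu.-integrable setT (fun x => (w ((lam - 1) `^ (al - 1)) x * h x)%:E).
Proof.
apply/integrableP; split; first by rewrite /w; mfun.
apply: le_lt_trans (_ : ((((lam - 1) `^ (al - 1))%:E * (\int[mu]_(y in `]u, 1%R[) (`|h y| * (y - u) `^ (-1))%:E) < +oo))%E); last first.
  by apply: lte_mul_pinfty => //; rewrite lee_fin powR_ge0.
rewrite integral_oo_if -ge0_integralZl_EFin ?powR_ge0//=; last 2 first.
- by move=> y _; case: ifP => // _; rewrite lee_fin mulr_ge0 ?powR_ge0.
- by mfun.
apply: ge0_le_integral => //=.
- by rewrite /w; mfun.
- by apply: measurable_funeM; mfun.
move=> x _; rewrite /w; case: ifP => _; last by rewrite mul0r normr0 mule0.
rewrite -EFinM lee_fin normrM (ger0_norm (mulr_ge0 _ _)) ?powR_ge0//.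
by rewrite -mulrA (mulrC `|_|).
Qed.

Let int_fst y := @integral_ge0Zr _ _ _ mu (fun x => cut_kernel2 lam (x, y)) _ (h y)
  (measurableT_comp (measurable_cut_kernel2 lam) (@measurable_pair2 _ _ _ _ y))
  (fun x => cut_kernel2_ge0 lam (x, y)) (integral_cut_kernel2_fst y lam1).

Let int_snd x := @integral_ge0Zr _ _ _ mu (fun y => cut_kernel2 lam (x, y)) _ (h x)
  (measurableT_comp (measurable_cut_kernel2 lam) (@measurable_pair1 _ _ _ _ x))
  (fun y => cut_kernel2_ge0 lam (x, y)) (integral_cut_kernel2_snd x lam1).

Lemma integrable_cut_snd : (mu \x mu)%E.-integrable setT
  (fun z : R * R => (cut_kernel2 lam z * h z.2)%:E).
Proof.
apply/integrable21ltyP.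
  by mfun; apply: (measurableT_comp mh); mfun.
have /integrableP[_] := integrable_w; apply: le_lt_trans.
rewrite le_eqVlt; apply/orP; left; apply/eqP; apply: eq_integral => y _.
have [_ /= ->] := int_fst y.
rewrite normrM (_ : `|w _ y| = w ((lam - 1) `^ (al - 1)) y)//.
by rewrite ger0_norm// /w; case: ifP => // _; rewrite mulr_ge0 ?powR_ge0.
Qed.

Lemma integrable_cut_fst : (mu \x mu)%E.-integrable setT
  (fun z : R * R => (cut_kernel2 lam z * h z.1)%:E).
Proof.
apply/integrable12ltyP.
  by mfun; apply: (measurableT_comp mh); mfun.
have /integrableP[_] := integrable_w; apply: le_lt_trans.
apply: ge0_le_integral => //=.
- by move=> x _; apply: integral_ge0.
- apply: (@measurable_fun_fubini_tonelli_F _ _ _ _ R mu (fun z : R * R => `|(cut_kernel2 lam z * h z.1)%:E|%E)) => //.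
  by apply: measurableT_comp => //; mfun; apply: (measurableT_comp mh); mfun.
- by rewrite /w; mfun.
move=> x _; have [_ /= ->] := int_snd x.
rewrite lee_fin normrM; apply: ler_wpM2r => //; rewrite /w.
case: ifPn => [/andP[ux x1]|_]; last exact: normr_ge0.
have pos : 0 < (lam - 1) * (x - u) by rewrite mulr_gt0 ?subr_gt0.
have x1' : x < 1 by lra.
rewrite ux x1'/= ger0_norm ?mulr_ge0 ?powR_ge0// lerBlDr lerDl.
by rewrite mulr_ge0 ?powR_ge0.
Qed.

Lemma integral_cut_kernel2 :
  (\int[mu \x mu]_z (cut_kernel2 lam z * (h z.2 - h z.1))%:E =
   \int[mu]_x (if (u < x) && (x < 1) then
     if lam * (x - u) < 1 - u then (x - u) `^ (- al) * (1 - x) `^ (al - 1) * h x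
     else (lam - 1) `^ (al - 1) * (x - u) `^ (-1) * h x else 0)%:E)%E.
Proof.
under eq_integral do rewrite mulrBr.
rewrite integralB_EFin//; [|exact: integrable_cut_snd|exact: integrable_cut_fst].
rewrite -(integral21_prod_meas1 integrable_cut_snd).
rewrite -(integral12_prod_meas1 integrable_cut_fst).
rewrite /fubini_F /fubini_G.
under [X in (X - _)%E]eq_integral => y _ do rewrite (int_fst y).1.
under [X in (_ - X)%E]eq_integral => x _ do rewrite (int_snd x).1.
rewrite -integralB_EFin//.
- apply: eq_integral => x _; rewrite -EFinB; congr EFin.
  have [ux|ux] /= := boolP (u < x); last by rewrite !mul0r subrr.
  case: ifPn => x1; case: ifPn => lx; [ring|ring| |by rewrite !mul0r subrr].
  exfalso; move: x1; rewrite -leNgt => x1.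
  have pos : 0 < (lam - 1) * (x - u) by rewrite mulr_gt0 ?subr_gt0.
  lra.
- have hI := integrable_fubini_F integrable_cut_fst.
  by apply: (@eq_integrable _ _ _ mu setT measurableT _ _ _ hI) => x _; exact: (int_snd x).1.
Qed.

End fubini_cut.
End cut_kernel.

Section rl_kernel.
Context {R : realType}.
Local Notation mu := (@lebesgue_measure R).
Variables (al : R).
Hypotheses (al01 : 0 < al < 1).

Let al0 : 0 < al. Proof. by case/andP: al01. Qed.
Let al1 : al < 1. Proof. by case/andP: al01. Qed.

(* rl_right al g is, up to sign and the factor 1 / Gamma al, the right-sided
   fractional derivative of order 1 - al of g - g 1; rl_step al u is Gamma (1 - al)
   times the left-sided one of order al of the indicator of x > u. *)
Definition rl_right (g : R -> R) (x : R) : R :=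
  (g 1 - g x) / (1 - x) `^ (1 - al) +
  (1 - al) * \int[mu]_(y in `[x, 1]) ((g y - g x) / (y - x) `^ (2 - al)).

Definition rl_abs (g : R -> R) (x : R) : \bar R :=
  ((`|g 1 - g x| * (1 - x) `^ (al - 1))%:E + (1 - al)%:E *
   \int[mu]_y (if (x < y) && (y < 1) then `|g y - g x| * (y - x) `^ (al - 2)
               else 0)%:E)%E.

Definition rl_step (u x : R) : R := if u < x then (x - u) `^ (- al) else 0.

Lemma rl_step_ge0 u x : 0 <= rl_step u x.
Proof. by rewrite /rl_step; case: ifP => // _; exact: powR_ge0. Qed.

Lemma measurable_rl_step u : measurable_fun setT (rl_step u).
Proof. by rewrite /rl_step; mfun. Qed.

Lemma measurable_integral_snd (f : R * R -> R) : measurable_fun setT f ->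
  measurable_fun setT (fun x => \int[mu]_y (f (x, y))%:E)%E.
Proof.
move=> mf.
have mfE : measurable_fun setT (EFin \o f) by exact/measurable_EFinP.
rewrite (_ : (fun x => _) = fun x =>
    (\int[mu]_y ((EFin \o f)^\+ (x, y)) - \int[mu]_y ((EFin \o f)^\- (x, y)))%E).
  apply: emeasurable_funB.
  - apply: (@measurable_fun_fubini_tonelli_F _ _ _ _ R mu (EFin \o f)^\+%E) => //.
    exact: measurable_funepos.
  - apply: (@measurable_fun_fubini_tonelli_F _ _ _ _ R mu (EFin \o f)^\-%E) => //.
    exact: measurable_funeneg.
apply/funext => x; rewrite integralE; congr (_ - _)%E.
- apply: eq_integral => y _.
  by rewrite -[LHS]/((((EFin \o f) \o pair x)^\+)%E y) funepos_comp.
- apply: eq_integral => y _.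
  by rewrite -[LHS]/((((EFin \o f) \o pair x)^\-)%E y) funeneg_comp.
Qed.

Lemma integral_beta_affine (u : R) : u < 1 ->
  (\int[mu]_x (if (u < x) && (x < 1)%R then (x - u) `^ (- al) * (1 - x) `^ (al - 1)
               else 0)%:E = (Gamma (1 - al) * Gamma al)%:E)%E.
Proof.
move=> u1; have c0 : 0 < 1 - u by rewrite subr_gt0.
rewrite -integral_beta_Gamma// integral_oo_if.
rewrite (@ge0_integral_affine _ _ (1 - u) u c0); last 2 first.
- by mfun.
- by move=> x; rewrite lee_fin; case: ifP => // _; rewrite mulr_ge0 ?powR_ge0.
rewrite -ge0_integralZl_EFin ?(ltW c0)//; last 2 first.
- by move=> x _; rewrite lee_fin; case: ifP => // _; rewrite mulr_ge0 ?powR_ge0.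
- by mfun.
apply: eq_integral => x _; rewrite -EFinM; congr EFin.
have -> : (u < (1 - u) * x + u) = (0 < x).
  by rewrite ltrDr pmulr_rgt0.
have -> : ((1 - u) * x + u < 1) = (x < 1).
  by rewrite -ltrBrDr gtr_pMr.
case: ifP => [/andP[x0 x1]|_]; last by rewrite mulr0.
have -> : (1 - u) * x + u - u = (1 - u) * x by ring.
have -> : 1 - ((1 - u) * x + u) = (1 - u) * (1 - x) by ring.
rewrite !powRM ?subr_ge0 ?(ltW c0) ?(ltW x0) ?(ltW x1) ?(ltW u1)//.
have e : (1 - u) * (1 - u) `^ (- al) * (1 - u) `^ (al - 1) = 1.
  rewrite -[X in X * _ * _](powRr1 (ltW c0)) -!powRD_gt0//.
  by rewrite (_ : 1 - al + (al - 1) = 0) ?powRr0//; ring.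
by rewrite -[RHS]mul1r -[X in _ = X * _]e; ring.
Qed.

Section path.
Variable (g : R -> R).
Hypothesis cg : continuous g.

Let mg : measurable_fun setT g. Proof. exact: continuous_measurable_fun. Qed.

Let mg1 : measurable_fun setT (fun z : R * R => g z.1).
Proof. by apply: (measurableT_comp mg); mfun. Qed.

Let mg2 : measurable_fun setT (fun z : R * R => g z.2).
Proof. by apply: (measurableT_comp mg); mfun. Qed.

Lemma rl_right_integral x : x < 1 ->
  (\int[mu]_(y in `[x, 1%R]) ((g y - g x) / (y - x) `^ (2 - al))%:E =
   \int[mu]_y (if (x < y) && (y < 1)%R then (y - x) `^ (al - 2) * (g y - g x)
               else 0)%:E)%E.
Proof.
move=> x1.
have -> : (fun y => ((g y - g x) / (y - x) `^ (2 - al))%:E) =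
    (fun y => ((y - x) `^ (al - 2) * (g y - g x))%:E).
  by apply/funext => y; rewrite -powRN opprB mulrC.
rewrite -integral_oo_if; apply: integral_itv_bndoo.
by apply: measurable_funTS; mfun.
Qed.

Lemma rl_rightE x : rl_right g x =
  (g 1 - g x) * (1 - x) `^ (al - 1) + (1 - al) *
  fine (\int[mu]_y (if (x <= y) && (y <= 1) then (g y - g x) * (y - x) `^ (al - 2)
                    else 0)%:E)%E.
Proof.
rewrite /rl_right /Rintegral integral_itv_if -powRN opprB; congr (_ + _ * fine _).
apply: eq_integral => y _; rewrite in_itv/= -powRN opprB.
by case: ifP.
Qed.

Lemma measurable_rl_right : measurable_fun setT (rl_right g).
Proof.
rewrite (funext rl_rightE).
have h : measurable_fun setT (fun x : R => fine (\int[mu]_y (if (x <= y) && (y <= 1)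
    then (g y - g x) * (y - x) `^ (al - 2) else 0)%:E)%E).
  apply: measurableT_comp => //.
  by apply: (@measurable_integral_snd (fun z : R * R => if (z.1 <= z.2) && (z.2 <= 1)
    then (g z.2 - g z.1) * (z.2 - z.1) `^ (al - 2) else 0)); mfun.
by mfun.
Qed.

Lemma rl_abs_ge0 x : (0 <= rl_abs g x)%E.
Proof.
apply: adde_ge0; first by rewrite lee_fin mulr_ge0 ?powR_ge0.
apply: mule_ge0; first by rewrite lee_fin subr_ge0 ltW.
by apply: integral_ge0 => y _; rewrite lee_fin; case: ifP => // _; rewrite mulr_ge0 ?powR_ge0.
Qed.

Lemma measurable_rl_abs : measurable_fun setT (rl_abs g).
Proof.
apply: emeasurable_funD; first by mfun.
apply: measurable_funeM.
by apply: (@measurable_integral_snd (fun z : R * R => if (z.1 < z.2) && (z.2 < 1)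
  then `|g z.2 - g z.1| * (z.2 - z.1) `^ (al - 2) else 0)); mfun.
Qed.

Lemma le_rl_right_abs x : x < 1 -> (`|(rl_right g x)%:E| <= rl_abs g x)%E.
Proof.
move=> x1; rewrite /rl_right /Rintegral rl_right_integral// -powRN opprB.
rewrite EFinD; apply: (le_trans (lee_abs_add _ _)); apply: leeD.
  by rewrite abse_EFin lee_fin normrM (ger0_norm (powR_ge0 _ _)).
rewrite EFinM abseM; apply: lee_pmul => //.
  by rewrite abse_EFin lee_fin ger0_norm// subr_ge0 ltW.
set I := (\int[mu]_y _)%E.
have : (`|(fine I)%:E| <= `|I|)%E by case: (I) => [r| |] //=; rewrite normr0 leey.
move=> /le_trans; apply; apply: le_trans (le_abse_integral _ _ _) _ => //.
  by mfun.
apply: ge0_le_integral => //.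
- by apply: measurableT_comp => //; mfun.
- by mfun.
- move=> y _; rewrite abse_EFin lee_fin; case: ifP => _; last by rewrite normr0.
  by rewrite normrM (ger0_norm (powR_ge0 _ _)) mulrC.
Qed.

Section point.
Variable u : R.
Hypothesis u1 : u < 1.
Hypothesis gK :
  (\int[mu]_x ((if x < 1 then rl_step u x else 0)%:E * rl_abs g x) < +oo)%E.
Hypothesis gL :
  (\int[mu]_(y in `]u, 1%R[) (`|g y - g u| * (y - u) `^ (-1))%:E < +oo)%E.

Let mstep := measurable_rl_step u.

Lemma integrable_rl_right : mu.-integrable setT
  (fun x => ((if x < 1 then rl_step u x else 0) * rl_right g x)%:E).
Proof.
have mr := measurable_rl_right; have ma := measurable_rl_abs.
apply/integrableP; split; first by mfun.
apply: le_lt_trans gK; apply: ge0_le_integral => //.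
- by apply: measurableT_comp => //; mfun.
- by apply: emeasurable_funM => //; mfun.
- move=> x _; rewrite EFinM abseM; case: ifPn => x1; last by rewrite abse0 !mul0e.
  by apply: lee_pmul => //; [rewrite abse_EFin ger0_norm ?rl_step_ge0|exact: le_rl_right_abs].
Qed.

Let D (z : R * R) := rl_kernel2 al u z * (g z.2 - g z.1).

Let mD : measurable_fun setT D.
Proof. by have := measurable_rl_kernel2 al u; rewrite /D => ?; mfun. Qed.

Let DE x y : D (x, y) = ((if x < 1 then rl_step u x else 0) * (1 - al)) *
  (if (x < y) && (y < 1) then (y - x) `^ (al - 2) * (g y - g x) else 0).
Proof.
rewrite /D /rl_kernel2 /rl_step /=.
have [ux|] := boolP (u < x); last by rewrite !if_same !mul0r.
have [xy|] := boolP (x < y); last by rewrite /= mul0r mulr0.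
have [y1|] := boolP (y < 1); last by rewrite /= mul0r mulr0.
by rewrite (lt_trans xy y1)/=; ring.
Qed.

Let integrable_D : (mu \x mu)%E.-integrable setT (fun z => (D z)%:E).
Proof.
apply/integrable12ltyP; first exact/measurable_EFinP.
apply: le_lt_trans gK; apply: ge0_le_integral => //.
- by move=> x _; exact: integral_ge0.
- by apply: (@measurable_integral_snd (fun z => `|D z|)); mfun.
- by apply: emeasurable_funM => //; [mfun|exact: measurable_rl_abs].
- move=> x _; under eq_integral => y _ do rewrite DE.
  have a1 : 0 <= (if x < 1 then rl_step u x else 0) * (1 - al).
    by rewrite mulr_ge0 ?subr_ge0 ?(ltW al1)//; case: ifP => // _; exact: rl_step_ge0.
  under eq_integral => y _ do rewrite abse_EFin normrM (ger0_norm a1) EFinM.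
  rewrite ge0_integralZl_EFin//; last by mfun.
  rewrite EFinM -muleA; apply: lee_pmul => //.
  + by rewrite lee_fin; case: ifP => // _; exact: rl_step_ge0.
  + apply: mule_ge0; first by rewrite lee_fin subr_ge0 ltW.
    by apply: integral_ge0 => y _.
  + rewrite /rl_abs -[X in (X <= _)%E]add0e; apply: leeD.
      by rewrite lee_fin mulr_ge0 ?powR_ge0.
    apply: lee_pmul => //; first by rewrite lee_fin subr_ge0 ltW.
      by apply: integral_ge0 => y _.
    rewrite le_eqVlt; apply/orP; left; apply/eqP; apply: eq_integral => y _.
    case: ifP => _; last by rewrite normr0.
    by rewrite normrM (ger0_norm (powR_ge0 _ _)) mulrC.
Qed.

Let h (x : R) := g x - g u.

Let mh : measurable_fun setT h. Proof. by rewrite /h; mfun. Qed.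

Let X (x : R) := if (u < x) && (x < 1) then
  (x - u) `^ (- al) * (1 - x) `^ (al - 1) * h x else 0.

Let mX : measurable_fun setT X. Proof. by rewrite /X; mfun. Qed.

Let b (x : R) := if (u < x) && (x < 1) then
  (x - u) `^ (- al) * (1 - x) `^ (al - 1) else 0.

Let b0 x : 0 <= b x.
Proof. by rewrite /b; case: ifP => // _; rewrite mulr_ge0 ?powR_ge0. Qed.

Let integrable_b : mu.-integrable setT (fun x => (b x)%:E).
Proof.
apply/integrableP; split; first by rewrite /b; mfun.
under eq_integral do rewrite gee0_abs ?lee_fin//.
by rewrite integral_beta_affine// ltry.
Qed.

Let integrable_X : mu.-integrable setT (fun x => (X x)%:E).
Proof.
have [c cu1 hc] : exists2 c, c \in `[u, 1] & forall t, t \in `[u, 1] -> `|h t| <= `|h c|.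
  apply: (@EVT_max _ (fun x => `|h x|)); first exact: ltW.
  apply: continuous_subspaceT => x; apply: cvg_norm; apply: cvgB; first exact: cg.
  exact: cvg_cst.
apply: (@le_integrable _ _ _ mu setT measurableT _ (fun x => ((b x) * `|h c|)%:E)).
- exact/measurable_EFinP.
- move=> x _; rewrite !abse_EFin lee_fin /X /b.
  case: ifPn => [/andP[ux x1]|_]; last by rewrite normr0.
  rewrite !normrM normr_id ler_wpM2l ?mulr_ge0//; apply: hc.
  by rewrite in_itv/= !ltW.
- by have := integrableZr measurableT `|h c| integrable_b.
Qed.

Let lam n : R := 1 + harmonic n.

Let lam1 n : 1 < lam n. Proof. by rewrite /lam ltrDl /harmonic /= invr_gt0. Qed.

Let cvg_lam : lam n @[n --> \oo] --> (1 : R).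
Proof.
rewrite -[X in _ --> X]addr0; apply: cvgD; first exact: cvg_cst.
exact: cvg_harmonic.
Qed.

Let lam_lt (c d : R) : 0 < c -> c < d -> \forall n \near \oo, lam n * c < d.
Proof.
move=> c0 cd.
have : lam n * c @[n --> \oo] --> 1 * c by apply: cvgMr_tmp.
by rewrite mul1r => /cvgr_lt; apply.
Qed.

Let cvg_cut : (\int[mu \x mu]_z (cut_kernel2 al u (lam n) z * (h z.2 - h z.1))%:E
  @[n --> \oo] --> \int[mu \x mu]_z (D z)%:E)%E.
Proof.
have hD z : h z.2 - h z.1 = g z.2 - g z.1 by rewrite /h; ring.
have mDE : measurable_fun setT (fun z => (D z)%:E) by exact/measurable_EFinP.
have := @dominated_convergence _ _ _ (mu \x mu)%E setT measurableT
  (fun n z => (cut_kernel2 al u (lam n) z * (h z.2 - h z.1))%:E)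
  (fun z => (D z)%:E) (fun z => `|(D z)%:E|%E) _ mDE _ _ _.
case => //.
- move=> n; have := measurable_cut_kernel2 al u (lam n) => mk.
  by mfun; apply: (measurableT_comp mh); mfun.
- apply: aeW => z _; apply: cvg_EFin; first exact: nearW.
  apply: cvg_near_cst; rewrite /D hD /cut_kernel2 /rl_kernel2.
  have [ch|ch] := boolP ((u < z.1) && (z.1 < z.2) && (z.2 < 1)); last first.
    by apply: nearW => n /=; rewrite if_same.
  move: ch => /andP[/andP[uz1 z12] z21].
  have : \forall n \near \oo, lam n * (z.1 - u) < z.2 - u.
    by apply: lam_lt; lra.
  by apply: filterS => n /= ->.
- by apply: integrable_abse.
- apply: aeW => z n _; rewrite hD !abse_EFin lee_fin /D !normrM ler_wpM2r//.
  rewrite /cut_kernel2; case: ifP => // _; rewrite normr0; exact: normr_ge0.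
Qed.

Let cvg_X : (\int[mu]_x (if (u < x) && (x < 1) then
     if lam n * (x - u) < 1 - u then (x - u) `^ (- al) * (1 - x) `^ (al - 1) * h x
     else (lam n - 1) `^ (al - 1) * (x - u) `^ (-1) * h x else 0)%:E
  @[n --> \oo] --> \int[mu]_x (X x)%:E)%E.
Proof.
have mXE : measurable_fun setT (fun x => (X x)%:E) by exact/measurable_EFinP.
have := @dominated_convergence _ _ _ mu setT measurableT
  (fun n x => (if (u < x) && (x < 1) then
     if lam n * (x - u) < 1 - u then (x - u) `^ (- al) * (1 - x) `^ (al - 1) * h x
     else (lam n - 1) `^ (al - 1) * (x - u) `^ (-1) * h x else 0)%:E)
  (fun x => (X x)%:E) (fun x => `|(X x)%:E|%E) _ mXE _ _ _.
case => //.
- by move=> n; mfun.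
- apply: aeW => x _; apply: cvg_EFin; first exact: nearW.
  apply: cvg_near_cst; rewrite /X.
  have [/andP[ux x1]|ch] := boolP ((u < x) && (x < 1)); last first.
    exact: nearW.
  have : \forall n \near \oo, lam n * (x - u) < 1 - u.
    by apply: lam_lt; lra.
  by apply: filterS => n /= ->.
- exact: integrable_abse.
- apply: aeW => x n _; rewrite !abse_EFin lee_fin /X.
  case: ifPn => // /andP[ux x1]; case: ifPn => //; rewrite -leNgt => lx.
  rewrite !normrM !(ger0_norm (powR_ge0 _ _)) ler_wpM2r//.
  have xu0 : 0 < x - u by rewrite subr_gt0.
  have x10 : 0 < 1 - x by rewrite subr_gt0.
  have -> : (x - u) `^ (- al) = (x - u) `^ (1 - al) * (x - u) `^ (-1).
    by rewrite -powRD_gt0//; congr (_ `^ _); ring.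
  rewrite mulrAC ler_wpM2r ?powR_ge0//.
  have -> : (x - u) `^ (1 - al) * (1 - x) `^ (al - 1) = ((1 - x) / (x - u)) `^ (al - 1).
    by rewrite powRM ?invr_ge0 ?(ltW xu0) ?(ltW x10)// -powR_inv1 ?(ltW xu0)// -powRrM mulN1r opprB mulrC.
  have d0 : 0 < (1 - x) / (x - u) by rewrite divr_gt0.
  have le1 : (1 - x) / (x - u) <= lam n - 1 by rewrite ler_pdivrMr//; lra.
  rewrite -(opprB 1 al) !powRN lef_pV2 ?posrE ?powR_gt0// ?(lt_le_trans d0 le1)//.
  by apply: ge0_ler_powR; rewrite ?nnegrE ?subr_ge0 ?(ltW al1) ?(ltW d0) ?(ltW (lam1 n)).
Qed.

Let integral_D : (\int[mu \x mu]_z (D z)%:E = \int[mu]_x (X x)%:E)%E.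
Proof.
have := cvg_cut.
under eq_fun do rewrite integral_cut_kernel2//.
move=> /(cvg_unique _); apply => //; exact: cvg_X.
Qed.

Lemma integral_rl_right :
  (\int[mu]_x ((if x < 1 then rl_step u x else 0) * rl_right g x)%:E =
   ((g 1 - g u) * (Gamma (1 - al) * Gamma al))%:E)%E.
Proof.
have iF := integrable_fubini_F integrable_D.
have -> : (\int[mu]_x ((if (x < 1)%R then rl_step u x else 0) * rl_right g x)%:E =
  \int[mu]_x ((b x * h 1 - X x)%:E + fubini_F mu (fun z => (D z)%:E) x))%E.
  apply: ae_eq_integral => //.
  - by have := measurable_int _ integrable_rl_right.
  - apply: emeasurable_funD; first by rewrite /b; mfun.
    exact: (measurable_int _ iF).
  - have := ae_integrable1 integrable_D; apply: filterS => x Dx _.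
    rewrite /fubini_F.
    have [x1|x1] := boolP (x < 1); last first.
      rewrite /b /X (negbTE x1) andbF !mul0r subr0 add0e.
      by rewrite integral0_eq// => y _; rewrite DE (negbTE x1) !mul0r.
    have [ux|ux] := boolP (u < x); last first.
      rewrite /rl_step /b /X (negbTE ux) /= !mul0r subr0 add0e.
      by rewrite integral0_eq// => y _; rewrite DE /rl_step (negbTE ux) if_same !mul0r.
    have kp : 0 < rl_step u x * (1 - al).
      by rewrite mulr_gt0 ?subr_gt0// /rl_step ux powR_gt0// subr_gt0.
    have /(integrableZl measurableT (rl_step u x * (1 - al))^-1) iE := Dx.
    under eq_integral => y _ do rewrite DE x1 EFinM.
    rewrite integralZl//; last first.
      apply: eq_integrable iE => // y _; rewrite DE x1 -EFinM; congr EFin.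
      by rewrite mulrA mulVf ?mul1r// gt_eqF.
    rewrite /rl_right /Rintegral rl_right_integral//.
    set I := (\int[mu]_y _)%E.
    have If : I \is a fin_num.
      apply: integrable_fin_num => //.
      apply: eq_integrable iE => // y _; rewrite DE x1 -EFinM; congr EFin.
      by rewrite mulrA mulVf ?mul1r// gt_eqF.
    rewrite -(fineK If) -EFinM -EFinD; congr EFin; move: (fine I) => {If I}.
    move=> I; rewrite /b /X ux x1/= /rl_step ux /h -powRN opprB; ring.
have i1 : mu.-integrable setT (EFin \o (fun x => b x * h 1)).
  by have := integrableZr measurableT (h 1) integrable_b.
have i2 : mu.-integrable setT (fun x => (b x * h 1 - X x)%:E).
  by have := integrableB measurableT i1 integrable_X; apply: eq_integrable.
rewrite integralD//.
rewrite (integral12_prod_meas1 integrable_D) integral_D.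
under eq_integral do rewrite EFinB.
rewrite integralB_EFin//.
rewrite subeK; last exact: integrable_fin_num.
under eq_integral do rewrite EFinM.
rewrite integralZr// integral_beta_affine//.
by rewrite -EFinM mulrC.
Qed.

End point.
End path.
End rl_kernel.

(** * Series of step functions *)

Section step_functions.
Context {R : realType}.
Local Notation mu := (@lebesgue_measure R).
Variables (al : R).
Hypotheses (al01 : 0 < al < 1).

Let al0 : 0 < al. Proof. by case/andP: al01. Qed.
Let al1 : al < 1. Proof. by case/andP: al01. Qed.

Definition step (u x : R) : R := (u < x)%R%:R.

Lemma measurable_step u : measurable_fun setT (step u).
Proof.
rewrite (_ : step u = fun x => if u < x then 1 else 0); first by mfun.
by apply/funext => x; rewrite /step; case: ifP.
Qed.

Lemma step_le u x z : z <= x -> 0 <= step u x - step u z.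
Proof.
move=> zx; rewrite subr_ge0 /step ler_nat.
by case: ltP => // ux; case: ltP => // uz; lra.
Qed.

Definition step_quot (u x z : R) : R :=
  (step u x - step u z) / (x - z) `^ (1 + al).

Lemma measurable_step_quot u x : measurable_fun setT (step_quot u x).
Proof.
have ms := measurable_step u.
rewrite (_ : step_quot u x =
  fun z => (step u x - step u z) * (x - z) `^ (- (1 + al))); first by mfun.
by apply/funext => z; rewrite /step_quot powRN.
Qed.

Lemma step_quot_ge0 u x z : z <= x -> 0 <= step_quot u x z.
Proof. by move=> zx; rewrite divr_ge0 ?powR_ge0// step_le. Qed.

Lemma integral_step_quot u x : 0 <= u -> 0 < x ->
  (\int[mu]_(z in `[0%R, x]) (step_quot u x z)%:E =
   (if u < x then ((x - u) `^ (- al) - x `^ (- al)) / al else 0)%:E)%E.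
Proof.
move=> u0 x0; case: ifPn => ux; last first.
  apply: integral0_eq => z; rewrite /= in_itv/= => /andP[z0 zx].
  rewrite /step_quot /step (negbTE ux) ltNge (le_trans zx) ?subrr ?mul0r//.
  by rewrite leNgt.
rewrite integral_itv_bndoo; last first.
  by apply/measurable_EFinP; apply: measurable_funTS; exact: measurable_step_quot.
transitivity (\int[mu]_(z in `]0%R, u[) ((x - z) `^ (- al - 1))%:E)%E.
  rewrite -(@integral_itv_bndoo _ 0 u _ true false); last first.
    by apply: measurable_funTS; mfun.
  rewrite -(@integral_itv_obnd_cbnd _ 0 (BRight u)); last first.
    by apply: measurable_funTS; mfun.
  rewrite !integral_itv_if; apply: eq_integral => z _; rewrite !in_itv/=.
  have [z0|//] := boolP (0 < z).
  rewrite /step_quot /step ux -powRN (_ : - (1 + al) = - al - 1); last by ring.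
  have [zu|uz] := leP z u; first by rewrite (le_lt_trans zu ux)/= subr0 mul1r.
  by rewrite subrr mul0r if_same.
have [u_gt0|u_le0] := ltP 0 u; last first.
  have -> : u = 0 by apply/eqP; rewrite eq_le u0 u_le0.
  by rewrite set_itvoo0 integral_set0 subr0 subrr mul0r.
rewrite integral_powRBr ?oppr_eq0 ?gt_eqF//; last by left.
by congr EFin; rewrite subr0 invrN mulrN -mulNr opprB.
Qed.

Lemma integrable_step_quot u x : 0 < x ->
  mu.-integrable `[0, x] (EFin \o step_quot u x).
Proof.
move=> x0; apply/integrableP; split.
  by apply/measurable_EFinP; apply: measurable_funTS; exact: measurable_step_quot.
rewrite (_ : (\int[mu]_(z in `[0%R, x]) `|_|)%E =
    (\int[mu]_(z in `[0%R, x]) (step_quot u x z)%:E)%E).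
  have [u0|u0] := leP 0 u; first by rewrite integral_step_quot// ltry.
  rewrite integral0_eq// => z; rewrite /= in_itv/= => /andP[z0 zx].
  by rewrite /step_quot /step (lt_trans u0 x0) (lt_le_trans u0 z0) subrr mul0r.
apply: eq_integral => z; rewrite inE/= in_itv/= => /andP[_ zx].
by rewrite ger0_norm// step_quot_ge0.
Qed.

(* A list of pairs (c, u) encodes the simple function with a jump c at each u. *)
Definition stepf (l : seq (R * R)) (x : R) : R :=
  \sum_(p <- l) p.1 * step p.2 x.

Definition stepf_deriv (l : seq (R * R)) (x : R) : R :=
  \sum_(p <- l) p.1 * rl_step al p.2 x.

Definition stepf_var (l : seq (R * R)) (x : R) : R :=
  \sum_(p <- l) `|p.1| * rl_step al p.2 x.

Lemma measurable_stepf l : measurable_fun setT (stepf l).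
Proof.
apply: measurable_sum => p; have := measurable_step p.2 => h; mfun.
Qed.

Lemma stepf_derivE l x : (forall p, p \in l -> 0 <= p.2) -> 0 < x ->
  stepf l x / x `^ al + al * \int[mu]_(z in `[0, x])
    ((stepf l x - stepf l z) / (x - z) `^ (1 + al)) = stepf_deriv l x.
Proof.
move=> l0 x0.
have iq p := integrable_step_quot p.2 x0.
have -> : \int[mu]_(z in `[0, x]) ((stepf l x - stepf l z) / (x - z) `^ (1 + al)) =
   \sum_(p <- l) p.1 * (if p.2 < x then ((x - p.2) `^ (- al) - x `^ (- al)) / al else 0).
  rewrite /Rintegral.
  under eq_integral => z _.
    rewrite /stepf -sumrB mulr_suml -sumEFin.
    under eq_bigr => p _ do rewrite -mulrBr -mulrA -/(step_quot p.2 x z) EFinM.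
    over.
  rewrite integral_sum//=; last by move=> p; apply: integrableZl => //; exact: iq.
  rewrite big_seq; under eq_bigr => p pl.
    rewrite integralZl//; last exact: iq.
    rewrite integral_step_quot ?l0// -EFinM.
    over.
  by rewrite -big_seq sumEFin.
rewrite mulr_sumr /stepf mulr_suml -big_split/=; apply: eq_bigr => p _.
rewrite /step /rl_step; case: ifPn => px; rewrite ?mulr0 ?mul0r ?addr0// mulr1.
by rewrite -powRN; field; rewrite gt_eqF.
Qed.

Lemma stepf_var_le l x : (forall p, p \in l -> 0 <= p.2) -> 0 < x ->
  ((`|stepf l x| / x `^ al)%:E + \int[mu]_(z in `[0%R, x])
    (`|stepf l x - stepf l z| / (x - z) `^ (1 + al))%:E <=
    (al^-1 * stepf_var l x)%:E)%E.
Proof.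
move=> l0 x0.
have mq p : measurable_fun `[0, x] (fun z => `|p.1| * step_quot p.2 x z).
  by apply: measurable_funTS; have := measurable_step_quot p.2 x => h; mfun.
have iE : (\int[mu]_(z in `[0%R, x]) (\sum_(p <- l) `|p.1| * step_quot p.2 x z)%:E =
   (\sum_(p <- l) `|p.1| *
     (if p.2 < x then ((x - p.2) `^ (- al) - x `^ (- al)) / al else 0)%R)%:E)%E.
  rewrite -sumEFin.
  under eq_integral do rewrite -sumEFin.
  rewrite ge0_integral_sum//=; last 2 first.
  - by move=> p; apply/measurable_EFinP; exact: mq.
  - move=> p z; rewrite /= in_itv/= => /andP[_ zx].
    by rewrite lee_fin mulr_ge0// step_quot_ge0.
  rewrite big_seq [RHS]big_seq.
  apply: eq_bigr => p pl; under eq_integral do rewrite EFinM.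
  rewrite ge0_integralZl_EFin//.
  - by rewrite integral_step_quot ?l0.
  - by move=> z; rewrite /= in_itv/= => /andP[_ zx]; rewrite lee_fin step_quot_ge0.
  - by apply/measurable_EFinP; apply: measurable_funTS; exact: measurable_step_quot.
apply: (@le_trans _ _ ((\sum_(p <- l) `|p.1| * (step p.2 x / x `^ al))%:E +
   \int[mu]_(z in `[0%R, x]) (\sum_(p <- l) `|p.1| * step_quot p.2 x z)%:E)%E).
  apply: leeD.
    rewrite lee_fin; under [leRHS]eq_bigr do rewrite mulrA.
    rewrite -mulr_suml ler_wpM2r ?invr_ge0 ?powR_ge0//.
    apply: (le_trans (ler_norm_sum _ _ _)); apply: ler_sum => p _.
    by rewrite normrM (@ger0_norm _ (step _ _))// /step ler0n.
  apply: ge0_le_integral => //.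
  - by move=> z _; rewrite lee_fin divr_ge0 ?powR_ge0.
  - apply: measurable_funTS; have := measurable_stepf l => h.
    rewrite (_ : (fun z => _) = fun z => (`|stepf l x - stepf l z| * (x - z) `^ (- (1 + al)))%:E).
      by mfun.
    by apply/funext => z; rewrite powRN.
  - apply/measurable_EFinP; apply: measurable_sum => p; exact: mq.
  - move=> z; rewrite /= in_itv/= => /andP[_ zx]; rewrite lee_fin.
    under [leRHS]eq_bigr do rewrite mulrA.
    rewrite -mulr_suml ler_wpM2r ?invr_ge0 ?powR_ge0// /stepf -sumrB.
    apply: (le_trans (ler_norm_sum _ _ _)); apply: ler_sum => p _.
    by rewrite -mulrBr normrM (ger0_norm (step_le _ zx)).
rewrite iE -EFinD lee_fin -big_split/= /stepf_var mulr_sumr.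
apply: ler_sum => p _; rewrite -mulrDr mulrCA ler_wpM2l//.
rewrite /step /rl_step; case: ifPn => px; last by rewrite mul0r !addr0 mulr0.
rewrite mul1r -powRN.
have ai : 1 <= al^-1 by rewrite invf_ge1// ltW.
have xal := powR_ge0 x (- al).
by rewrite [X in _ + X]mulrC; nra.
Qed.

End step_functions.

Lemma integral_sum_seq d (T : measurableType d) (R : realType)
    (m : {measure set T -> \bar R}) (D : set T) (I : eqType)
    (f : I -> T -> \bar R) (s : seq I) : measurable D ->
  (forall i, i \in s -> m.-integrable D (f i)) ->
  (\int[m]_(x in D) (\sum_(i <- s) f i x) = \sum_(i <- s) \int[m]_(x in D) f i x)%E.
Proof.
move=> mD; elim: s => [|i s IH] fi.
  by under eq_integral do rewrite big_nil; rewrite integral0 big_nil.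
have fs j : j \in s -> m.-integrable D (f j).
  by move=> js; apply: fi; rewrite inE js orbT.
under eq_integral do rewrite big_cons.
rewrite integralD//; first by rewrite big_cons IH.
- by apply: fi; rewrite mem_head.
- have := @integrable_sum _ _ _ m D mD I s (fun j => j \in s) f fs.
  by apply: eq_integrable => // x _; rewrite -big_seq.
Qed.

Section assembly.
Context {R : realType}.
Local Notation mu := (@lebesgue_measure R).
Variables (al : R).
Hypotheses (al01 : 0 < al < 1).

Let al0 : 0 < al. Proof. by case/andP: al01. Qed.
Let al1 : al < 1. Proof. by case/andP: al01. Qed.

Variables (t : nat -> R) (L : nat -> seq (R * R)) (J : R -> nat).
Hypothesis t0 : forall m, 0 <= t m.
Hypothesis Lt : forall m p, p \in L m -> t m <= p.2.
Hypothesis HJ : forall x m, x < 1 -> (J x <= m)%N -> x <= t m.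

Definition stages n := flatten [seq L m | m <- iota 0 n].

Lemma stagesS n : stages n.+1 = stages n ++ L n.
Proof. by rewrite /stages -addn1 iotaD map_cat flatten_cat/= cats0 add0n. Qed.

Lemma stages_ge0 n p : p \in stages n -> 0 <= p.2.
Proof. by move=> /flattenP[s /mapP[m _ ->] /Lt]; exact: le_trans. Qed.

(* Before time 1 only finitely many stages are nonzero, and J x bounds their
   number at x. *)
Definition step_series x := if x < 1 then stepf (stages (J x)) x else 0.

Lemma rl_step_eq0 u x : x <= u -> rl_step al u x = 0.
Proof. by move=> xu; rewrite /rl_step ltNge xu. Qed.

Lemma stepf_stages_eq n n' x : (n <= n')%N -> (forall m, (n <= m)%N -> x <= t m) ->
  stepf (stages n') x = stepf (stages n) x /\
  stepf_deriv al (stages n') x = stepf_deriv al (stages n) x.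
Proof.
move=> nn' xt; elim: n' nn' => [|n' IH]; first by rewrite leqn0 => /eqP ->.
rewrite leq_eqVlt => /predU1P[->//|nn'].
have xtn p : p \in L n' -> x <= p.2.
  by move=> /Lt; apply: le_trans; exact: xt.
have [<- <-] := IH nn'; rewrite stagesS /stepf /stepf_deriv !big_cat/=.
split; rewrite [X in _ + X]big_seq [X in _ + X]big1 ?addr0// => p /xtn xp.
  by rewrite /step ltNge xp mulr0.
by rewrite rl_step_eq0 ?mulr0.
Qed.

Lemma step_seriesE n x : x < 1 -> (forall m, (n <= m)%N -> x <= t m) ->
  step_series x = stepf (stages n) x.
Proof.
move=> x1 xt; rewrite /step_series x1.
have [nJ|Jn] := leqP n (J x).
  by have [] := stepf_stages_eq nJ xt.
have xJ m : (J x <= m)%N -> x <= t m by exact: HJ.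
by have [-> _] := stepf_stages_eq (ltnW Jn) xJ.
Qed.

Lemma cvg_step_series x :
  (if x < 1 then stepf (stages n) x else 0) @[n --> \oo] --> step_series x.
Proof.
have [x1|x1] := boolP (x < 1); last first.
  by rewrite /step_series (negbTE x1); exact: cvg_cst.
apply: cvg_near_cst; exists (J x) => // n /= Jn.
by rewrite (@step_seriesE n)// => m nm; apply: HJ => //; exact: leq_trans nm.
Qed.

Lemma measurable_step_series : measurable_fun setT step_series.
Proof.
apply: (@measurable_fun_cvg _ (measurableTypeR R) R setT (fun n x => if x < 1 then stepf (stages n) x else 0)).
- by move=> n; have := measurable_stepf (stages n) => h; mfun.
- by move=> x _; exact: cvg_step_series.
Qed.

Definition stage_var (x : R) : \bar R :=
  (\sum_(0 <= m <oo) (stepf_var al (L m) x)%:E)%E.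

Lemma stepf_var_ge0 (l : seq (R * R)) x : 0 <= stepf_var al l x.
Proof. by apply: sumr_ge0 => p _; rewrite mulr_ge0 ?rl_step_ge0. Qed.

Lemma measurable_stepf_var (l : seq (R * R)) : measurable_fun setT (stepf_var al l).
Proof. by apply: measurable_sum => p; have := measurable_rl_step al p.2 => h; mfun. Qed.

Lemma measurable_stage_var : measurable_fun setT stage_var.
Proof.
apply: (@ge0_emeasurable_sum _ _ _ _ (fun m x => (stepf_var al (L m) x)%:E) xpredT).
- by move=> m x _ _; rewrite lee_fin stepf_var_ge0.
- by move=> m _; apply/measurable_EFinP; exact: measurable_stepf_var.
Qed.

Lemma stepf_var_stages_le n x : ((stepf_var al (stages n) x)%:E <= stage_var x)%E.
Proof.
have -> : (stepf_var al (stages n) x)%:E = (\sum_(0 <= m < n) (stepf_var al (L m) x)%:E)%E.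
  elim: n => [|n IH]; first by rewrite big_nil /stages /stepf_var big_nil.
  by rewrite big_nat_recr//= -IH stagesS /stepf_var big_cat EFinD.
by apply: nneseries_lim_ge => m _; rewrite lee_fin stepf_var_ge0.
Qed.

Let near1 x : x < 1 -> exists n, forall m, (n <= m)%N -> x <= t m.
Proof. by move=> x1; exists (J x) => m; exact: HJ. Qed.

Lemma norm_alpha_step_series :
  (\int[mu]_(x in `]0%R, 1%R[) stage_var x < +oo)%E ->
  finite_norm_alpha al step_series 1.
Proof.
move=> W; split; first by apply: measurable_funTS; exact: measurable_step_series.
have ms := measurable_step_series.
have ms1 : measurable_fun setT (fun z : R * R => step_series z.1).
  by apply: (measurableT_comp ms); mfun.
have ms2 : measurable_fun setT (fun z : R * R => step_series z.2).
  by apply: (measurableT_comp ms); mfun.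
have mI : measurable_fun setT (fun x => (`|step_series x| / x `^ al)%:E +
    \int[mu]_(z in `[0%R, x]) (`|step_series x - step_series z| / (x - z) `^ (1 + al))%:E)%E.
  apply: emeasurable_funD.
    rewrite (_ : (fun x => _) = fun x => (`|step_series x| * x `^ (- al))%:E).
      by mfun.
    by apply/funext => x; rewrite powRN.
  under eq_fun do rewrite integral_itv_if.
  rewrite (_ : (fun x => _) = (fun x => \int[mu]_z
    (if (0 <= z) && (z <= x) then `|step_series x - step_series z| * (x - z) `^ (- (1 + al)) else 0)%:E))%E.
    apply: (@measurable_integral_snd _ (fun p => if (0 <= p.2) && (p.2 <= p.1) then
     `|step_series p.1 - step_series p.2| * (p.1 - p.2) `^ (- (1 + al)) else 0)).
    by mfun.
  apply/funext => x; apply: eq_integral => z _; rewrite in_itv/= -powRN.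
  by case: ifP.
rewrite /norm_alpha (@integral_itv_bndoo _ 0 1 _ true false); last exact/measurable_funTS.
apply: (@le_lt_trans _ _ (\int[mu]_(x in `]0%R, 1%R[) (al^-1%:E * stage_var x))%E).
  apply: ge0_le_integral => //.
  - move=> x _; apply: adde_ge0; first by rewrite lee_fin divr_ge0 ?powR_ge0.
    by apply: integral_ge0 => z _; rewrite lee_fin divr_ge0 ?powR_ge0.
  - exact/measurable_funTS.
  - by apply: measurable_funeM; apply: measurable_funTS; exact: measurable_stage_var.
  move=> x; rewrite /= in_itv/= => /andP[x0 x1].
  have [n xt] := near1 x1.
  apply: le_trans (_ : (al^-1 * stepf_var al (stages n) x)%:E <= _)%E; last first.
    by rewrite EFinM; apply: lee_pmul => //; [rewrite lee_fin invr_ge0 ltW|rewrite lee_fin stepf_var_ge0|exact: stepf_var_stages_le].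
  have := stepf_var_le al01 (@stages_ge0 n) x0; apply: le_trans.
  rewrite (step_seriesE x1 xt) leeD// le_eqVlt; apply/orP; left; apply/eqP.
  apply: eq_integral => z; rewrite inE/= in_itv/= => /andP[_ zx].
  rewrite (@step_seriesE n z)//; first exact: le_lt_trans x1.
  by move=> m /xt; exact: le_trans.
rewrite ge0_integralZl_EFin//.
- by apply: lte_mul_pinfty => //; rewrite lee_fin invr_ge0 ltW.
- by move=> x _; apply: nneseries_ge0 => m _ _; rewrite lee_fin stepf_var_ge0.
- by apply: measurable_funTS; exact: measurable_stage_var.
- by rewrite invr_ge0 ltW.
Qed.

Variable g : R -> R.
Hypothesis cg : continuous g.
Hypothesis gP : forall m p, p \in L m ->
  (\int[mu]_x ((if x < 1 then rl_step al p.2 x else 0)%:E * rl_abs al g x) < +oo)%E /\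
  (\int[mu]_x ((if x < 1 then rl_step al p.2 x else 0) * rl_right al g x)%:E =
   ((g 1 - g p.2) * (Gamma (1 - al) * Gamma al))%:E)%E.
Hypothesis W : (\int[mu]_(x in `]0%R, 1%R[) (stage_var x * rl_abs al g x) < +oo)%E.

Let mr : measurable_fun setT (rl_right al g).
Proof. exact: measurable_rl_right. Qed.

Let step_right u : 0 <= u ->
  (\int[mu]_x ((if x < 1 then rl_step al u x else 0)%:E * rl_abs al g x) < +oo)%E ->
  mu.-integrable `]0, 1[ (fun x => (rl_step al u x * rl_right al g x)%:E) /\
  (\int[mu]_(x in `]0%R, 1%R[) (rl_step al u x * rl_right al g x)%:E =
   \int[mu]_x ((if x < 1 then rl_step al u x else 0) * rl_right al g x)%:E)%E.
Proof.
move=> u0 hK; split.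
  have iS : mu.-integrable `]0, 1[ (fun x =>
      ((if x < 1 then rl_step al u x else 0) * rl_right al g x)%:E).
    apply: (integrableS measurableT) => //.
    exact: integrable_rl_right.
  apply: eq_integrable iS => // x; rewrite inE/= in_itv/= => /andP[_ ->] //.
rewrite integral_oo_if; apply: eq_integral => x _; congr EFin.
have [x1|x1] := boolP (x < 1); last by rewrite andbF mul0r.
have [//|x0] := boolP (0 < x).
by rewrite rl_step_eq0 ?mul0r// (le_trans _ u0)// leNgt.
Qed.

Let stepf_deriv_right n :
  mu.-integrable `]0, 1[ (fun x => (stepf_deriv al (stages n) x * rl_right al g x)%:E) /\
  (\int[mu]_(x in `]0%R, 1%R[) (stepf_deriv al (stages n) x * rl_right al g x)%:E =
   ((\sum_(p <- stages n) p.1 * (g 1 - g p.2)) * (Gamma (1 - al) * Gamma al))%:E)%E.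
Proof.
have E x : ((stepf_deriv al (stages n) x * rl_right al g x)%:E =
    \sum_(p <- stages n) p.1%:E * (rl_step al p.2 x * rl_right al g x)%:E)%E.
  rewrite /stepf_deriv mulr_suml -sumEFin; apply: eq_bigr => p _.
  by rewrite -EFinM mulrA.
have stP p : p \in stages n -> exists m, p \in L m.
  by move=> /flattenP[s /mapP[m _ ->] pm]; exists m.
have iE p : p \in stages n ->
    mu.-integrable `]0, 1[ (fun x => (p.1%:E * (rl_step al p.2 x * rl_right al g x)%:E)%E).
  move=> pn; have [m pm] := stP p pn; apply: integrableZl => //.
  exact: (step_right (stages_ge0 pn) (gP pm).1).1.
split.
  have := @integrable_sum _ _ _ mu `]0%R, 1%R[ (measurable_itv _) _ (stages n) (fun p => p \in stages n) _ iE.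
  by apply: eq_integrable => // x _; rewrite E big_seq.
under eq_integral do rewrite E.
rewrite integral_sum_seq//.
rewrite mulr_suml -sumEFin big_seq [RHS]big_seq; apply: eq_bigr => p pn.
have [m pm] := stP p pn; have [i1 i2] := step_right (stages_ge0 pn) (gP pm).1.
by rewrite integralZl// i2 (gP pm).2 -EFinM; congr EFin; ring.
Qed.

Lemma gLS_step_series (v : R) :
  \sum_(p <- stages n) p.1 * (g 1 - g p.2) @[n --> \oo] --> v ->
  gLS_integral al step_series g 1 = v.
Proof.
move=> cv.
pose D x := step_series x / x `^ al + al * \int[mu]_(z in `[0, x])
    ((step_series x - step_series z) / (x - z) `^ (1 + al)).
have DE x n : 0 < x < 1 -> (forall m, (n <= m)%N -> x <= t m) ->
    D x = stepf_deriv al (stages n) x.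
  move=> /andP[x0 x1] xt; rewrite -(stepf_derivE al01 (@stages_ge0 n) x0) /D.
  rewrite (step_seriesE x1 xt); congr (_ + _ * _); apply: eq_Rintegral => z.
  rewrite inE/= in_itv/= => /andP[_ zx].
  rewrite (@step_seriesE n z)//; first exact: le_lt_trans x1.
  by move=> m /xt; exact: le_trans.
have D_cvg x : 0 < x < 1 -> \forall n \near \oo, stepf_deriv al (stages n) x = D x.
  move=> x01; have /andP[_ x1] := x01; exists (J x) => // n /= Jn.
  by rewrite (DE _ n)// => m nm; apply: HJ => //; exact: leq_trans nm.
have msd l : measurable_fun setT (stepf_deriv al l).
  by apply: measurable_sum => p; have := measurable_rl_step al p.2 => h; mfun.
have mD : measurable_fun (`]0, 1[%classic : set R) D.
  apply: (@measurable_fun_cvg _ (measurableTypeR R) R _ (fun n x => stepf_deriv al (stages n) x)).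
  - by move=> n; apply: measurable_funTS; exact: msd.
  - move=> x; rewrite /= in_itv/= => x01; apply: cvg_near_cst.
    by apply: filterS (D_cvg x x01).
have G0 : Gamma (1 - al) * Gamma al != 0.
  have := beta_gt0 al01; rewrite integral_beta_Gamma// lte_fin => h.
  by rewrite gt_eqF.
rewrite /gLS_integral -/(rl_right al g).
rewrite [X in _ * X](_ : _ = v * (Gamma (1 - al) * Gamma al)).
  by rewrite mulrC mulfK.
have mr1 : measurable_fun (`]0, 1[%classic : set R) (rl_right al g).
  by apply: measurable_funTS; exact: mr.
have mDr : measurable_fun (`]0, 1[%classic : set R) (fun x => (D x * rl_right al g x)%:E).
  have h := measurable_funM mD mr1.
  by move/measurable_EFinP : h.
rewrite [LHS](_ : _ = \int[mu]_(x in `]0, 1[) (D x * rl_right al g x)); last first.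
  rewrite /Rintegral.
  by rewrite (@integral_itv_bndoo _ 0 1 _ true false mDr).
rewrite /Rintegral.
have ma := measurable_rl_abs al cg.
have := @dominated_convergence _ _ _ mu `]0%R, 1%R[ (measurable_itv _)
  (fun n x => (stepf_deriv al (stages n) x * rl_right al g x)%:E)
  (fun x => (D x * rl_right al g x)%:E)
  (fun x => (stage_var x * rl_abs al g x)%E) _ mDr _ _ _.
case.
- move=> n; have m1 := @measurable_funTS _ _ _ _ (`]0, 1[%classic : set R) _ (msd (stages n)).
  have h := measurable_funM m1 mr1.
  by move/measurable_EFinP : h.
- apply: aeW => x; rewrite /= in_itv/= => x01; apply: cvg_EFin; first exact: nearW.
  by apply: cvg_near_cst; apply: filterS (D_cvg x x01) => n /= ->.
- apply/integrableP; split.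
    apply: measurable_funTS; apply: emeasurable_funM => //.
    exact: measurable_stage_var.
  rewrite (_ : (\int[mu]_(x in _) `|_|)%E = (\int[mu]_(x in `]0%R, 1%R[) (stage_var x * rl_abs al g x))%E)//.
  apply: eq_integral => x _; rewrite gee0_abs//; apply: mule_ge0; last exact: rl_abs_ge0.
  by apply: nneseries_ge0 => m _ _; rewrite lee_fin stepf_var_ge0.
- apply: aeW => x n; rewrite /= in_itv/= => /andP[x0 x1].
  rewrite normrM EFinM; apply: lee_pmul => //; last exact: le_rl_right_abs.
  apply: le_trans (stepf_var_stages_le n x).
  rewrite lee_fin /stepf_deriv /stepf_var.
  apply: (le_trans (ler_norm_sum _ _ _)); apply: ler_sum => p _.
  by rewrite normrM (ger0_norm (rl_step_ge0 _ _ _)).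
move=> _ _.
have -> : [sequence (\int[mu]_(x in `]0%R, 1%R[) (stepf_deriv al (stages n) x * rl_right al g x)%:E)%E]_n
   = (fun n => ((\sum_(p <- stages n) p.1 * (g 1 - g p.2)) * (Gamma (1 - al) * Gamma al))%:E).
  by apply/funext => n; rewrite /= (stepf_deriv_right n).2.
move=> h1.
have h2 : ((\sum_(p <- stages n) p.1 * (g 1 - g p.2)) * (Gamma (1 - al) * Gamma al))%:E
   @[n --> \oo] --> (v * (Gamma (1 - al) * Gamma al))%:E.
  apply: cvg_EFin; first exact: nearW.
  by apply: cvgMr_tmp.
by rewrite (cvg_unique _ h1 h2).
Qed.

End assembly.

Section hitting.
Context {R : realFieldType}.
Variables (x : nat -> R) (r th : R).
Hypotheses (x0 : x 0%N = 0) (r0 : 0 < r) (th01 : 0 < th <= 1).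

Definition not_hit (k : nat) : bool := all (fun j => x j ^+ 2 < r) (iota 0 k.+1).

Definition hit_coef (k : nat) : R := 2 * x k * (not_hit k)%:R.

Lemma not_hitS k : not_hit k.+1 = not_hit k && (x k.+1 ^+ 2 < r).
Proof. by rewrite /not_hit -[k.+2]addn1 iotaD all_cat/= andbT add0n. Qed.

Lemma not_hit_lt k : not_hit k -> x k ^+ 2 < r.
Proof. by move=> /allP; apply; rewrite mem_iota add0n ltnS leqnn. Qed.

Lemma hit_coef_sqr k : hit_coef k ^+ 2 <= 4 * r.
Proof.
rewrite /hit_coef; have [/not_hit_lt h|_] := boolP (not_hit k).
  by rewrite mulr1; nra.
by rewrite mulr0 expr0n/= mulr_ge0// ltW.
Qed.

(* Before the hitting time the sum equals x_m ^+ 2 minus the quadratic variation,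
   and it is frozen afterwards; the last step overshoots by O(th * r). *)
Lemma hit_sum_error n :
  \sum_(k < n) (x k.+1 - x k) ^+ 2 <= th ^+ 2 * r -> r <= x n ^+ 2 ->
  `|\sum_(k < n) hit_coef k * (x k.+1 - x k) - r| <= 2 * th * r.
Proof.
move=> Qn xn; have /andP[th0 th1] := th01.
pose Q m := \sum_(k < m) (x k.+1 - x k) ^+ 2.
pose S m := \sum_(k < m) hit_coef k * (x k.+1 - x k).
have QS m : Q m.+1 = Q m + (x m.+1 - x m) ^+ 2 by rewrite /Q big_ord_recr.
have SS m : S m.+1 = S m + hit_coef m * (x m.+1 - x m) by rewrite /S big_ord_recr.
have Q_ge0 m : 0 <= Q m by apply: sumr_ge0 => k _; rewrite sqr_ge0.
have Q_le m : (m <= n)%N -> Q m <= th ^+ 2 * r.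
  move=> mn; apply: le_trans Qn; rewrite -(subnKC mn) /Q big_split_ord/= lerDl.
  by apply: sumr_ge0 => k _; rewrite sqr_ge0.
have th2 : th ^+ 2 * r <= 2 * th * r by apply: ler_wpM2r; [exact: ltW|nra].
have main m : (m <= n)%N ->
    if not_hit m then S m = x m ^+ 2 - Q m else `|S m - r| <= 2 * th * r.
  elim: m => [|m IH] mn.
    rewrite /not_hit/= x0 expr0n/= r0 /S /Q !big_ord0; ring.
  move: (IH (ltnW mn)); rewrite not_hitS SS /hit_coef.
  have [hm|hm] /= := boolP (not_hit m); last by rewrite mulr0 mul0r addr0.
  move=> Sm; rewrite mulr1.
  have SE : S m + 2 * x m * (x m.+1 - x m) = x m.+1 ^+ 2 - Q m.+1.
    by rewrite Sm QS; ring.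
  case: ifPn => [_|]; first exact: SE.
  rewrite -leNgt => xr; rewrite ler_norml; apply/andP; split.
    by rewrite SE; have := Q_le _ mn; have := th2; lra.
  have xm := not_hit_lt hm.
  have dm : (x m.+1 - x m) ^+ 2 <= th ^+ 2 * r.
    by apply: le_trans (Q_le _ mn); rewrite QS lerDr.
  have pr : x m * (x m.+1 - x m) <= th * r.
    have h0 : 0 <= th * r by rewrite mulr_ge0 ?ltW.
    have [?|h1] := leP (x m * (x m.+1 - x m)) 0; first by lra.
    rewrite -(@ler_pXn2r _ 2) ?nnegrE ?(ltW h1)// exprMn.
    have -> : (th * r) ^+ 2 = r * (th ^+ 2 * r) by ring.
    by apply: ler_pM; rewrite ?sqr_ge0//; exact: ltW.
  by have := Q_ge0 m; rewrite Sm; lra.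
have := main n (leqnn n); case: ifPn => // /not_hit_lt; rewrite ltNge xn//.
Qed.

End hitting.

Lemma geometric_error (R : realFieldType) (e : nat -> R) (C q : R) (n0 : nat) :
  0 < q -> 0 <= C -> (forall n, 0 <= e n) ->
  (forall n, (n0 <= n)%N -> e n.+1 <= C * q ^+ n + q / 2 * e n) ->
  exists2 C', 0 <= C' & forall n, e n <= C' * q ^+ n.
Proof.
move=> q0 C0 e0 eS.
pose C' := 2 * C / q + \sum_(n < n0.+1) e n / q ^+ n.
have sum0 : 0 <= \sum_(n < n0.+1) e n / q ^+ n.
  by apply: sumr_ge0 => n _; apply: divr_ge0 => //; apply: exprn_ge0; exact: ltW.
have h0 : 0 <= 2 * C / q by rewrite divr_ge0 ?mulr_ge0// (ltW q0).
exists C'; first by rewrite addr_ge0.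
have small n : (n <= n0)%N -> e n <= C' * q ^+ n.
  move=> nn0; rewrite -ler_pdivrMr ?exprn_gt0//.
  apply: (@le_trans _ _ (\sum_(n < n0.+1) e n / q ^+ n)); last by rewrite /C' lerDr.
  rewrite -ltnS in nn0; rewrite (bigD1 (Ordinal nn0))//= lerDl.
  by apply: sumr_ge0 => i _; apply: divr_ge0 => //; apply: exprn_ge0; exact: ltW.
elim=> [|n IH]; first exact: small.
have [nn0|n0n] := leqP n.+1 n0; first exact: small.
apply: (le_trans (eS n _)); first by rewrite -ltnS.
have qn : 0 < q ^+ n by rewrite exprn_gt0.
have Cq : C <= C' * q / 2.
  rewrite ler_pdivlMr// -ler_pdivrMr// (mulrC C) /C' lerDl//.
rewrite exprS; apply: (@le_trans _ _ (C' * q / 2 * q ^+ n + q / 2 * (C' * q ^+ n))).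
  by apply: lerD; [apply: ler_wpM2r => //; exact: ltW|apply: ler_wpM2l => //; rewrite divr_ge0// ltW].
by rewrite le_eqVlt; apply/orP; left; apply/eqP; field.
Qed.

(** * Fractional Brownian motion *)

Section fbm.
Context {d : measure_display} {T : measurableType d} {R : realType}.
Variables (P : probability T R) (F : R -> set (set T)).
Hypothesis F_filtration : filtration F.
Variables (H : R) (B : R -> T -> R).
Hypotheses (H0 : 0 < H) (B_fBm : fractional_brownian_motion P F H B).

Lemma adapted_measurable (X : R -> T -> R) t : adapted F X -> t \in `[0, 1] ->
  measurable_fun setT (X t).
Proof.
move=> aX t01 _ Y mY; rewrite setTI.
have [Ft _] := F_filtration; have [_] := Ft t t01.
by apply; exact: aX.
Qed.

Lemma fbm_measurable t : t \in `[0, 1] -> measurable_fun setT (B t).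
Proof. by move=> t01; apply: adapted_measurable t01; case: B_fBm. Qed.

Let cov s t : s \in `[0, 1] -> t \in `[0, 1] ->
  (\int[P]_w (B t w * B s w)%:E =
  (2^-1 * (s `^ (2 * H) + t `^ (2 * H) - `|s - t| `^ (2 * H)))%:E)%E.
Proof. by move=> s01 t01; have [_ _ _ /(_ s t s01 t01) <- _] := B_fBm; rewrite unlock. Qed.

Let integrable_sqr t : t \in `[0, 1] -> P.-integrable setT (fun w => (B t w * B t w)%:E).
Proof.
move=> t01; have mB := fbm_measurable t01.
apply/integrableP; split; first by mfun.
under eq_integral do rewrite gee0_abs ?lee_fin -?expr2 ?sqr_ge0//.
by under eq_integral do rewrite expr2; rewrite cov// ltry.
Qed.

Let integrable_prod s t : s \in `[0, 1] -> t \in `[0, 1] ->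
  P.-integrable setT (fun w => (B t w * B s w)%:E).
Proof.
move=> s01 t01; have mt := fbm_measurable t01; have ms := fbm_measurable s01.
apply: (@le_integrable _ _ _ P setT measurableT _
  (fun w => ((B t w * B t w)%:E + (B s w * B s w)%:E)%E)).
- by mfun.
- move=> w _; rewrite -EFinD !abse_EFin lee_fin.
  rewrite (@ger0_norm _ (_ + _)) -?expr2 ?addr_ge0 ?sqr_ge0//.
  by rewrite ler_norml; apply/andP; split; nra.
- by apply: integrableD => //; exact: integrable_sqr.
Qed.

Lemma fbm_integral_sqr s t : s \in `[0, 1] -> t \in `[0, 1] ->
  (\int[P]_w ((B t w - B s w) ^+ 2)%:E = (`|t - s| `^ (2 * H))%:E)%E.
Proof.
move=> s01 t01.
have i1 := integrable_sqr t01; have i2 := integrable_sqr s01.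
have i3 := integrable_prod s01 t01.
have i4 : P.-integrable setT (fun w => (-2%:E * (B t w * B s w)%:E)%E).
  exact: integrableZl.
transitivity (\int[P]_w (((B t w * B t w)%:E + (B s w * B s w)%:E) +
    (- 2%:E * (B t w * B s w)%:E)))%E.
  apply: eq_integral => w _; rewrite -EFinN -EFinM -!EFinD; congr EFin; ring.
rewrite integralD//; last exact: integrableD.
rewrite integralD// -EFinN integralZl// !cov// -EFinM -!EFinD; congr EFin.
rewrite !subrr normr0 powR0 ?mulf_neq0 ?gt_eqF//.
by rewrite (distrC s t); field.
Qed.

Lemma fbm_integral_abs s t : s \in `[0, 1] -> t \in `[0, 1] ->
  (\int[P]_w (`|B t w - B s w|)%:E <= (`|t - s| `^ H)%:E)%E.
Proof.
move=> s01 t01.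
have [->|ts] := eqVneq t s.
  by rewrite integral0_eq ?lee_fin ?powR_ge0// => w _; rewrite subrr normr0.
have mt := fbm_measurable t01; have ms := fbm_measurable s01.
set c := `|t - s| `^ H.
have c0 : 0 < c by rewrite powR_gt0// normr_gt0 subr_eq0.
apply: (@le_trans _ _ (\int[P]_w (((2 * c)^-1)%:E * ((B t w - B s w) ^+ 2)%:E + (c / 2)%:E))%E).
  apply: ge0_le_integral => //.
  - by mfun.
  - apply: emeasurable_funD; last exact: measurable_cst.
    by apply: measurable_funeM; apply/measurable_EFinP; apply: measurable_funX; mfun.
  - move=> w _; rewrite -EFinM -EFinD lee_fin.
    rewrite -(@real_normK _ (B t w - B s w)) ?num_real//; set y := `|_|.
    rewrite -subr_ge0 (_ : _ - y = (y - c) ^+ 2 / (2 * c)).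
      by rewrite divr_ge0 ?sqr_ge0// mulr_ge0// ltW.
    by field; exact: lt0r_neq0.
rewrite ge0_integralD//; last 3 first.
- by move=> w _; rewrite -EFinM lee_fin mulr_ge0 ?sqr_ge0// invr_ge0 mulr_ge0// ltW.
- by apply: measurable_funeM; apply/measurable_EFinP; apply: measurable_funX; mfun.
- by move=> w _; rewrite lee_fin divr_ge0 ?ltW.
rewrite ge0_integralZl_EFin//; last 3 first.
- by move=> w _; rewrite lee_fin sqr_ge0.
- by apply/measurable_EFinP; apply: measurable_funX; mfun.
- by rewrite invr_ge0 mulr_ge0// ltW.
rewrite fbm_integral_sqr// integral_cst//= probability_setT mule1 -EFinM -EFinD lee_fin.
have -> : `|t - s| `^ (2 * H) = c ^+ 2.
  by rewrite mulrC powRrM -powR_mulrn// powR_ge0.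
rewrite le_eqVlt; apply/orP; left; apply/eqP; field; exact: lt0r_neq0.
Qed.

End fbm.

Section density.
Context {R : realType}.
Local Notation mu := (@lebesgue_measure R).

(* Layer-cake formula f x = \int 1[0 < y < f x] dy and Tonelli on both sides. *)
Lemma ge0_integral_density (nu : probability (measurableTypeR R) R) (p f : R -> R) :
  measurable_fun setT p -> (forall x, 0 <= p x) ->
  (forall A, measurable A -> (nu A = \int[mu]_(x in A) (p x)%:E)%E) ->
  measurable_fun setT f -> (forall x, 0 <= f x) ->
  (\int[nu]_x (f x)%:E = \int[mu]_x (f x * p x)%:E)%E.
Proof.
move=> mp p0 nup mf f0.
have layer x : (\int[mu]_y (if (0 < y) && (y < f x) then 1 else 0)%R%:E = (f x)%:E)%E.
  rewrite -(@integral_oo_if R 0 (f x) (fun=> 1)) integral_cst//= mul1e.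
  rewrite lebesgue_measure_itv/= lte_fin oppr0 adde0; case: ltP => // fx.
  by congr EFin; apply/eqP; rewrite eq_le f0 fx.
have mf1 : measurable_fun setT (fun z : R * R => f z.1).
  by apply: (measurableT_comp mf); mfun.
have mp1 : measurable_fun setT (fun z : R * R => p z.1).
  by apply: (measurableT_comp mp); mfun.
under eq_integral do rewrite -layer.
rewrite (@fubini_tonelli _ _ _ _ R nu mu
  (fun z : R * R => (if (0 < z.2) && (z.2 < f z.1) then 1 else 0)%R%:E)); last 2 first.
- by mfun.
- by move=> z; rewrite lee_fin; case: ifP.
transitivity (\int[mu]_y \int[mu]_x (if (0 < y) && (y < f x) then p x else 0)%R%:E)%E.
  apply: eq_integral => y _ /=.
  pose A := [set x | (0 < y) && (y < f x)].
  have mA : measurable A.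
    have : measurable_fun setT (fun x => (0 < y) && (y < f x)) by mfun.
    by move=> /(_ measurableT [set true]); rewrite setTI; apply.
  have AE x : (x \in A) = (0 < y) && (y < f x) by apply/idP/idP; rewrite inE.
  transitivity (nu A).
    rewrite -[RHS]mul1e -integral_cst// integral_mkcond/=; apply: eq_integral => x _.
    by rewrite patchE AE; case: ifP.
  rewrite nup// integral_mkcond; apply: eq_integral => x _.
  by rewrite patchE AE; case: ifP.
rewrite -(@fubini_tonelli _ _ _ _ R mu mu
  (fun z : R * R => (if (0 < z.2) && (z.2 < f z.1) then p z.1 else 0)%R%:E)); last 2 first.
- by mfun.
- by move=> z; rewrite lee_fin; case: ifP.
apply: eq_integral => x _ /=.
rewrite EFinM -layer -ge0_integralZr//.
- by apply: eq_integral => y _; rewrite -EFinM; case: ifP; rewrite ?mul1r ?mul0r.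
- by mfun.
- by move=> y _; rewrite lee_fin; case: ifP.
- by rewrite lee_fin.
Qed.

Lemma normal_variance_le (m s : R) : s != 0 ->
  (\int[normal_prob m s]_x ((x - m) ^+ 2)%:E <= (6 * s ^+ 2)%:E)%E.
Proof.
move=> s0; have s20 : 0 < s ^+ 2 by rewrite exprn_even_gt0.
rewrite (@ge0_integral_density _ (normal_pdf m s)); last 5 first.
- exact: measurable_normal_pdf.
- by move=> x; exact: normal_pdf_ge0.
- by [].
- by apply: measurable_funX; mfun.
- by move=> x; rewrite sqr_ge0.
pose s' := Num.sqrt 2 * s.
have s'0 : s' != 0 by rewrite mulf_neq0// sqrtr_eq0 -ltNge.
have s'2 : s' ^+ 2 = 2 * s ^+ 2 by rewrite exprMn sqr_sqrtr.
have pk : normal_peak s = Num.sqrt 2 * normal_peak s'.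
  rewrite /normal_peak s'2 -[_ *+ 2]mulr_natr -[2 * _ * _ *+ 2]mulr_natr -!mulrA.
  by rewrite (@sqrtrM _ 2)// invfM mulVKf// sqrtr_eq0 -ltNge.
have c2 : 0 <= 4 * s ^+ 2 * Num.sqrt 2 by rewrite mulr_ge0 ?sqrtr_ge0// mulr_ge0// ltW.
apply: (@le_trans _ _ (\int[mu]_x ((4 * s ^+ 2 * Num.sqrt 2)%:E * (normal_pdf m s' x)%:E))%E).
  apply: ge0_le_integral => //.
  - by move=> x _; rewrite lee_fin mulr_ge0 ?sqr_ge0 ?normal_pdf_ge0.
  - apply/measurable_EFinP; apply: measurable_funM; last exact: measurable_normal_pdf.
    by apply: measurable_funX; mfun.
  - by apply: measurable_funeM; apply/measurable_EFinP; exact: measurable_normal_pdf.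
  move=> x _; rewrite -EFinM lee_fin /normal_pdf (negbTE s0) (negbTE s'0) pk.
  rewrite /normal_fun s'2.
  pose y := (x - m) ^+ 2 / (4 * s ^+ 2).
  have -> : - (x - m) ^+ 2 / (s ^+ 2 *+ 2) = - y - y.
    by rewrite /y -mulr_natr; field; rewrite s0.
  have -> : - (x - m) ^+ 2 / ((2 * s ^+ 2) *+ 2) = - y.
    by rewrite /y -mulr_natr; field; rewrite s0.
  have -> : (x - m) ^+ 2 = 4 * s ^+ 2 * y.
    by rewrite /y; field; rewrite s0.
  rewrite expRD.
  have pk0 := normal_peak_ge0 s'.
  have sq0 : 0 <= Num.sqrt (2 : R) by exact: sqrtr_ge0.
  have yE : y * expR (- y) <= 1.
    rewrite expRN ler_pdivrMr ?expR_gt0// mul1r.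
    by apply: le_trans (expR_ge1Dx y); lra.
  have -> : 4 * s ^+ 2 * y * (Num.sqrt 2 * normal_peak s' * (expR (- y) * expR (- y))) =
     (y * expR (- y)) * (4 * s ^+ 2 * Num.sqrt 2 * (normal_peak s' * expR (- y))) by ring.
  apply: ler_piMl => //.
  by rewrite mulr_ge0// mulr_ge0 ?expR_ge0.
rewrite ge0_integralZl_EFin//; last 2 first.
- by move=> x _; rewrite lee_fin normal_pdf_ge0.
- by apply/measurable_EFinP; exact: measurable_normal_pdf.
rewrite integral_normal_pdf mule1 lee_fin.
have : Num.sqrt (2 : R) <= 3 / 2.
  rewrite -(@ler_pXn2r _ 2) ?nnegrE ?sqrtr_ge0// sqr_sqrtr//; lra.
nra.
Qed.

End density.

Section small_ball.
Context {d : measure_display} {T : measurableType d} {R : realType}.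
Variable P : probability T R.
Local Notation mu := (@lebesgue_measure R).

Lemma ge0_integral_law (X : T -> R) (m : {measure set (measurableTypeR R) -> \bar R})
    (f : R -> R) : measurable_fun setT X ->
  (forall A, measurable A -> P (X @^-1` A) = m A) ->
  measurable_fun setT f -> (forall x, 0 <= f x) ->
  (\int[P]_w (f (X w))%:E = \int[m]_x (f x)%:E)%E.
Proof.
move=> mX Xm mf f0.
have h := @ge0_integral_pushforward _ _ T (measurableTypeR R) R X mX P setT
  (fun x => (f x)%:E) measurableT.
have mfE : measurable_fun setT (fun x => (f x)%:E) by exact/measurable_EFinP.
have fE0 : {in [set: R], forall y, (0 <= (f y)%:E)%E} by move=> x _; rewrite lee_fin.
have := h mfE fE0; rewrite preimage_setT => /esym hh.
apply: (eq_trans hh).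
by apply: eq_measure_integral => A mA _; exact: Xm.
Qed.

Lemma gaussian_small_ball (X : T -> R) (sg e : R) :
  gaussian_rv P X -> P.-integrable setT (EFin \o X) ->
  (\int[P]_w (X w)%:E = 0)%E ->
  P.-integrable setT (fun w => (X w ^+ 2)%:E) ->
  (\int[P]_w (X w ^+ 2)%:E = (sg ^+ 2)%:E)%E -> 0 < sg -> 0 < e ->
  (P [set w | (X w ^+ 2 < (e * sg) ^+ 2)%R] <= (4 * e)%:E)%E.
Proof.
move=> [mX [m [s Xlaw]]] iX X0 iX2 X2 sg0 e0.
have mXm : measurable_fun setT (fun x : R => (x - m) ^+ 2).
  by apply: measurable_funX; mfun.
have EXm : (\int[P]_w ((X w - m) ^+ 2)%:E = (sg ^+ 2 + m ^+ 2)%:E)%E.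
  have i2 : P.-integrable setT (fun w => ((-2 * m)%:E * (X w)%:E)%E) by exact: integrableZl.
  have i3 : P.-integrable setT (fun w : T => (m ^+ 2)%:E).
    exact: finite_measure_integrable_cst.
  transitivity (\int[P]_w (((X w ^+ 2)%:E + (-2 * m)%:E * (X w)%:E) + (m ^+ 2)%:E))%E.
    by apply: eq_integral => w _; rewrite -EFinM -!EFinD; congr EFin; ring.
  rewrite integralD//; last exact: integrableD.
  rewrite integralD// integralZl// X0 mule0 adde0 X2 integral_cst//=.
  by rewrite probability_setT mule1 EFinD.
have EXm_gt0 : 0 < sg ^+ 2 + m ^+ 2 by rewrite ltr_wpDr ?sqr_ge0// exprn_gt0.
have [s0|s0] := eqVneq s 0.
  have XD A : measurable A -> P (X @^-1` A) = \d_m A.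
    by move=> mA; rewrite Xlaw// /gaussian_law s0 eqxx.
  move: EXm; rewrite (@ge0_integral_law X (@dirac _ (measurableTypeR R) m R) (fun x => (x - m) ^+ 2))//; last first.
    by move=> x; exact: sqr_ge0.
  rewrite integral_dirac//; last exact/measurable_EFinP.
  rewrite diracT mul1e subrr expr0n/= => -[h].
  by move: EXm_gt0; rewrite -h ltxx.
have XN A : measurable A -> P (X @^-1` A) = normal_prob m s A.
  by move=> mA; rewrite Xlaw// /gaussian_law (negbTE s0).
have sgs : sg ^+ 2 <= 6 * s ^+ 2.
  have : (\int[P]_w ((X w - m) ^+ 2)%:E <= (6 * s ^+ 2)%:E)%E.
    rewrite (@ge0_integral_law X (normal_prob m s) (fun x => (x - m) ^+ 2))//.
      exact: normal_variance_le.
    by move=> x; exact: sqr_ge0.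
  rewrite EXm lee_fin; apply: le_trans.
  by rewrite lerDl sqr_ge0.
have es0 : 0 < e * sg by rewrite mulr_gt0.
have -> : [set w | X w ^+ 2 < (e * sg) ^+ 2] = X @^-1` `](- (e * sg)), (e * sg)[%classic.
  apply/seteqP; split => w /=; rewrite in_itv/= -ltr_norml -[X w ^+ 2]real_normK ?num_real//.
    by rewrite ltr_pXn2r ?nnegrE// ltW.
  by rewrite ltr_pXn2r ?nnegrE// ltW.
rewrite XN//.
apply: (@le_trans _ _ (\int[mu]_(x in `](- (e * sg))%R, (e * sg)%R[) (normal_peak s)%:E)%E).
  apply: ge0_le_integral => //.
  - by move=> x _; rewrite lee_fin normal_pdf_ge0.
  - by apply: measurable_funTS; apply/measurable_EFinP; exact: measurable_normal_pdf.
  - by move=> x _; rewrite lee_fin normal_pdf_ub.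
rewrite integral_cst//= lebesgue_measure_itv/= lte_fin ifT; last by lra.
rewrite -EFinD -EFinM lee_fin opprK.
have pk0 := normal_peak_ge0 s.
suff h : normal_peak s * sg <= 2.
  have -> : normal_peak s * (e * sg + e * sg) = 2 * e * (normal_peak s * sg) by ring.
  have : 0 <= 2 * e by rewrite mulr_ge0// ltW.
  by move=> /ler_wpM2l /(_ _ _ h); lra.
rewrite -(@ler_pXn2r _ 2) ?nnegrE ?mulr_ge0 ?(ltW sg0)// exprMn.
have s20 : 0 < s ^+ 2 by rewrite exprn_even_gt0.
have pi2 := @pi_ge2 R.
have -> : normal_peak s ^+ 2 = (2 * s ^+ 2 * pi)^-1.
  rewrite /normal_peak exprVn sqr_sqrtr; last by rewrite mulrn_wge0// mulr_ge0 ?pi_ge0// ltW.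
  by rewrite -mulr_natl mulrA.
rewrite mulrC ler_pdivrMr; last by apply: mulr_gt0; [apply: mulr_gt0|lra].
have : 2 * s ^+ 2 <= pi * s ^+ 2 by rewrite ler_wpM2r// ltW.
lra.
Qed.

End small_ball.

Lemma geometric_nneseries_lty (R : realType) (c q : R) : 0 <= c -> 0 <= q < 1 ->
  (\sum_(0 <= n <oo) (c * q ^+ n)%:E < +oo)%E.
Proof.
move=> c0 /andP[q0 q1].
have h : series (geometric c q) n @[n --> \oo] --> c / (1 - q).
  by apply: cvg_geometric_series; rewrite ger0_norm.
rewrite (_ : (\sum_(0 <= n <oo) (c * q ^+ n)%:E)%E = (c / (1 - q))%:E) ?ltry//.
apply/cvg_lim => //.
rewrite (_ : (fun n => _) = EFin \o series (geometric c q)); last first.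
  by apply/funext => n /=; rewrite /series/= -sumEFin.
by apply: cvg_EFin; first exact: nearW.
Qed.

Lemma ae_eventually_notin d (T : measurableType d) (R : realType)
    (P : {measure set T -> \bar R}) (A : nat -> set T) (c : R) :
  0 <= c -> (forall n, measurable (A n)) ->
  (forall n, (P (A n) <= (c * 2^-1 ^+ n)%:E)%E) ->
  {ae P, forall w, exists n0, forall n, (n0 <= n)%N -> ~ A n w}.
Proof.
move=> c0 mA PA.
have h : (\sum_(0 <= n <oo) P (A n) < +oo)%E.
  apply: le_lt_trans (@geometric_nneseries_lty _ c 2^-1 c0 _).
    by apply: lee_nneseries.
  by apply/andP; split; lra.
exists (lim_sup_set A); split; first by
  apply: bigcapT_measurable => n; apply: bigcup_measurable => k _; exact: mA.
  exact: lim_sup_set_cvg0.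
move=> w /= Aw n _ /=; apply: contrapT => nA; apply: Aw; exists n => k nk Ak.
by apply: nA; exists k.
Qed.

Section fbm_paths.
Context {d : measure_display} {T : measurableType d} {R : realType}.
Variables (P : probability T R) (F : R -> set (set T)).
Hypothesis F_filtration : filtration F.
Variables (H : R) (B : R -> T -> R).
Hypotheses (H0 : 0 < H) (B_fBm : fractional_brownian_motion P F H B).
Local Notation mu := (@lebesgue_measure R).

Let mB t : t \in `[0, 1] -> measurable_fun setT (B t).
Proof. exact: (fbm_measurable F_filtration B_fBm). Qed.

Let integrable_fbm t : t \in `[0, 1] -> P.-integrable setT (EFin \o B t).
Proof.
move=> t01; have mt := mB t01.
have i2 : P.-integrable setT (fun w => ((B t w * B t w)%:E + 1)%E).
  apply: integrableD => //; last exact: finite_measure_integrable_cst.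
  apply/integrableP; split; first by mfun.
  under eq_integral do rewrite gee0_abs ?lee_fin -?expr2 ?sqr_ge0//.
  under eq_integral do rewrite expr2.
  by have [_ _ _ /(_ t t t01 t01) + _] := B_fBm; rewrite unlock => ->; rewrite ltry.
apply: le_integrable i2 => //; first exact/measurable_EFinP.
move=> w _; rewrite -EFinD !abse_EFin lee_fin (@ger0_norm _ (_ + _)).
  have := sqr_ge0 (`|B t w| - 1); rewrite -expr2 -(@real_normK _ (B t w)) ?num_real//.
  by set y := `|_|; nra.
by rewrite addr_ge0// -expr2 sqr_ge0.
Qed.

Lemma fbm_small_ball s t e : s \in `[0, 1] -> t \in `[0, 1] -> s != t -> 0 < e ->
  (P [set w | ((B t w - B s w) ^+ 2 < (e * `|t - s| `^ H) ^+ 2)%R] <= (4 * e)%:E)%E.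
Proof.
move=> s01 t01 st e0.
have ms := mB s01; have mt := mB t01.
have is1 := integrable_fbm s01; have it1 := integrable_fbm t01.
have E0 r : r \in `[0, 1] -> (\int[P]_w (B r w)%:E = 0)%E.
  by move=> r01; have [_ _ /(_ r r01) + _ _] := B_fBm; rewrite unlock.
have X2 : (\int[P]_w ((B t w - B s w) ^+ 2)%:E = ((`|t - s| `^ H) ^+ 2)%:E)%E.
  rewrite (fbm_integral_sqr F_filtration H0 B_fBm s01 t01).
  by rewrite mulrC powRrM -powR_mulrn// powR_ge0.
have iX : P.-integrable setT (EFin \o (fun w => B t w - B s w)).
  by have := integrableB measurableT it1 is1; apply: eq_integrable.
apply: (@gaussian_small_ball _ _ _ P (fun w => B t w - B s w)) => //.
- have [_ gB _ _ _] := B_fBm.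
  have := gB 2 (fun i => if i == ord0 then t else s) (fun i => if i == ord0 then 1 else -1).
  rewrite (_ : (fun w => \sum_(i < 2) _) = (fun w => B t w - B s w)).
    by apply => i; case: ifP.
  by apply/funext => w; rewrite !big_ord_recl big_ord0/= mul1r mulN1r addr0.
- under eq_integral do rewrite EFinB.
  by rewrite integralB_EFin// !E0// subee.
- apply/integrableP; split.
    by apply/measurable_EFinP; apply: measurable_funX; mfun.
  under eq_integral do rewrite gee0_abs ?lee_fin ?sqr_ge0//.
  by rewrite X2 ltry.
- by rewrite powR_gt0// normr_gt0 subr_eq0 eq_sym.
Qed.

(* Extends the paths to R by constants, so that they become continuous there. *)
Definition clamp (x : R) : R := Num.max 0 (Num.min 1 x).

Lemma clamp_itv x : clamp x \in `[0, 1].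
Proof. by rewrite in_itv/= /clamp le_max lexx/= ge_max ler01/= ge_min lexx. Qed.

Lemma clampE x : x \in `[0, 1] -> clamp x = x.
Proof.
by rewrite in_itv/= => /andP[x0 x1]; rewrite /clamp min_r// max_r.
Qed.

Lemma clamp_lipschitz x y : `|clamp x - clamp y| <= `|x - y|.
Proof.
have E z : [\/ clamp z = 0 /\ z <= 0, clamp z = z /\ 0 <= z <= 1 | clamp z = 1 /\ 1 <= z].
  rewrite /clamp; have [z1|z1] := leP 1 z.
    by rewrite max_r//; apply: Or33.
  have [z0|z0] := leP 0 z; first by apply: Or32; split=> //=; exact: ltW.
  by apply: Or31; split=> //; exact: ltW.
have h1 := ler_norm (x - y); have h2 := ler_norm (y - x); rewrite distrC in h2.
rewrite ler_norml; move: h1 h2; set n := `|x - y| => h1 h2.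
have [[-> ?]|[-> /andP[? ?]]|[-> ?]] := E x;
  have [[-> ?]|[-> /andP[? ?]]|[-> ?]] := E y; apply/andP; split; lra.
Qed.

Lemma clamped_path_continuous w : continuous (fun x => B (clamp x) w).
Proof.
have [_ _ _ _ /(_ w) cB] := B_fBm.
move=> x; have /subspace_continuousP/(_ (clamp x) (clamp_itv x)) h := cB.
apply/cvgrPdist_lt => e e0; have /cvgrPdist_lt/(_ e e0) := h.
move=> [dl dl0 hd]; exists dl => // y /= xy.
apply: hd; last exact: clamp_itv.
exact: le_lt_trans (clamp_lipschitz _ _) xy.
Qed.

(* Joint measurability comes from piecewise constant approximation in time. *)
Let pc (n : nat) (z : R * T) : R :=
  \sum_(k < n.+1) (if (k%:R <= n.+1%:R * z.1) && (n.+1%:R * z.1 < k.+1%:R)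
    then B (clamp (k%:R / n.+1%:R)) z.2 else 0).

Definition fbm01 (z : R * T) : R :=
  if (0 <= z.1) && (z.1 < 1) then B (clamp z.1) z.2 else 0.

Let pcE n x w : 0 <= x < 1 -> exists k : nat, 
  [/\ k%:R <= n.+1%:R * x, n.+1%:R * x < k.+1%:R & pc n (x, w) = B (clamp (k%:R / n.+1%:R)) w].
Proof.
move=> /andP[x0 x1]; set y := n.+1%:R * x.
have y0 : 0 <= y by rewrite mulr_ge0.
have yn : y < n.+1%:R by rewrite /y gtr_pMr.
have /andP[k1 k2] := Num.Theory.truncn_itv y0.
exists (Num.truncn y); split => //.
have kn : (Num.truncn y < n.+1)%N by rewrite -(ltr_nat R) (le_lt_trans k1).
rewrite /pc /= (bigD1 (Ordinal kn))//= k1 k2/= big1 ?addr0// => i ik.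
case: ifP => // /andP[i1 i2]; exfalso; move/negP: ik; apply; apply/eqP/val_inj => /=.
apply/eqP; rewrite eqn_leq; apply/andP; split; rewrite -ltnS -(ltr_nat R).
  exact: le_lt_trans i1 k2.
exact: le_lt_trans k1 i2.
Qed.

Lemma measurable_fbm01 : measurable_fun setT fbm01.
Proof.
apply: (@measurable_fun_cvg _ _ _ _ pc).
- move=> n; apply: measurable_sum => k.
  have mk : measurable_fun setT (fun z : R * T => B (clamp (k%:R / n.+1%:R)) z.2).
    by apply: (measurableT_comp (mB (clamp_itv _))); mfun.
  by mfun.
- move=> [x w] _; rewrite /fbm01/=.
  have [x01|x01] := boolP ((0 <= x) && (x < 1)); last first.
    apply: cvg_near_cst; apply: nearW => n; rewrite /pc big1// => k _ /=.
    case: ifP => // /andP[k1 k2]; exfalso; move/negP: x01; apply.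
    have n0 : 0 < n.+1%:R :> R by [].
    apply/andP; split.
      by rewrite -(pmulr_rge0 _ n0) (le_trans _ k1).
    rewrite -(ltr_pM2l n0) mulr1; apply: (lt_le_trans k2).
    by rewrite ler_nat.
  have cb := @clamped_path_continuous w x.
  apply/cvgrPdist_lt => e e0; have /cvgrPdist_lt/(_ e e0) [dl /= dl0 hd] := cb.
  have := @cvg_harmonic R => /cvgrPdist_lt/(_ dl dl0); apply: filterS => n.
  rewrite /harmonic/= sub0r normrN ger0_norm ?invr_ge0// => nd.
  have [k [k1 k2 ->]] := pcE n w x01.
  apply: hd => /=; apply: le_lt_trans nd.
  have n0 : 0 < n.+1%:R :> R by [].
  rewrite -(ler_pM2l n0) mulfV ?gt_eqF// -[X in X * _](gtr0_norm n0) -normrM.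
  rewrite mulrBr mulrCA mulfV ?gt_eqF// mulr1 ger0_norm ?subr_ge0//.
  by move: (ltW k2); rewrite -(natr1 k) lerBlDr addrC.
Qed.

Section rl_abs_expectation.
Variable al : R.
Hypotheses (al01 : 0 < al < 1) (Hal : 1 - H < al).

Let al0 : 0 < al. Proof. by case/andP: al01. Qed.
Let al1 : al < 1. Proof. by case/andP: al01. Qed.
Let p0 : 0 < H + al - 1. Proof. by rewrite subr_gt0 addrC -ltrBlDr. Qed.

Definition path_of (w : T) (x : R) : R := B (clamp x) w.

Let in01 (x : R) : 0 < x < 1 -> x \in `[0, 1].
Proof. by move=> /andP[x0 x1]; rewrite in_itv/= !ltW. Qed.

Let fbm01E (x : R) w : 0 <= x < 1 -> fbm01 (x, w) = path_of w x.
Proof. by rewrite /fbm01/= => ->. Qed.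

Let mfbm01 := measurable_fbm01.

Let m1 : measurable_fun setT (B 1).
Proof. by apply: mB; rewrite in_itv/= ler01 lexx. Qed.

Let inner (z : (R * T) * R) : R :=
  if (z.1.1 < z.2) && (z.2 < 1) then
    `|fbm01 (z.2, z.1.2) - fbm01 z.1| * (z.2 - z.1.1) `^ (al - 2) else 0.

Let inner_ge0 z : 0 <= inner z.
Proof. by rewrite /inner; case: ifP => // _; rewrite mulr_ge0 ?powR_ge0. Qed.

Let measurable_inner : measurable_fun setT inner.
Proof.
have h1 : measurable_fun setT (fun z : (R * T) * R => fbm01 z.1).
  by apply: (measurableT_comp mfbm01); mfun.
have h2 : measurable_fun setT (fun z : (R * T) * R => fbm01 (z.2, z.1.2)).
  apply: (measurableT_comp mfbm01); apply: measurable_fun_pair => //.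
  exact: (measurableT_comp measurable_snd).
by rewrite /inner; mfun.
Qed.

Let jabs (z : R * T) : \bar R :=
  ((`|B 1 z.2 - fbm01 z| * (1 - z.1) `^ (al - 1))%:E +
  (1 - al)%:E * \int[mu]_y (inner (z, y))%:E)%E.

Let measurable_jabs : measurable_fun setT jabs.
Proof.
have h1 : measurable_fun setT (fun z : R * T => B 1 z.2).
  by apply: (measurableT_comp m1); mfun.
apply: emeasurable_funD; first by mfun.
apply: measurable_funeM.
apply: (@measurable_fun_fubini_tonelli_F _ _ _ _ R mu (fun z => (inner z)%:E)).
  exact/measurable_EFinP.
by move=> z; rewrite lee_fin.
Qed.

Let jabsE (x : R) w : 0 < x < 1 -> jabs (x, w) = rl_abs al (path_of w) x.
Proof.
move=> /andP[x0 x1]; have x01 : 0 <= x < 1 by rewrite ltW.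
rewrite /jabs /rl_abs /= fbm01E//; congr (_ + _ * _)%E.
  by rewrite /path_of (@clampE 1)// in_itv/= ler01 lexx.
apply: eq_integral => y _; rewrite /inner/=; congr EFin.
case: ifP => // /andP[xy y1]; rewrite !fbm01E// y1 andbT.
by rewrite (le_trans (ltW x0))// ltW.
Qed.

Let jabs_ge0 z : (0 <= jabs z)%E.
Proof.
apply: adde_ge0; first by rewrite lee_fin mulr_ge0 ?powR_ge0.
apply: mule_ge0; first by rewrite lee_fin subr_ge0 ltW.
by apply: integral_ge0 => y _; rewrite lee_fin.
Qed.

Let C0 : R := 1 + (1 - al) / (H + al - 1).

Let E_jabs (x : R) : 0 < x < 1 -> (\int[P]_w jabs (x, w) <= C0%:E)%E.
Proof.
move=> x01; have /andP[x0 x1] := x01; have xu := in01 x01.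
have one : (1 : R) \in `[0, 1] by rewrite in_itv/= ler01 lexx.
have mx : measurable_fun setT (fun w => fbm01 (x, w)).
  by apply: (measurableT_comp mfbm01); exact: measurable_pair1.
have mi : measurable_fun setT (fun z : T * R => inner ((x, z.1), z.2)).
  apply: (measurableT_comp measurable_inner).
  apply: measurable_fun_pair; last exact: measurable_snd.
  by apply: measurable_fun_pair; [exact: measurable_cst|exact: measurable_fst].
have mI : measurable_fun setT (fun w => \int[mu]_y (inner ((x, w), y))%:E)%E.
  apply: (@measurable_fun_fubini_tonelli_F _ _ _ _ R mu (fun z : T * R => (inner ((x, z.1), z.2))%:E)).
    exact/measurable_EFinP.
  by move=> z; rewrite lee_fin.
have x1' : 0 < 1 - x by rewrite subr_gt0.
have pow1 : (1 - x) `^ (H + al - 1) <= 1.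
  apply: (@le_trans _ _ ((1 - x) `^ 0)); last by rewrite powRr0.
  by apply: ger_powR; [apply/andP; split; lra|exact: ltW].
rewrite /jabs ge0_integralD//=; last 4 first.
- by move=> w _; rewrite lee_fin mulr_ge0 ?powR_ge0.
- by mfun.
- move=> w _; apply: mule_ge0; first by rewrite lee_fin subr_ge0 ltW.
  by apply: integral_ge0 => y _; rewrite lee_fin.
- exact: measurable_funeM.
rewrite /C0 [X in (_ <= X)%E]EFinD; apply: leeD.
  under eq_integral do rewrite EFinM.
  rewrite ge0_integralZr//; last 2 first.
  - by mfun.
  - by rewrite lee_fin powR_ge0.
  apply: (@le_trans _ _ (((1 - x) `^ H)%:E * ((1 - x) `^ (al - 1))%:E)%E).
    apply: lee_wpmul2r; first by rewrite lee_fin powR_ge0.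
    have := fbm_integral_abs F_filtration H0 B_fBm xu one.
    rewrite (gtr0_norm x1'); apply: le_trans.
    rewrite le_eqVlt; apply/orP; left; apply/eqP; apply: eq_integral => w _.
    by rewrite fbm01E ?ltW// /path_of clampE.
  by rewrite -EFinM lee_fin -powRD_gt0// addrA.
rewrite ge0_integralZl_EFin//; last 2 first.
- by move=> w _; apply: integral_ge0 => y _; rewrite lee_fin.
- by rewrite subr_ge0 ltW.
rewrite EFinM; apply: lee_wpmul2l; first by rewrite lee_fin subr_ge0 ltW.
rewrite (@fubini_tonelli _ _ _ _ R P mu (fun z : T * R => (inner ((x, z.1), z.2))%:E)); last 2 first.
- exact/measurable_EFinP.
- by move=> z; rewrite lee_fin.
apply: (@le_trans _ _ (\int[mu]_(y in `]x, 1%R[) ((y - x) `^ (H + al - 1 - 1))%:E)%E).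
  rewrite integral_oo_if; apply: ge0_le_integral => //.
  - by move=> y _; apply: integral_ge0 => w _; rewrite lee_fin.
  - apply: (@measurable_fun_fubini_tonelli_G _ _ _ _ R P (fun z : T * R => (inner ((x, z.1), z.2))%:E)).
      exact/measurable_EFinP.
    by move=> z; rewrite lee_fin.
  - by mfun.
  move=> y _; rewrite /inner/=; case: ifPn => [/andP[xy y1]|_]; last by rewrite integral0.
  have y0 : 0 < y by exact: lt_trans xy.
  have yu : y \in `[0, 1] by apply: in01; rewrite y0.
  have my : measurable_fun setT (fun w => fbm01 (y, w)).
    by apply: (measurableT_comp mfbm01); exact: measurable_pair1.
  under eq_integral do rewrite EFinM.
  rewrite ge0_integralZr//; last 2 first.
  - by mfun.
  - by rewrite lee_fin powR_ge0.
  apply: (@le_trans _ _ (((y - x) `^ H)%:E * ((y - x) `^ (al - 2))%:E)%E).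
    apply: lee_wpmul2r; first by rewrite lee_fin powR_ge0.
    have := fbm_integral_abs F_filtration H0 B_fBm xu yu.
    rewrite gtr0_norm ?subr_gt0//; apply: le_trans.
    rewrite le_eqVlt; apply/orP; left; apply/eqP; apply: eq_integral => w _.
    by rewrite !fbm01E ?ltW// /path_of !clampE.
  rewrite -EFinM lee_fin -powRD_gt0 ?subr_gt0//.
  by rewrite le_eqVlt; apply/orP; left; apply/eqP; congr (_ `^ _); ring.
rewrite integral_powRBl//; [|by rewrite gt_eqF|by right].
rewrite lee_fin subrr powR0 ?gt_eqF// subr0 ler_pdivrMr// mulVf ?gt_eqF//.
Qed.

Lemma ae_integral_rl_abs_lty (k : R -> \bar R) :
  measurable_fun setT k -> (forall x, (0 <= k x)%E) ->
  (\int[mu]_(x in `]0%R, 1%R[) k x < +oo)%E ->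
  {ae P, forall w, (\int[mu]_(x in `]0%R, 1%R[) (k x * rl_abs al (path_of w) x) < +oo)%E}.
Proof.
move=> mk k0 ik.
pose f (z : R * T) : \bar R := ((if (0 < z.1)%R && (z.1 < 1)%R then k z.1 else 0) * jabs z)%E.
have f0 z : (0 <= f z)%E by rewrite mule_ge0//; case: ifP.
have mf : measurable_fun setT f.
  apply: emeasurable_funM => //; apply: measurable_fun_ifT; first by mfun.
    by apply: (measurableT_comp mk); mfun.
  exact: measurable_cst.
have fE w : (\int[mu]_(x in `]0%R, 1%R[) (k x * rl_abs al (path_of w) x) =
    \int[mu]_x f (x, w))%E.
  rewrite integral_itv_if; apply: eq_integral => x _; rewrite in_itv/= /f/=.
  by case: ifPn => [x01|_]; rewrite ?mul0e// jabsE.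
have C00 : 0 <= C0.
  by rewrite addr_ge0// divr_ge0//; [rewrite subr_ge0; exact: ltW|exact: ltW].
have iG : P.-integrable setT (fun w => \int[mu]_x f (x, w))%E.
  apply/integrableP; split.
    exact: (@measurable_fun_fubini_tonelli_G _ _ _ _ R mu f).
  under eq_integral do rewrite gee0_abs ?integral_ge0//.
  rewrite -(@fubini_tonelli _ _ _ _ R mu P f)//.
  apply: (@le_lt_trans _ _ (\int[mu]_x ((if (0 < x)%R && (x < 1)%R then k x else 0) * C0%:E))%E).
    apply: ge0_le_integral => //.
    - by move=> x _; exact: integral_ge0.
    - exact: (@measurable_fun_fubini_tonelli_F _ _ _ _ R P f).
    - apply: emeasurable_funM => //; apply: measurable_fun_ifT => //; mfun.
    move=> x _; rewrite /f/=; case: ifPn => [x01|_]; last first.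
      by under eq_integral do rewrite mul0e; rewrite integral0 mul0e.
    have mj : measurable_fun setT (fun w => jabs (x, w)).
      by apply: (measurableT_comp measurable_jabs); exact: measurable_pair1.
    have j0 w : [set: T] w -> (0 <= jabs (x, w))%E by [].
    have -> := @ge0_integralZl _ _ _ P setT measurableT _ mj _ j0 (k0 x).
    by apply: lee_wpmul2l => //; exact: E_jabs.
  rewrite ge0_integralZr//; last 2 first.
  - by apply: measurable_fun_ifT => //; mfun.
  - by move=> x _; case: ifP.
  rewrite muleC; apply: lte_mul_pinfty => //.
  move: ik; rewrite integral_itv_if; apply: le_lt_trans.
  by rewrite le_eqVlt; apply/orP; left; apply/eqP; apply: eq_integral => x _; rewrite in_itv.
have := integrable_ae measurableT iG; apply: filterS => w /(_ I).
by rewrite fE => /fin_numPlt/andP[].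
Qed.

Lemma ae_increment_quot_lty (u : R) : 0 <= u < 1 ->
  {ae P, forall w, (\int[mu]_(y in `]u, 1%R[)
    (`|path_of w y - path_of w u| * (y - u) `^ (-1))%:E < +oo)%E}.
Proof.
move=> u01; have /andP[u0 u1] := u01.
pose f (z : R * T) : R := if (u < z.1) && (z.1 < 1) then
  `|fbm01 z - fbm01 (u, z.2)| * (z.1 - u) `^ (-1) else 0.
have f0 z : 0 <= f z by rewrite /f; case: ifP => // _; rewrite mulr_ge0 ?powR_ge0.
have mu2 : measurable_fun setT (fun z : R * T => fbm01 (u, z.2)).
  apply: (measurableT_comp mfbm01); apply: measurable_fun_pair => //.
have mf : measurable_fun setT f by rewrite /f; mfun.
have mfE : measurable_fun setT (fun z => (f z)%:E) by exact/measurable_EFinP.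
have fE w : (\int[mu]_(y in `]u, 1%R[)
    (`|path_of w y - path_of w u| * (y - u) `^ (-1))%:E = \int[mu]_x (f (x, w))%:E)%E.
  rewrite integral_oo_if; apply: eq_integral => x _; rewrite /f/=.
  case: ifP => // /andP[ux x1]; rewrite !fbm01E// x1 andbT.
  by rewrite (le_trans u0)// ltW.
have iG : P.-integrable setT (fun w => \int[mu]_x (f (x, w))%:E)%E.
  apply/integrableP; split.
    by apply: (@measurable_fun_fubini_tonelli_G _ _ _ _ R mu (fun z => (f z)%:E)) => // z; rewrite lee_fin.
  under eq_integral do (rewrite gee0_abs; last by apply: integral_ge0 => x _; rewrite lee_fin).
  rewrite -(@fubini_tonelli _ _ _ _ R mu P (fun z => (f z)%:E))//.
  apply: (@le_lt_trans _ _ (\int[mu]_(y in `]u, 1%R[) ((y - u) `^ (H - 1))%:E)%E).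
    rewrite integral_oo_if; apply: ge0_le_integral => //.
    - by move=> x _; apply: integral_ge0 => w _; rewrite lee_fin.
    - by apply: (@measurable_fun_fubini_tonelli_F _ _ _ _ R P (fun z => (f z)%:E)) => // z; rewrite lee_fin.
    - by mfun.
    move=> y _; rewrite /f/=; case: ifPn => [/andP[uy y1]|_]; last by rewrite integral0.
    have y0 : 0 < y by exact: le_lt_trans uy.
    have yu : y \in `[0, 1] by apply: in01; rewrite y0.
    have uu : u \in `[0, 1] by rewrite in_itv/= u0 ltW.
    have my : measurable_fun setT (fun w => fbm01 (y, w)).
      by apply: (measurableT_comp mfbm01); exact: measurable_pair1.
    have mu' : measurable_fun setT (fun w => fbm01 (u, w)).
      by apply: (measurableT_comp mfbm01); exact: measurable_pair1.
    under eq_integral do rewrite EFinM.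
    rewrite ge0_integralZr//; last 2 first.
    - by mfun.
    - by rewrite lee_fin powR_ge0.
    apply: (@le_trans _ _ (((y - u) `^ H)%:E * ((y - u) `^ (-1))%:E)%E).
      apply: lee_wpmul2r; first by rewrite lee_fin powR_ge0.
      have := fbm_integral_abs F_filtration H0 B_fBm uu yu.
      rewrite gtr0_norm ?subr_gt0//; apply: le_trans.
      rewrite le_eqVlt; apply/orP; left; apply/eqP; apply: eq_integral => w _.
      by rewrite (fbm01E _ u01) fbm01E ?(ltW y0)// /path_of (clampE uu) (clampE yu).
    by rewrite -EFinM lee_fin -powRD_gt0 ?subr_gt0.
  rewrite integral_powRBl//; [|by rewrite gt_eqF|by right].
  by rewrite ltry.
have := integrable_ae measurableT iG; apply: filterS => w /(_ I).
by rewrite fE => /fin_numPlt/andP[].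
Qed.

End rl_abs_expectation.
End fbm_paths.

Lemma exprn_powR (R : realType) (x p : R) n : 0 <= x -> (x ^+ n) `^ p = (x `^ p) ^+ n.
Proof.
move=> x0; elim: n => [|n IH]; first by rewrite !expr0 powR1.
by rewrite !exprS powRM ?exprn_ge0// IH.
Qed.

Lemma sumEFin_const (R : realType) (m : nat) (w : R) :
  (\sum_(k < m) w%:E = (m%:R * w)%:E)%E.
Proof.
elim: m => [|m IH]; first by rewrite big_ord0 mul0r.
by rewrite big_ord_recr/= IH -EFinD -natr1 mulrDl mul1r.
Qed.

(** * The approximation scheme *)

Section scheme.
Context {R : realType}.
Local Notation mu := (@lebesgue_measure R).
Variables (H rho : R) (K : nat).
Hypothesis rho01 : 0 < rho < 1.

Let rho0 : 0 < rho. Proof. by case/andP: rho01. Qed.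
Let rho1 : rho < 1. Proof. by case/andP: rho01. Qed.

Definition stage_time (n : nat) : R := 1 - rho ^+ n.
Definition gap (n : nat) : R := (1 - rho) * rho ^+ n.
Definition npts (n : nat) : nat := (2 ^ (K * n))%N.
Definition grid (n k : nat) : R := stage_time n + gap n * (k%:R / (npts n)%:R).
(* The factor 2^-n makes the probability of not reaching the level summable. *)
Definition radius (n : nat) : R := 2^-1 ^+ n * gap n `^ H.
Definition level (n : nat) : R := radius n ^+ 2.

Lemma expn_ratio_itv n : 0 < rho ^+ n <= 1.
Proof. by rewrite exprn_gt0//= exprn_ile1// ltW. Qed.

Lemma gap_gt0 n : 0 < gap n.
Proof. by rewrite mulr_gt0 ?subr_gt0// exprn_gt0. Qed.

Lemma gap_le n : gap n <= rho ^+ n.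
Proof.
by rewrite /gap ger_pMl ?exprn_gt0// gerBl ltW.
Qed.

Lemma stage_timeS n : stage_time n.+1 = stage_time n + gap n.
Proof. by rewrite /stage_time /gap exprS; ring. Qed.

Lemma one_sub_stage_time n : 1 - stage_time n = rho ^+ n.
Proof. by rewrite /stage_time opprB addrC subrK. Qed.

Lemma stage_time_itv n : 0 <= stage_time n < 1.
Proof.
by rewrite /stage_time subr_ge0 gtrBl; have /andP[-> ->] := expn_ratio_itv n.
Qed.

Lemma npts_gt0 n : (0 < npts n)%N.
Proof. by rewrite expn_gt0. Qed.

Let nptsR n : 0 < (npts n)%:R :> R.
Proof. by rewrite ltr0n npts_gt0. Qed.

Lemma radius_gt0 n : 0 < radius n.
Proof. by rewrite mulr_gt0 ?exprn_gt0// powR_gt0// gap_gt0. Qed.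

Lemma level_gt0 n : 0 < level n.
Proof. by rewrite exprn_gt0// radius_gt0. Qed.

Lemma grid0 n : grid n 0 = stage_time n.
Proof. by rewrite /grid mul0r mulr0 addr0. Qed.

Lemma grid_npts n : grid n (npts n) = stage_time n.+1.
Proof. by rewrite /grid divff ?gt_eqF// mulr1 stage_timeS. Qed.

Lemma grid_step n k : grid n k.+1 - grid n k = gap n / (npts n)%:R.
Proof. by rewrite /grid -natr1; field; rewrite gt_eqF. Qed.

Lemma grid_ge n k : stage_time n <= grid n k.
Proof. by rewrite lerDl mulr_ge0 ?divr_ge0// ltW// gap_gt0. Qed.

Lemma grid_le n k : (k <= npts n)%N -> grid n k <= stage_time n.+1.
Proof.
move=> kn; rewrite stage_timeS lerD2l ger_pMr ?gap_gt0//.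
by rewrite ler_pdivrMr// mul1r ler_nat.
Qed.

Lemma grid_itv n k : (k <= npts n)%N -> 0 <= grid n k < 1.
Proof.
move=> kn; have /andP[h1 _] := stage_time_itv n; have /andP[_ h2] := stage_time_itv n.+1.
by rewrite (le_trans h1 (grid_ge n k)) (le_lt_trans (grid_le kn) h2).
Qed.

Lemma grid_leS n k : grid n k <= grid n k.+1.
Proof. by rewrite -subr_ge0 grid_step divr_ge0// ltW// gap_gt0. Qed.

Variables (g zz : R -> R).

Definition grid_hit (n k : nat) : R :=
  hit_coef (fun j => g (grid n j) - g (stage_time n)) (level n) k.

Definition stage_gain (n : nat) : R :=
  \sum_(k < npts n) grid_hit n k * (g (grid n k.+1) - g (grid n k)).

(* The value of the integral accumulated over the first n stages. *)
Fixpoint value (n : nat) : R :=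
  if n is m.+1 then
    value m + (zz (stage_time m) - value m) / level m * stage_gain m
  else 0.

Definition weight (n k : nat) : R :=
  (zz (stage_time n) - value n) / level n * grid_hit n k.

Definition jumps (n : nat) : seq (R * R) :=
  flatten [seq [:: (weight n k, grid n k); (- weight n k, grid n k.+1)]
          | k <- iota 0 (npts n)].

Lemma big_jumps (f : R * R -> R) n : \sum_(p <- jumps n) f p =
  \sum_(k < npts n) (f (weight n k, grid n k) + f (- weight n k, grid n k.+1)).
Proof.
rewrite /jumps big_flatten/= big_map -[X in iota 0 X]subn0 big_mkord.
by apply: eq_bigr => k _; rewrite !big_cons big_nil addr0.
Qed.

Lemma mem_jumps n p : p \in jumps n -> exists2 k, (k <= npts n)%N & p.2 = grid n k.
Proof.
move=> /flattenP[s /mapP[k]]; rewrite mem_iota add0n => /andP[_ kn] ->.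
rewrite !inE => /orP[] /eqP ->/=; [exists k => //; exact: ltnW|by exists k.+1].
Qed.

Lemma sum_stages_jumps n :
  \sum_(p <- stages jumps n) p.1 * (g 1 - g p.2) = value n.
Proof.
elim: n => [|n IH]; first by rewrite /stages big_nil.
rewrite stagesS big_cat IH/= big_jumps /stage_gain big_distrr/=; congr (_ + _).
by apply: eq_bigr => k _; rewrite /weight; ring.
Qed.

Lemma error_step th n : 0 < th <= 1 ->
  \sum_(k < npts n) (g (grid n k.+1) - g (grid n k)) ^+ 2 <= th ^+ 2 * level n ->
  level n <= (g (stage_time n.+1) - g (stage_time n)) ^+ 2 ->
  `|zz (stage_time n.+1) - value n.+1| <=
  `|zz (stage_time n.+1) - zz (stage_time n)| +
    2 * th * `|zz (stage_time n) - value n|.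
Proof.
move=> th01 Q X; have l0 := level_gt0 n.
have h : `|stage_gain n - level n| <= 2 * th * level n.
  have := @hit_sum_error R (fun j => g (grid n j) - g (stage_time n)) (level n) th.
  move=> /(_ _ l0 th01 (npts n)); rewrite grid0 subrr grid_npts => /(_ erefl).
  rewrite (_ : \sum_(k < npts n) _ =
      \sum_(k < npts n) (g (grid n k.+1) - g (grid n k)) ^+ 2); last first.
    by apply: eq_bigr => k _; congr (_ ^+ 2); ring.
  move=> /(_ Q X); apply: le_trans; rewrite /stage_gain.
  rewrite le_eqVlt; apply/orP; left; apply/eqP; congr (`|_ - _|).
  by apply: eq_bigr => k _; congr (_ * _); ring.
set e := zz (stage_time n) - value n.
have -> : zz (stage_time n.+1) - value n.+1 = (zz (stage_time n.+1) - zz (stage_time n)) -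
    e / level n * (stage_gain n - level n).
  by rewrite /= -/e /e; field; rewrite gt_eqF.
apply: le_trans (ler_normB _ _) _; rewrite lerD2l.
rewrite normrM normrM normfV (gtr0_norm l0).
apply: (@le_trans _ _ (`|e| / level n * (2 * th * level n))).
  by apply: ler_wpM2l => //; rewrite divr_ge0// ltW.
by rewrite le_eqVlt; apply/orP; left; apply/eqP; field; rewrite gt_eqF.
Qed.

Lemma weight_le n k : `|weight n k| <= `|zz (stage_time n) - value n| * (2 / radius n).
Proof.
have s0 := radius_gt0 n; have l0 := level_gt0 n.
have h : `|grid_hit n k| <= 2 * radius n.
  suff : `|grid_hit n k| ^+ 2 <= (2 * radius n) ^+ 2.
    by rewrite ler_pXn2r// nnegrE mulr_ge0// ltW.
  rewrite -normrX ger0_norm ?sqr_ge0//.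
  apply: le_trans (hit_coef_sqr _ l0 _) _; rewrite /level.
  by rewrite le_eqVlt; apply/orP; left; apply/eqP; ring.
rewrite /weight normrM normrM normfV (gtr0_norm l0).
apply: (@le_trans _ _ (`|zz (stage_time n) - value n| / level n * (2 * radius n))).
  by apply: ler_wpM2l => //; rewrite divr_ge0// ltW.
by rewrite /level le_eqVlt; apply/orP; left; apply/eqP; field; rewrite gt_eqF.
Qed.

End scheme.

Section domination.
Context {R : realType}.
Local Notation mu := (@lebesgue_measure R).
Variables (H rho a al : R) (K : nat).
Hypotheses (rho01 : 0 < rho < 1) (al01 : 0 < al < 1).
Hypothesis rho_small : rho `^ a * rho `^ (1 - al) / rho `^ H * 2 ^+ K.+1 <= 2^-1.

Let rho0 : 0 < rho. Proof. by case/andP: rho01. Qed.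
Let rho1 : rho < 1. Proof. by case/andP: rho01. Qed.
Let al1 : 0 < 1 - al. Proof. by case/andP: al01 => _; rewrite subr_gt0. Qed.

Lemma integral_rl_step (u : R) : 0 <= u < 1 ->
  (\int[mu]_(x in `]0%R, 1%R[) (rl_step al u x)%:E = ((1 - u) `^ (1 - al) / (1 - al))%:E)%E.
Proof.
move=> /andP[u0 u1].
rewrite [LHS](_ : _ = (\int[mu]_(x in `]u, 1%R[) ((x - u) `^ (1 - al - 1))%:E)%E).
  rewrite integral_powRBl//; [|by rewrite gt_eqF|by right].
  by rewrite subrr powR0 ?gt_eqF// subr0.
rewrite !integral_oo_if; apply: eq_integral => x _; congr EFin.
rewrite /rl_step (_ : 1 - al - 1 = - al); last by ring.
have [ux|xu] := ltP u x; last by case: ifP.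
by rewrite (le_lt_trans u0 ux).
Qed.

Local Notation grid := (grid rho K).
Local Notation npts := (npts K).
Local Notation radius := (radius H rho).

(* Dominates the fractional variation of the jumps of stage n when
   |zz (stage_time n) - value n| <= (rho `^ a) ^+ n. *)
Definition jump_majorant (n : nat) (x : R) : R := (rho `^ a) ^+ n * (2 / radius n) *
  \sum_(k < npts n) (rl_step al (grid n k) x + rl_step al (grid n k.+1) x).

Lemma jump_majorant_ge0 n x : 0 <= jump_majorant n x.
Proof.
have r0 := radius_gt0 H rho01 n.
rewrite /jump_majorant; apply: mulr_ge0; last by apply: sumr_ge0 => k _; rewrite addr_ge0 ?rl_step_ge0.
by apply: mulr_ge0; [rewrite exprn_ge0 ?powR_ge0|rewrite divr_ge0// ltW].
Qed.

Lemma measurable_jump_majorant n : measurable_fun setT (jump_majorant n).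
Proof.
apply: measurable_funM; first exact: measurable_cst.
by apply: measurable_sum => k; apply: measurable_funD; exact: measurable_rl_step.
Qed.

Let c : R := 4 / ((1 - al) * (1 - rho) `^ H).

Let integral_rl_step_grid n k : (k <= npts n)%N ->
  (\int[mu]_(x in `]0%R, 1%R[) (rl_step al (grid n k) x)%:E <=
   ((rho `^ (1 - al)) ^+ n / (1 - al))%:E)%E.
Proof.
move=> kn; have h := grid_itv rho01 kn; have /andP[h0 h1] := h.
rewrite integral_rl_step// lee_fin ler_pM2r ?invr_gt0// -exprn_powR ?(ltW rho0)//.
have r0 : 0 <= rho ^+ n by have /andP[/ltW] := expn_ratio_itv rho01 n.
apply: ge0_ler_powR; rewrite ?nnegrE ?(ltW al1)// ?subr_ge0 ?(ltW h1)//.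
have := grid_ge K rho01 n k; rewrite /stage_time; lra.
Qed.

Lemma integral_jump_majorant_le n :
  (\int[mu]_(x in `]0%R, 1%R[) (jump_majorant n x)%:E <= (c * 2^-1 ^+ n)%:E)%E.
Proof.
have r0 := radius_gt0 H rho01 n.
set b := (rho `^ a) ^+ n * (2 / radius n).
have b0 : 0 <= b by apply: mulr_ge0; [rewrite exprn_ge0 ?powR_ge0|rewrite divr_ge0// ltW].
have ms k : measurable_fun (`]0, 1[%classic : set R) (fun x => (rl_step al (grid n k) x)%:E).
  by apply/measurable_EFinP; apply: measurable_funTS; exact: measurable_rl_step.
have s0 k x : (0 <= (rl_step al (grid n k) x)%:E)%E by rewrite lee_fin rl_step_ge0.
apply: (@le_trans _ _ (b%:E * (\sum_(k < npts n) (2 * ((rho `^ (1 - al)) ^+ n / (1 - al)))%:E))%E).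
  rewrite [leLHS](_ : _ = (b%:E * \int[mu]_(x in `]0%R, 1%R[)
     (\sum_(k < npts n) ((rl_step al (grid n k) x)%:E + (rl_step al (grid n k.+1) x)%:E)))%E); last first.
    rewrite -ge0_integralZl_EFin//.
    - apply: eq_integral => x _; rewrite /jump_majorant -/b EFinM -sumEFin.
      by congr (_ * _)%E; apply: eq_bigr => k _; rewrite EFinD.
    - by move=> x _; apply: sume_ge0 => k _; apply: adde_ge0.
    - by apply: emeasurable_sum => k; apply: emeasurable_funD; exact: ms.
  apply: lee_wpmul2l; first by rewrite lee_fin.
  rewrite ge0_integral_sum//; last 2 first.
  - by move=> k; apply: emeasurable_funD; exact: ms.
  - by move=> k x _; apply: adde_ge0.
  apply: lee_sum => k _; rewrite ge0_integralD//; try exact: ms.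
  rewrite mulrDl mul1r EFinD.
  by apply: leeD; apply: integral_rl_step_grid => //; exact: ltnW.
rewrite sumEFin_const -EFinM lee_fin.
have -> : b * ((npts n)%:R * (2 * ((rho `^ (1 - al)) ^+ n / (1 - al)))) =
    c * (rho `^ a * rho `^ (1 - al) / rho `^ H * 2 ^+ K.+1) ^+ n.
  rewrite /b /c /radius /gap powRM ?subr_ge0 ?(ltW rho1)//; last first.
    by have /andP[/ltW] := expn_ratio_itv rho01 n.
  rewrite exprn_powR ?(ltW rho0)// natrX !exprMn exprVn exprVn exprS exprMn -exprM.
  by field; apply/and4P; split; rewrite ?expf_neq0// gt_eqF// powR_gt0// subr_gt0.
have c0 : 0 <= c by rewrite divr_ge0// mulr_ge0 ?powR_ge0// ltW.
move: c c0 => c' c0; apply: ler_wpM2l => //.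
apply: lerXn2r => //; rewrite nnegrE//.
by rewrite !mulr_ge0 ?invr_ge0 ?powR_ge0// exprn_ge0.
Qed.

Definition majorant_series (x : R) : \bar R := (\sum_(0 <= n <oo) (jump_majorant n x)%:E)%E.

Lemma majorant_series_ge0 x : (0 <= majorant_series x)%E.
Proof. by apply: nneseries_ge0 => n _ _; rewrite lee_fin jump_majorant_ge0. Qed.

Lemma measurable_majorant_series : measurable_fun setT majorant_series.
Proof.
apply: (@ge0_emeasurable_sum _ _ _ _ (fun m x => (jump_majorant m x)%:E) xpredT).
- by move=> m x _ _; rewrite lee_fin jump_majorant_ge0.
- by move=> m _; apply/measurable_EFinP; exact: measurable_jump_majorant.
Qed.

Lemma integral_majorant_series_lty : (\int[mu]_(x in `]0%R, 1%R[) majorant_series x < +oo)%E.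
Proof.
rewrite /majorant_series integral_nneseries//; last 2 first.
- by move=> n; apply/measurable_EFinP; apply: measurable_funTS; exact: measurable_jump_majorant.
- by move=> n x _; rewrite lee_fin jump_majorant_ge0.
have c0 : 0 <= c by rewrite divr_ge0// mulr_ge0 ?powR_ge0// ltW.
apply: le_lt_trans (@geometric_nneseries_lty R c 2^-1 c0 _); last by apply/andP; split; lra.
apply: lee_nneseries => [n _ _|n _]; last exact: integral_jump_majorant_le.
by apply: integral_ge0 => x _; rewrite lee_fin jump_majorant_ge0.
Qed.

Variables (g zz : R -> R) (C : R).
Hypothesis C0 : 0 <= C.
Hypothesis err : forall n, `|zz (stage_time rho n) - value H rho K g zz n| <= C * (rho `^ a) ^+ n.

Lemma stage_var_le_majorant_series x :
  (stage_var al (jumps H rho K g zz) x <= C%:E * majorant_series x)%E.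
Proof.
rewrite /stage_var /majorant_series -nneseriesZl//; last by move=> n _; rewrite lee_fin jump_majorant_ge0.
apply: lee_nneseries => [n _ _|n _].
  by rewrite lee_fin; apply: sumr_ge0 => p _; rewrite mulr_ge0 ?rl_step_ge0.
rewrite -EFinM lee_fin /stepf_var big_jumps /jump_majorant mulrA big_distrr/=.
apply: ler_sum => k _; rewrite normrN -mulrDr; apply: ler_wpM2r.
  by rewrite addr_ge0 ?rl_step_ge0.
apply: le_trans (weight_le H K rho01 g zz n k) _.
rewrite [leRHS]mulrA; apply: ler_wpM2r => //.
by rewrite divr_ge0// ltW// radius_gt0.
Qed.

End domination.

Section adaptedness.
Context {d : measure_display} {T : measurableType d} {R : realType}.

Lemma measurable_hit_coef (x : nat -> T -> R) r k :
  (forall j, (j <= k)%N -> measurable_fun setT (x j)) ->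
  measurable_fun setT (fun w => hit_coef (x ^~ w) r k).
Proof.
move=> mx.
have mX j : (j <= k)%N -> measurable_fun setT (fun w => (x j w ^+ 2 < r)%R).
  move=> jk; apply: measurable_fun_ltr; last exact: measurable_cst.
  by apply: measurable_funX; exact: mx.
have mN m : (m <= k)%N -> measurable_fun setT (fun w => not_hit (x ^~ w) r m).
  elim: m => [|m IH] mk; last first.
    under eq_fun do rewrite not_hitS.
    by apply: measurable_and; [apply: IH; exact: ltnW|exact: mX].
  by rewrite /not_hit/=; apply: measurable_and; [exact: mX|exact: measurable_cst].
have mb : measurable_fun setT (fun w => (not_hit (x ^~ w) r k)%:R : R).
  rewrite (_ : (fun w => _) = fun w => if not_hit (x ^~ w) r k then 1 else 0).
    by apply: measurable_fun_ifT; [exact: mN|exact: measurable_cst|exact: measurable_cst].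
  by apply/funext => w; case: (not_hit _ _ _).
rewrite /hit_coef; apply: measurable_funM => //; apply: measurable_funM; first exact: measurable_cst.
exact: mx.
Qed.

Variables (H rho : R) (K : nat) (J : R -> nat) (t : R) (g zz : R -> T -> R).
Hypothesis rho01 : 0 < rho < 1.
Hypothesis mg : forall u, 0 <= u -> u <= t -> measurable_fun setT (g u).
Hypothesis mz : forall u, 0 <= u -> u <= t -> measurable_fun setT (zz u).

Local Notation stage_time := (stage_time rho).
Local Notation grid := (grid rho K).
Local Notation npts := (npts K).

Let grid_ge0 n k : 0 <= grid n k.
Proof. by apply: le_trans (grid_ge K rho01 n k); have /andP[] := stage_time_itv rho01 n. Qed.

Let grid_mono n j k : (j <= k)%N -> grid n j <= grid n k.
Proof.
elim: k => [|k IH]; first by rewrite leqn0 => /eqP ->.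
rewrite leq_eqVlt => /predU1P[->//|/IH h].
exact: le_trans h (grid_leS K rho01 n k).
Qed.

Let time_ge0 n : 0 <= stage_time n.
Proof. by have /andP[] := stage_time_itv rho01 n. Qed.

Let time_le n k : grid n k <= t -> stage_time n <= t.
Proof. exact: le_trans (grid_ge K rho01 n k). Qed.

Let measurable_grid_hit n k : grid n k <= t ->
  measurable_fun setT (fun w => grid_hit H rho K (g ^~ w) n k).
Proof.
move=> nk; apply: (@measurable_hit_coef (fun j w => g (grid n j) w - g (stage_time n) w)).
move=> j jk; apply: measurable_funB; apply: mg => //.
- by apply: le_trans nk; exact: grid_mono.
- exact: time_le nk.
Qed.

Let measurable_value n : stage_time n <= t ->
  measurable_fun setT (fun w => value H rho K (g ^~ w) (zz ^~ w) n).
Proof.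
elim: n => [|n IH] nt; first exact: measurable_cst.
have tn : stage_time n <= t.
  by apply: le_trans nt; rewrite stage_timeS lerDl ltW// gap_gt0.
have gt k : (k <= npts n)%N -> grid n k <= t.
  by move=> kn; apply: le_trans nt; exact: grid_le.
have mV := IH tn.
rewrite /=; apply: measurable_funD => //; apply: measurable_funM.
  apply: measurable_funM; last exact: measurable_cst.
  by apply: measurable_funB => //; exact: mz.
rewrite /stage_gain; apply: measurable_sum => k; apply: measurable_funM.
  by apply: measurable_grid_hit; apply: gt; exact: ltnW.
by apply: measurable_funB; apply: mg => //; apply: gt => //; exact: ltnW.
Qed.

Lemma measurable_step_series_jumps : measurable_fun setT (fun w =>
  step_series (jumps H rho K (g ^~ w) (zz ^~ w)) J t).
Proof.
rewrite /step_series; case: (t < 1); last exact: measurable_cst.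
rewrite /stepf; elim: (J t) => [|n IH].
  rewrite (_ : (fun w => _) = fun=> 0); first exact: measurable_cst.
  by apply/funext => w; rewrite /stages big_nil.
pose Z w := \sum_(k < npts n) (weight H rho K (g ^~ w) (zz ^~ w) n k * step (grid n k) t +
  - weight H rho K (g ^~ w) (zz ^~ w) n k * step (grid n k.+1) t).
rewrite (_ : (fun w => _) = fun w =>
    \sum_(p <- stages (jumps H rho K (g ^~ w) (zz ^~ w)) n) p.1 * step p.2 t + Z w); last first.
  by apply/funext => w; rewrite stagesS big_cat/= big_jumps.
apply: measurable_funD => //.
apply: measurable_sum => k.
have [nk|nk] := leP (grid n k) t; last first.
  have s0 : step (grid n k) t = 0 by rewrite /step ltNge (ltW nk).
  have s1 : step (grid n k.+1) t = 0.
    by rewrite /step ltNge (le_trans (ltW nk))// grid_leS.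
  by under eq_fun do rewrite s0 s1 !mulr0 addr0; exact: measurable_cst.
have mw : measurable_fun setT (fun w => weight H rho K (g ^~ w) (zz ^~ w) n k).
  rewrite /weight; apply: measurable_funM; last exact: measurable_grid_hit.
  apply: measurable_funM; last exact: measurable_cst.
  apply: measurable_funB; first by apply: mz => //; exact: time_le nk.
  by apply: measurable_value; exact: time_le nk.
apply: measurable_funD; apply: measurable_funM; try exact: measurable_cst; first exact: mw.
exact: (measurableT_comp (@oppr_measurable _ setT) mw).
Qed.

End adaptedness.

Lemma exists_stage_index (R : realType) (rho : R) : 0 < rho < 1 ->
  exists J : R -> nat, forall x m, x < 1 -> (J x <= m)%N -> x <= stage_time rho m.
Proof.
move=> rho01; have /andP[rho0 rho1] := rho01.
suff h (x : R) : exists n : nat, forall m, x < 1 -> (n <= m)%N -> x <= stage_time rho m.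
  by have [J hJ] := choice h; exists J => x m; exact: hJ.
have [x1|x1] := ltP x 1; last by exists 0%N.
have x1' : 0 < 1 - x by rewrite subr_gt0.
have rn : `|rho| < 1 by rewrite gtr0_norm.
have /cvgrPdist_lt/(_ _ x1') [n _ hn] := cvg_expr rn.
exists n => m _ nm; have := hn m nm => /=.
rewrite sub0r normrN gtr0_norm ?exprn_gt0// /stage_time => h; lra.
Qed.

Section pathwise.
Context {R : realType}.
Local Notation mu := (@lebesgue_measure R).
Variables (H rho a al : R) (K : nat) (J : R -> nat).
Hypotheses (rho01 : 0 < rho < 1) (al01 : 0 < al < 1) (a0 : 0 < a).
Hypothesis rho_small : rho `^ a * rho `^ (1 - al) / rho `^ H * 2 ^+ K.+1 <= 2^-1.
Hypothesis HJ : forall x m, x < 1 -> (J x <= m)%N -> x <= stage_time rho m.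

Local Notation stage_time := (stage_time rho).
Local Notation grid := (grid rho K).
Local Notation npts := (npts K).
Local Notation level := (level H rho).

Variables (g zz : R -> R) (n0 : nat).
Hypothesis cg : continuous g.
Hypothesis zz_holder : holder_on_unit a zz.
Hypothesis hit : forall n, (n0 <= n)%N ->
  level n <= (g (stage_time n.+1) - g (stage_time n)) ^+ 2.
Hypothesis fine_grid : forall n, (n0 <= n)%N ->
  \sum_(k < npts n) (g (grid n k.+1) - g (grid n k)) ^+ 2 <= (rho `^ a / 4) ^+ 2 * level n.
Hypothesis gK : forall n k, (k <= npts n)%N ->
  (\int[mu]_(x in `]0%R, 1%R[) ((rl_step al (grid n k) x)%:E * rl_abs al g x) < +oo)%E.
Hypothesis gL : forall n k, (k <= npts n)%N ->
  (\int[mu]_(y in `]grid n k, 1%R[) (`|g y - g (grid n k)| * (y - grid n k) `^ (-1))%:E < +oo)%E.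
Hypothesis gD : (\int[mu]_(x in `]0%R, 1%R[) (majorant_series H rho a al K x * rl_abs al g x) < +oo)%E.

Let rho0 : 0 < rho. Proof. by case/andP: rho01. Qed.
Let rho1 : rho < 1. Proof. by case/andP: rho01. Qed.
Let q := rho `^ a.
Let q0 : 0 < q. Proof. exact: powR_gt0. Qed.
Let q1 : q < 1.
Proof.
have := @gt0_ltr_powR _ a a0 rho 1; rewrite powR1; apply => //; rewrite nnegrE//.
exact: ltW.
Qed.

Local Notation V := (value H rho K g zz).
Local Notation psi := (step_series (jumps H rho K g zz) J).

Let time01 n : stage_time n \in `[0, 1].
Proof. by have /andP[h1 h2] := stage_time_itv rho01 n; rewrite in_itv/= h1 ltW. Qed.

Let holder_gap : exists2 C : R, 0 <= C & forall n,
  `|zz (stage_time n.+1) - zz (stage_time n)| <= C * q ^+ n /\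
  `|zz 1 - zz (stage_time n)| <= C * q ^+ n.
Proof.
have [C hC] := zz_holder; exists `|C| => // n.
have key s : s \in `[0, 1] -> stage_time n <= s -> s - stage_time n <= rho ^+ n ->
    `|zz s - zz (stage_time n)| <= `|C| * q ^+ n.
  move=> s01 ns sn; apply: le_trans (hC _ _ s01 (time01 n)) _.
  apply: (@le_trans _ _ (`|C| * `|s - stage_time n| `^ a)).
    by apply: ler_wpM2r; [exact: powR_ge0|exact: ler_norm].
  apply: ler_wpM2l => //; rewrite /q -exprn_powR ?(ltW rho0)//.
  have /andP[/ltW r0 _] := expn_ratio_itv rho01 n.
  rewrite ger0_norm ?subr_ge0//; apply: ge0_ler_powR; rewrite ?nnegrE ?subr_ge0//.
  exact: ltW.
split; apply: key => //.
- by rewrite stage_timeS lerDl ltW// gap_gt0.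
- by rewrite stage_timeS addrC addKr; exact: gap_le.
- by rewrite in_itv/= ler01 lexx.
- by have /andP[_ /ltW] := stage_time_itv rho01 n.
- by rewrite one_sub_stage_time.
Qed.

Let value_error : exists2 C : R, 0 <= C & forall n, `|zz (stage_time n) - V n| <= C * q ^+ n.
Proof.
have [C C0 hC] := holder_gap.
apply: (@geometric_error _ (fun n => `|zz (stage_time n) - V n|) C q n0) => // n nn.
have th : 0 < q / 4 <= 1.
  by have h0 := q0; have h1 := q1; apply/andP; split; lra.
have := @error_step _ H rho K rho01 g zz (q / 4) n th (fine_grid nn) (hit nn).
move=> h; apply: (le_trans h); apply: lerD; first by have [] := hC n.
by rewrite le_eqVlt; apply/orP; left; apply/eqP; field.
Qed.

Let value_cvg : V n @[n --> \oo] --> zz 1.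
Proof.
have [C C0 hC] := holder_gap; have [C' C'0 hC'] := value_error.
apply/cvgrPdist_lt => e e0.
have qn : `|q| < 1 by rewrite gtr0_norm.
have D0 : 0 < e / (C + C' + 1) by rewrite divr_gt0// ltr_wpDl// addr_ge0.
have /cvgrPdist_lt/(_ _ D0) [n _ hn] := cvg_expr qn.
exists n => // m nm /=; have := hn m nm => /=.
rewrite sub0r normrN gtr0_norm ?exprn_gt0// ltr_pdivlMr ?ltr_wpDl ?addr_ge0// => h.
rewrite (_ : zz 1 - V m = (zz 1 - zz (stage_time m)) + (zz (stage_time m) - V m)); last by ring.
apply: (le_lt_trans (ler_normD _ _)); apply: le_lt_trans h.
apply: (@le_trans _ _ (C * q ^+ m + C' * q ^+ m)); first by apply: lerD => //; have [] := hC m.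
have := exprn_gt0 m q0; nra.
Qed.

Lemma pathwise_integral : finite_norm_alpha al psi 1 /\ gLS_integral al psi g 1 = zz 1.
Proof.
have [C C0 hC] := value_error.
have t0 m : 0 <= stage_time m by have /andP[] := stage_time_itv rho01 m.
have Lt m p : p \in jumps H rho K g zz m -> stage_time m <= p.2.
  by move=> /mem_jumps[k _ ->]; exact: grid_ge.
have sD := @stage_var_le_majorant_series R H rho a al K rho01 g zz C hC.
have ms := measurable_majorant_series H a al K rho01.
have mv := measurable_stage_var al (jumps H rho K g zz).
have mA := measurable_rl_abs al cg.
have sv0 x : (0 <= stage_var al (jumps H rho K g zz) x)%E.
  by apply: nneseries_ge0 => m _ _; rewrite lee_fin stepf_var_ge0.
have d0 x := majorant_series_ge0 H a al K rho01 x.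
have dA x := rl_abs_ge0 al01 g x.
have W0 : (\int[mu]_(x in `]0%R, 1%R[) stage_var al (jumps H rho K g zz) x < +oo)%E.
  apply: (@le_lt_trans _ _ (\int[mu]_(x in `]0%R, 1%R[) (C%:E * majorant_series H rho a al K x))%E).
    apply: ge0_le_integral => //.
    - exact: measurable_funTS.
    - by apply: measurable_funTS; exact: measurable_funeM.
  rewrite ge0_integralZl_EFin//; last exact: measurable_funTS.
  by apply: lte_mul_pinfty => //; exact: integral_majorant_series_lty.
have W1 : (\int[mu]_(x in `]0%R, 1%R[)
    (stage_var al (jumps H rho K g zz) x * rl_abs al g x) < +oo)%E.
  apply: (@le_lt_trans _ _ (\int[mu]_(x in `]0%R, 1%R[)
      (C%:E * (majorant_series H rho a al K x * rl_abs al g x)))%E).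
    apply: ge0_le_integral => //.
    - by move=> x _; apply: mule_ge0.
    - by apply: measurable_funTS; exact: emeasurable_funM.
    - by apply: measurable_funTS; apply: measurable_funeM; exact: emeasurable_funM.
    - by move=> x _; rewrite muleA; apply: lee_wpmul2r.
  rewrite ge0_integralZl_EFin//.
  - exact: lte_mul_pinfty.
  - by move=> x _; apply: mule_ge0.
  - by apply: measurable_funTS; exact: emeasurable_funM.
split; first exact: (norm_alpha_step_series al01 t0 Lt HJ W0).
apply: (gLS_step_series al01 t0 Lt HJ cg _ W1); last first.
  by under eq_fun do rewrite sum_stages_jumps; exact: value_cvg.
move=> m p /mem_jumps[k km pk]; have /andP[p0 p1] := grid_itv rho01 km.
have gK' : (\int[mu]_x ((if (x < 1)%R then rl_step al p.2 x else 0)%:E * rl_abs al g x) < +oo)%E.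
  apply: le_lt_trans (gK km); rewrite pk integral_itv_if.
  rewrite le_eqVlt; apply/orP; left; apply/eqP; apply: eq_integral => x _.
  rewrite in_itv/=; have [x0|x0] /= := ltP 0 x; first by case: ifP; rewrite ?mul0e.
  by rewrite rl_step_eq0 ?if_same ?mul0e// (le_trans x0).
split => //; apply: integral_rl_right => //; first by rewrite pk.
by rewrite pk; exact: gL.
Qed.

End pathwise.

(** * Almost sure behaviour of the stages *)

Section fbm_stages.
Context {d : measure_display} {T : measurableType d} {R : realType}.
Variables (P : probability T R) (F : R -> set (set T)).
Hypothesis F_filtration : filtration F.
Variables (H : R) (B : R -> T -> R).
Hypotheses (H0 : 0 < H) (B_fBm : fractional_brownian_motion P F H B).
Variables (rho : R) (K : nat).
Hypothesis rho01 : 0 < rho < 1.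
Local Notation stage_time := (stage_time rho).
Local Notation grid := (grid rho K).
Local Notation npts := (npts K).
Local Notation level := (level H rho).

Lemma adapted_step_series_jumps (J : R -> nat) (z : R -> T -> R) : adapted F z ->
  adapted F (fun t w => step_series (jumps H rho K (path_of B w) (z ^~ w)) J t).
Proof.
move=> z_adapted t t01 A mA.
have [sF _] := F_filtration.1 t t01.
move: (t01); rewrite in_itv/= => /andP[t0 t1].
have mX (Y : R -> T -> R) u : adapted F Y -> 0 <= u -> u <= t ->
    measurable_fun (setT : set (g_sigma_algebraType (F t))) (Y u).
  move=> aY u0 ut _ D mD; rewrite setTI (measurable_g_measurableTypeE sF).
  apply: (F_filtration.2 u t u0 ut t1); apply: aY => //.
  by rewrite in_itv/= u0 (le_trans ut).
have mB u : 0 <= u -> u <= t ->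
    measurable_fun (setT : set (g_sigma_algebraType (F t))) (fun w => path_of B w u).
  move=> u0 ut; rewrite (_ : (fun w => _) = B u).
    by apply: mX => //; case: B_fBm.
  by apply/funext => w; rewrite /path_of clampE// in_itv/= u0 (le_trans ut).
have h := @measurable_step_series_jumps _ (g_sigma_algebraType (F t)) R H rho K J t
  (fun u w => path_of B w u) z rho01 mB (fun u => mX z u z_adapted).
by have := h measurableT A mA; rewrite setTI (measurable_g_measurableTypeE sF).
Qed.

Let grid01 n k : (k <= npts n)%N -> grid n k \in `[0, 1].
Proof. by move=> /(grid_itv rho01)/andP[h1 h2]; rewrite in_itv/= h1 ltW. Qed.

Let time01 n : stage_time n \in `[0, 1].
Proof. by have /andP[h1 h2] := stage_time_itv rho01 n; rewrite in_itv/= h1 ltW. Qed.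

Lemma ae_hit : {ae P, forall w, exists n0, forall n, (n0 <= n)%N ->
  level n <= (B (stage_time n.+1) w - B (stage_time n) w) ^+ 2}.
Proof.
pose A n := [set w | (B (stage_time n.+1) w - B (stage_time n) w) ^+ 2 < level n].
have mA n : measurable (A n).
  have mt m := fbm_measurable F_filtration B_fBm (time01 m).
  have m1 := mt n.+1; have m2 := mt n.
  have mf : measurable_fun setT (fun w => (B (stage_time n.+1) w - B (stage_time n) w) ^+ 2 < level n).
    apply: measurable_fun_ltr; last exact: measurable_cst.
    by apply: measurable_funX; exact: measurable_funB.
  by have := mf measurableT [set true] I; rewrite setTI.
have PA n : (P (A n) <= (4 * 2^-1 ^+ n)%:E)%E.
  have st : stage_time n != stage_time n.+1.
    by rewrite stage_timeS lt_eqF// ltrDl gap_gt0.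
  have e0 : 0 < 2^-1 ^+ n :> R by rewrite exprn_gt0.
  have := fbm_small_ball F_filtration H0 B_fBm (time01 n) (time01 n.+1) st e0.
  rewrite (_ : `|stage_time n.+1 - stage_time n| = gap rho n)//.
  by rewrite stage_timeS addrC addKr gtr0_norm ?gap_gt0.
have := @ae_eventually_notin _ _ _ P A 4 (ler0n _ 4) mA PA.
apply: filterS => w [n0 h]; exists n0 => n /h /negP; rewrite -leNgt.
by [].
Qed.

Hypothesis H_gt : 2^-1 < H.
(* The expected quadratic variation of stage n is then at most 8^-n gap^(2H),
   against a level of order 4^-n gap^(2H). *)
Hypothesis K_large : (2 ^+ K) `^ (1 - 2 * H) <= 8^-1.

Lemma ae_fine_grid th : 0 < th -> {ae P, forall w, exists n0, forall n, (n0 <= n)%N ->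
  \sum_(k < npts n) (B (grid n k.+1) w - B (grid n k) w) ^+ 2 <= th ^+ 2 * level n}.
Proof.
move=> th0.
pose Q n w := \sum_(k < npts n) (B (grid n k.+1) w - B (grid n k) w) ^+ 2.
have Q0 n w : 0 <= Q n w by apply: sumr_ge0 => k _; exact: sqr_ge0.
have mG n k : (k < npts n)%N ->
    measurable_fun setT (fun w => (B (grid n k.+1) w - B (grid n k) w) ^+ 2).
  move=> kn; apply: measurable_funX; apply: measurable_funB.
    exact: (fbm_measurable F_filtration B_fBm (grid01 kn)).
  exact: (fbm_measurable F_filtration B_fBm (grid01 (ltnW kn))).
have mQ n : measurable_fun setT (Q n) by apply: measurable_sum => k; exact: mG.
have th2 : 0 < th ^+ 2 by rewrite exprn_gt0.
pose A n := [set w | th ^+ 2 * level n <= Q n w].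
have mA n : measurable (A n).
  have mf : measurable_fun setT (fun w => th ^+ 2 * level n <= Q n w).
    by apply: measurable_fun_ler => //; exact: measurable_cst.
  by have := mf measurableT [set true] I; rewrite setTI.
have EQ n : (\int[P]_w (Q n w)%:E <= (level n * 2^-1 ^+ n)%:E)%E.
  have g0 := gap_gt0 rho01 n.
  have N0 : 0 < (npts n)%:R :> R by rewrite ltr0n npts_gt0.
  have int_incr k : (k < npts n)%N ->
      (\int[P]_w ((B (grid n k.+1) w - B (grid n k) w) ^+ 2)%:E =
       ((gap rho n / (npts n)%:R) `^ (2 * H))%:E)%E.
    move=> kn; rewrite (fbm_integral_sqr F_filtration H0 B_fBm (grid01 (ltnW kn)) (grid01 kn)).
    by rewrite grid_step gtr0_norm// divr_gt0.
  under eq_integral do rewrite -sumEFin.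
  rewrite ge0_integral_sum//; last 2 first.
  - by move=> k; apply/measurable_EFinP; exact: mG.
  - by move=> k w _; rewrite lee_fin sqr_ge0.
  rewrite (eq_bigr (fun=> ((gap rho n / (npts n)%:R) `^ (2 * H))%:E)); last first.
    by move=> k _; exact: int_incr.
  rewrite sumEFin_const lee_fin powRM ?invr_ge0// ?(ltW g0)// -powR_inv1// -powRrM mulrCA.
  rewrite -{1}(powRr1 (ltW N0)) -powRD_gt0// mulN1r.
  rewrite {1}/npts expnM natrX natrX exprn_powR ?exprn_ge0//.
  set y := gap rho n `^ (2 * H); set x := (_ `^ _) ^+ n.
  have -> : level n * 2^-1 ^+ n = y * (8^-1) ^+ n.
    rewrite /level /radius exprMn (_ : (gap rho n `^ H) ^+ 2 = y); last first.
      by rewrite /y mulrC powRrM powR_mulrn// powR_ge0.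
    rewrite (_ : 8^-1 = 2^-1 * 2^-1 * 2^-1 :> R); last by field.
    by rewrite !exprMn; ring.
  apply: ler_wpM2l; first exact: powR_ge0.
  by apply: lerXn2r; rewrite ?nnegrE ?powR_ge0.
have PA n : (P (A n) <= (th ^- 2 * 2^-1 ^+ n)%:E)%E.
  have l0 := level_gt0 H rho01 n.
  have := @le_integral_abse _ _ _ P setT measurableT (fun w => (Q n w)%:E) (th ^+ 2 * level n).
  have a0 : 0 < th ^+ 2 * level n by rewrite mulr_gt0.
  have mQ' : measurable_fun setT (fun w => (Q n w)%:E) by exact/measurable_EFinP.
  move=> /(_ mQ' a0); rewrite setTI.
  rewrite (_ : [set x | _] = A n); last first.
    by apply/seteqP; split => w /=; rewrite lee_fin ger0_norm.
  under eq_integral do rewrite /= ger0_norm//.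
  move=> /le_trans/(_ (EQ n)); rewrite -lee_pdivlMl// -EFinM.
  rewrite (_ : (th ^+ 2 * level n)^-1 * (level n * 2^-1 ^+ n) = th ^- 2 * 2^-1 ^+ n)//.
  by rewrite invfM mulrA mulfVK// gt_eqF.
have := @ae_eventually_notin _ _ _ P A (th ^- 2) _ mA PA.
rewrite invr_ge0 (ltW th2) => /(_ isT); apply: filterS => w [n0 h]; exists n0 => n /h /negP.
by rewrite -ltNge => /ltW.
Qed.

End fbm_stages.

Lemma exists_grid_exponent (R : realType) (H : R) : 2^-1 < H ->
  exists K : nat, (2 ^+ K) `^ (1 - 2 * H) <= 8^-1 :> R.
Proof.
move=> H_gt; have h0 : 0 < 2 * H - 1.
  by rewrite subr_gt0 -(@ltr_pdivrMl _ 2)// mulr1.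
pose K := (Num.truncn (3 / (2 * H - 1))).+1; exists K.
have hK : 3 <= K%:R * (2 * H - 1).
  have /andP[_ h] := Num.Theory.truncn_itv (divr_ge0 (ler0n R 3) (ltW h0)).
  rewrite -ler_pdivrMr//; exact: (ltW h).
rewrite -powR_mulrn// -powRrM.
apply: (@le_trans _ _ (2 `^ (- 3))).
  by apply: ler_powR; [rewrite ler1n|move: hK; lra].
by rewrite powRN -[3]/(3%:R) powR_mulrn// -natrX.
Qed.

Lemma exists_ratio (R : realType) (H a al : R) (K : nat) : 0 < a + (1 - al) - H ->
  exists2 rho : R, 0 < rho < 1 & rho `^ a * rho `^ (1 - al) / rho `^ H * 2 ^+ K.+1 <= 2^-1.
Proof.
set eta := _ - H => eta0; pose rho : R := 2 `^ (- K.+2%:R / eta).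
have rho0 : 0 < rho by rewrite powR_gt0.
exists rho.
  rewrite rho0/= /rho /powR gt_eqF// -[ltRHS]expR0 ltr_expR.
  by rewrite mulNr mulNr oppr_lt0 mulr_gt0 ?divr_gt0// ln_gt0 ?ltr1n.
rewrite -powRN -!powRD_gt0// -/eta /rho -powRrM divfK ?gt_eqF// powRN powR_mulrn//.
by rewrite exprS invfM mulfVK// expf_neq0.
Qed.

Theorem theorem3p3 (d : measure_display) (T : measurableType d) (R : realType)
    (P : probability T R) (P_complete : measure_is_complete P)
    (F : R -> set (set T)) (F_filtration : filtration F)
    (F_complete : complete_filtration P F)
    (F_left_continuous : left_continuous_filtration F)
    (H : R) (H_gt : 2^-1 < H) (H_lt1 : H < 1)
    (B : R -> T -> R) (B_fBm : fractional_brownian_motion P F H B)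
    (xi : {RV P >-> R}) (a : R) (a_gt0 : 0 < a)
    (z : R -> T -> R) (z_adapted : adapted F z)
    (z_holder : {ae P, forall w, holder_on_unit a (fun t => z t w)})
    (z1_xi : {ae P, forall w, z 1 w = xi w})
    (alpha : R) (alpha_gt : 1 - H < alpha)
    (alpha_lt : alpha < Num.min (1 - H + a) 2^-1) :
  exists psi : R -> T -> R,
    [/\ adapted F psi,
        {ae P, forall w, finite_norm_alpha alpha (fun t => psi t w) 1} &
        {ae P, forall w,
          gLS_integral alpha (fun t => psi t w) (fun t => B t w) 1 = xi w}].
Proof.
move: alpha_lt; rewrite lt_min => /andP[al_a al_2].
have H0 : 0 < H by apply: lt_trans H_gt; rewrite invr_gt0.
have al01 : 0 < alpha < 1 by apply/andP; split; lra.
have [K hK] := exists_grid_exponent H_gt.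
have eta0 : 0 < a + (1 - alpha) - H by lra.
have [rho rho01 hrho] := exists_ratio K eta0.
have [J HJ] := exists_stage_index rho01.
pose psi t w := step_series (jumps H rho K (path_of B w) (z ^~ w)) J t.
have th0 : 0 < rho `^ a / 4 by rewrite divr_gt0// powR_gt0//; case/andP: rho01.
have h1 := ae_hit F_filtration H0 B_fBm rho01.
have h2 := ae_fine_grid F_filtration H0 B_fBm rho01 hK th0.
have h3 : {ae P, forall w, forall n k, (k <= npts K n)%N ->
    (\int[lebesgue_measure]_(x in `]0%R, 1%R[)
      ((rl_step alpha (grid rho K n k) x)%:E * rl_abs alpha (path_of B w) x) < +oo)%E}.
  apply: ae_foralln => n; apply: ae_foralln => k.
  have [kn|kn] := leqP k (npts K n); last exact: aeW.
  have gi := grid_itv rho01 kn.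
  apply: filterS (@ae_integral_rl_abs_lty _ _ _ P F F_filtration H B H0 B_fBm alpha al01
    alpha_gt (fun x => (rl_step alpha (grid rho K n k) x)%:E) _ _ _) => //.
  - by apply/measurable_EFinP; exact: measurable_rl_step.
  - by move=> x; rewrite lee_fin rl_step_ge0.
  - by rewrite integral_rl_step// ltry.
have h4 : {ae P, forall w, forall n k, (k <= npts K n)%N ->
    (\int[lebesgue_measure]_(y in `]grid rho K n k, 1%R[)
      (`|path_of B w y - path_of B w (grid rho K n k)| * (y - grid rho K n k) `^ (-1))%:E < +oo)%E}.
  apply: ae_foralln => n; apply: ae_foralln => k.
  have [kn|kn] := leqP k (npts K n); last exact: aeW.
  by apply: filterS (ae_increment_quot_lty F_filtration H0 B_fBm (grid_itv rho01 kn)).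
have h5 := ae_integral_rl_abs_lty F_filtration H0 B_fBm al01 alpha_gt
  (measurable_majorant_series H a alpha K rho01) (majorant_series_ge0 H a alpha K rho01)
  (integral_majorant_series_lty rho01 al01 hrho).
have main : {ae P, forall w, finite_norm_alpha alpha (psi ^~ w) 1 /\
    gLS_integral alpha (psi ^~ w) (path_of B w) 1 = xi w}.
  apply: filter_app z1_xi; apply: filter_app z_holder; apply: filter_app h5.
  apply: filter_app h4; apply: filter_app h3; apply: filter_app h2.
  apply: filterS h1 => w [n1 w1] [n2 w2] w3 w4 w5 w6 <-.
  have pg n k : (k <= npts K n)%N -> path_of B w (grid rho K n k) = B (grid rho K n k) w.
    by move=> kn; rewrite /path_of clampE// in_itv/=; have /andP[-> /ltW ->] := grid_itv rho01 kn.
  have pt n : path_of B w (stage_time rho n) = B (stage_time rho n) w.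
    by rewrite -(grid0 rho K) pg.
  apply: (@pathwise_integral _ H rho a alpha K J rho01 al01 a_gt0 hrho HJ (path_of B w) (z ^~ w)
    (maxn n1 n2)) => //.
  - exact: (clamped_path_continuous B_fBm).
  - by move=> n; rewrite geq_max => /andP[n1n _]; rewrite !pt; exact: w1.
  - move=> n; rewrite geq_max => /andP[_ n2n]; apply: le_trans (w2 n n2n).
    by rewrite le_eqVlt; apply/orP; left; apply/eqP; apply: eq_bigr => k _; rewrite !pg// ltnW.
exists psi; split.
- exact: (adapted_step_series_jumps F_filtration B_fBm K rho01 J z_adapted).
- by apply: filterS main => w [].
- apply: filterS main => w [_ <-]; rewrite /gLS_integral; congr (_ * _).
  have pB x : x \in `[0, 1] -> B x w = path_of B w x by move=> x01; rewrite /path_of clampE.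
  apply: eq_Rintegral => x; rewrite inE/= => x01.
  rewrite (pB x x01) (pB 1) ?in_itv/= ?ler01 ?lexx//; congr (_ * (_ + _ * _)).
  apply: eq_Rintegral => u; rewrite inE/= !in_itv/= => /andP[xu u1].
  rewrite (pB u)// in_itv/= u1 andbT (le_trans _ xu)//.
  by move: x01; rewrite in_itv/= => /andP[].
Qed.
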